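(* Let $G$ be a graph on a linearly ordered set of edges $E$. 1. For any orientation $\vec G$ of $G$, $\alpha(\vec G)$ is well defined, and its inductive, sequential and relaxed definitions (given in the context) are equivalent. 2. For any orientation $\vec G$ of $G$, $\alpha(\vec G)$ is a spanning tree of $G$ with the same active filtration as $\vec G$, which implies in particular $\mathrm{Int}(\alpha(\vec G))=O^*(\vec G)$ and $\mathrm{Ext}(\alpha(\vec G))=O(\vec G)$. 3. The $2^{i+j}$ orientations of $G$ in a given activity class with activity $j$ and dual-activity $i$ are mapped onto the same spanning tree by $\alpha$. 4. The mapping $\vec G\mapsto\alpha(\vec G)$ from orientations of $G$ to spanning trees of $G$ is surjective. It provides a bijection between all activity classes of orientations of $G$ and all spanning trees of $G$ (there are $t(G;1,1)$ of each). It restricts to bijections: between activity classes of acyclic orientations and internal spanning trees ($t(G;1,0)$ of each); between activity classes of strongly connected orientations and external spanning trees ($t(G;0,1)$ of each); between bipolar orientations w.r.t. $\min(E)$, up to opposite, and uniactive internal spanning trees ($t_{1,0}$ of each); between cyclic-bipolar orientations w.r.t. $\min(E)$, up to opposite, and uniactive external spanning trees ($t_{0,1}$ of each).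
   Context: Graphs are finite, may have loops and multiple edges, and are connected unless they arise as minors (isolated vertices are ignored, and for a disconnected graph ''spanning tree'' means maximal spanning forest). For $F\subseteq E$, $G(F)$ is the restriction of $G$ to $F$ (deletion of $E\setminus F$) and $G/F$ is the contraction of $F$; similarly for digraphs. Cycles and cocycles (inclusion-minimal non-empty edge cuts) are edge subsets. Minors inherit the linear order. An orientation $\vec G$ of $G$ is a digraph with underlying graph $G$; $-_A\vec G$ is obtained by reversing the edges in $A$; the opposite of $\vec G$ is $-_E\vec G$. A cycle is directed if its edges are consistently oriented along it; a cocycle is directed if all its edges go from one side of the cut to the other. Acyclic means no directed cycle; strongly connected means every edge is in a directed cycle. $\subset$ is strict inclusion, $\uplus$ disjoint union. Spanning trees. For a spanning tree $T$ of $G$, $b\in T$, $e\notin T$: $C^*(T;b)$ is the unique cocycle contained in $(E\setminus T)\cup\{b\}$, $C(T;e)$ is the unique cycle contained in $T\cup\{e\}$. $\mathrm{Int}(T)=\{b\in T: b=\min C^*(T;b)\}$, $\mathrm{Ext}(T)=\{e\in E\setminus T: e=\min C(T;e)\}$. $T$ is internal if $\mathrm{Ext}(T)=\emptyset$, external if $\mathrm{Int}(T)=\emptyset$, uniactive internal if $|\mathrm{Int}(T)|=1,|\mathrm{Ext}(T)|=0$, uniactive external if $|\mathrm{Int}(T)|=0,|\mathrm{Ext}(T)|=1$. The Tutte polynomial is $t(G;x,y)=\sum t_{\iota,\varepsilon}x^\iota y^\varepsilon$ with $t_{\iota,\varepsilon}$ the number of spanning trees with $|\mathrm{Int}(T)|=\iota$,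 $|\mathrm{Ext}(T)|=\varepsilon$. Orientations. $O(\vec G)$ (active edges) is the set of smallest edges of directed cycles of $\vec G$, $O^*(\vec G)$ (dual-active edges) the set of smallest edges of directed cocycles; the activity is $|O(\vec G)|$, the dual-activity is $|O^*(\vec G)|$. $\vec G$ is bipolar w.r.t. an edge $p$ if every edge is in a directed cocycle and every directed cocycle contains $p$ (i.e. it is acyclic with unique source and unique sink, the extremities of $p$); cyclic-bipolar w.r.t. $p$ if every edge is in a directed cycle and every directed cycle contains $p$. Let $a_1<\cdots<a_\iota$ be the dual-active edges and $a'_1<\cdots<a'_\varepsilon$ the active edges. The active filtration of $\vec G$ is $\emptyset=F'_\varepsilon\subset\cdots\subset F'_0=F_c=F_0\subset\cdots\subset F_\iota=E$, where $F_c$ is the union of all directed cycles, $F_k=E\setminus\bigcup\{D\text{ directed cocycle}:\min(D)\ge a_{k+1}\}$ for $0\le k\le\iota-1$, $F'_k=\bigcup\{C\text{ directed cycle}:\min(C)\ge a'_{k+1}\}$ for $0\le k\le\varepsilon-1$. The active partition of $\vec G$ is the partition of $E$ into the parts $F_k\setminus F_{k-1}$ ($1\le k\le\iota$) and $F'_{k-1}\setminus F'_k$ ($1\le k\le\varepsilon$). The activity class of $\vec G$ is the set of all orientations obtained from $\vec G$ by reversing all edges in any union of parts of its active partition. Active filtration of a spanning tree. A filtration of $G$ is a sequence of subsets $\emptyset=F'_\varepsilon\subset\cdots\subset F'_0=F_c=F_0\subset\cdots\subset F_\iota=E$ with $\min(F_k\setminus F_{k-1})$ ($1\le k\le\iota$)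 increasing with $k$ and $\min(F'_{k-1}\setminus F'_k)$ ($1\le k\le\varepsilon$) increasing with $k$. The active filtration of a spanning tree $T$ is the unique filtration of $G$ such that $T\cap(F_k\setminus F_{k-1})$ is a uniactive internal spanning tree of $G(F_k)/F_{k-1}$ for $1\le k\le\iota$ and $T\cap(F'_{k-1}\setminus F'_k)$ is a uniactive external spanning tree of $G(F'_{k-1})/F'_k$ for $1\le k\le\varepsilon$. Definition of $\alpha$ in the (cyclic-)bipolar case. Two edges of a cycle have the same (opposite) directions in it if they are oriented the same way (opposite ways) along it; two edges of a cocycle have the same (opposite) directions in it if they cross the cut in the same (opposite) way. If $\vec G$ is bipolar w.r.t. $p=\min(E)$, $\alpha(\vec G)$ is the unique spanning tree $T$ (existence and uniqueness being a known theorem) such that for all $b\in T\setminus\{p\}$, $b$ and $\min C^*(T;b)$ have opposite directions in $C^*(T;b)$, and for all $e\in E\setminus T$, $e$ and $\min C(T;e)$ have opposite directions in $C(T;e)$. If $\vec G$ is cyclic-bipolar w.r.t. $p=\min(E)$, $\alpha(\vec G)$ is the unique spanning tree $T$ such that for all $b\in T$, $b$ and $\min C^*(T;b)$ have opposite directions in $C^*(T;b)$, and for all $e\in(E\setminus T)\setminus\{p\}$, $e$ and $\min C(T;e)$ have opposite directions in $C(T;e)$ (equivalently, if $|E|>1$, $\alpha(\vec G)=(\alpha(-_p\vec G)\setminus\{p\})\cup\{p'\}$, with $p'$ the second smallest edge). Also $\alpha=\emptyset$ on the empty edge set. Three definitions of $\alpha$ for general ordered digraphs, extending the (cyclic-)bipolar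 case. Inductive definition: $\alpha(\vec G)=\alpha(\vec G/F)\uplus\alpha(\vec G(F))$ both when $F$ is the union of all directed cycles whose smallest element is the greatest active element of $\vec G$, and when $F$ is the complement of the union of all directed cocycles whose smallest element is the greatest dual-active element of $\vec G$. Sequential definition: with the active filtration of $\vec G$, $\alpha(\vec G)=\biguplus_{1\le k\le\iota}\alpha(\vec G(F_k)/F_{k-1})\uplus\biguplus_{1\le k\le\varepsilon}\alpha(\vec G(F'_{k-1})/F'_k)$ (these minors are respectively bipolar and cyclic-bipolar w.r.t. their smallest edge). Relaxed definition: $\alpha(\vec G)=\alpha(\vec G/F)\uplus\alpha(\vec G(F))$ whenever $F$ is either the union of all directed cycles of $\vec G$ whose smallest edge is greater than a fixed edge, or the complement of the union of all directed cocycles of $\vec G$ whose smallest edge is greater than a fixed edge. *)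

(* Defs.v *)
From HB Require Import structures.
From mathcomp Require Import all_boot all_order all_algebra.

Set Implicit Arguments.
Unset Strict Implicit.
Unset Printing Implicit Defensive.

Import Order.TTheory GRing.Theory.

Section OrderedSets.
Context {d : Order.disp_t} {E : finOrderType d}.
Implicit Types (A B : {set E}) (e : E).

Definition is_min A e : bool := (e \in A) && [forall f in A, (e <= f)%O].

Definition is_max A e : bool := (e \in A) && [forall f in A, (f <= e)%O].

Definition min_lt A B : bool :=
  [exists a, exists b, [&& is_min A a, is_min B b & (a < b)%O]].

(* For a non-empty A: min A >= e and min A > e. *)
Definition min_ge e A : bool := [forall f in A, (e <= f)%O].
Definition min_gt e A : bool := [forall f in A, (e < f)%O].

Definition disjoint_union (l : seq {set E}) (T : {set E}) : Prop :=
  pairwise (fun A B : {set E} => [disjoint A & B]) l /\ T = \bigcup_(A <- l) A.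

End OrderedSets.

(* Multigraphs with loops. The ambient vertex type V and the ambient ordered
   type E of edge names are shared by a graph and all its minors; the edges of
   the graph are those in [edges], and [ends] is irrelevant elsewhere.  The two
   ends of an edge are listed in an arbitrary order, which only serves as a
   reference for encoding orientations by signs. *)
Record graph (V : finType) (d : Order.disp_t) (E : finOrderType d) :=
  Graph { edges : {set E}; ends : E -> V * V }.

(* Edge e is directed from (ends e).1 to (ends e).2 if s e = false, and the
   other way if s e = true.  In particular a loop has two orientations, so that
   a graph with all of E as edge set has exactly 2 ^ #|E| orientations. *)
Definition orientation (d : Order.disp_t) (E : finOrderType d) : finType :=
  {ffun E -> bool}.

(* A filtration F'_eps < .. < F'_0 = F_c = F_0 < .. < F_iota is stored as
   F_c, the list F_1, .., F_iota, and the list F'_1, .., F'_eps. *)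
Record filtration (d : Order.disp_t) (E : finOrderType d) :=
  Filtration { fcyc : {set E}; fup : seq {set E}; fdown : seq {set E} }.

Section Graphs.
Context {V : finType} {d : Order.disp_t} {E : finOrderType d}.
Implicit Types (G : graph V E) (s : orientation E) (p e f b : E).
Implicit Types (A B C F T : {set E}) (X : {set V}) (D : {set E * bool}).

Definition adj G F : rel V := fun x y =>
  [exists e in F, (ends G e == (x, y)) || (ends G e == (y, x))].

Definition connected G : Prop := forall x y : V, connect (adj G (edges G)) x y.

Definition restrict G F : graph V E := Graph (edges G :&: F) (ends G).

(* Every vertex is replaced by a representative of its connected component in
   F; the vertices that do not represent a component become isolated, and
   isolated vertices are ignored. *)
Definition contract G F : graph V E :=
  let rep := fingraph.root (adj G (edges G :&: F)) in
  Graph (edges G :\: F) (fun e => (rep (ends G e).1, rep (ends G e).2)).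

(* G(F) / F' for the pair (F', F) *)
Definition minor G (FF : {set E} * {set E}) : graph V E :=
  contract (restrict G FF.2) FF.1.

(* A dart (e, c) is the edge e traversed in the direction it has in the
   orientations s such that s e = c. *)
Definition dtail G (x : E * bool) : V :=
  if x.2 then (ends G x.1).2 else (ends G x.1).1.
Definition dhead G (x : E * bool) : V := dtail G (x.1, ~~ x.2).

Definition dedges D : {set E} := [set x.1 | x in D].

(* D is the set of darts of a closed walk without repeated edge or vertex. *)
Definition circuit G D : bool :=
  [exists k : 'I_#|E|.+1, exists w : k.-tuple (E * bool),
    [&& D == [set x in w], 0 < k, all (fun x => x.1 \in edges G) w,
        uniq [seq x.1 | x <- w], uniq [seq dtail G x | x <- w]
      & cycle (fun x y => dhead G x == dtail G y) w]].

Definition is_cycle G C : bool := [exists D, circuit G D && (dedges D == C)].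

Definition cut_darts G X : {set E * bool} :=
  [set x | [&& x.1 \in edges G, dtail G x \in X & dhead G x \notin X]].

Definition is_cocycle G C : bool :=
  minset [pred A : {set E} | (A != set0)
                           && [exists X, dedges (cut_darts G X) == A]] C.

Definition cocircuit G D : bool :=
  is_cocycle G (dedges D) && [exists X, cut_darts G X == D].

Definition directed s D : bool := [forall x in D, x.2 == s x.1].

Definition directed_cycle G s C : bool :=
  [exists D, [&& circuit G D, dedges D == C & directed s D]].

Definition directed_cocycle G s C : bool :=
  [exists D, [&& cocircuit G D, dedges D == C & directed s D]].

Definition opposite_in s D e f : bool :=
  [&& e \in dedges D, f \in dedges D
    & ((e, s e) \in D) != ((f, s f) \in D)].

(* e and min C have opposite directions in the cycle (resp. cocycle) C. *)
Definition opp_min_cycle G s C e : bool :=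
  [exists D, [&& circuit G D, dedges D == C
               & [exists m, is_min C m && opposite_in s D e m]]].
Definition opp_min_cocycle G s C e : bool :=
  [exists D, [&& cocircuit G D, dedges D == C
               & [exists m, is_min C m && opposite_in s D e m]]].

Definition spanning_tree G T : bool :=
  [&& T \subset edges G,
      [forall C, is_cycle G C ==> ~~ (C \subset T)]
    & [forall x, forall y,
         connect (adj G (edges G)) x y ==> connect (adj G T) x y]].

Definition fund_cocycle G T b : {set E} :=
  odflt set0 [pick C | is_cocycle G C & C \subset b |: (edges G :\: T)].
Definition fund_cycle G T e : {set E} :=
  odflt set0 [pick C | is_cycle G C & C \subset e |: T].

Definition Int G T : {set E} := [set b in T | is_min (fund_cocycle G T b) b].
Definition Ext G T : {set E} :=
  [set e in edges G :\: T | is_min (fund_cycle G T e) e].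

Definition internal_tree G T : bool := spanning_tree G T && (Ext G T == set0).
Definition external_tree G T : bool := spanning_tree G T && (Int G T == set0).
Definition uniactive_internal G T : bool :=
  [&& spanning_tree G T, #|Int G T| == 1 & #|Ext G T| == 0].
Definition uniactive_external G T : bool :=
  [&& spanning_tree G T, #|Int G T| == 0 & #|Ext G T| == 1].

Definition tutte_coef G (i j : nat) : nat :=
  #|[set T | [&& spanning_tree G T, #|Int G T| == i & #|Ext G T| == j]]|.

(* As in polyXY, the outer indeterminate is x and the inner one is y. *)
Definition tutte G : {poly {poly int}} :=
  (\sum_(i < #|E|.+1) \sum_(j < #|E|.+1)
     (tutte_coef G i j)%:R * 'Y ^+ j * 'X ^+ i)%R.

Definition reverse A s : orientation E := [ffun e => (e \in A) (+) s e].
Definition opposite s : orientation E := reverse [set: E] s.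

Definition acyclic G s : bool := [forall C, ~~ directed_cycle G s C].
Definition strongly_connected G s : bool :=
  [forall e in edges G, exists C, directed_cycle G s C && (e \in C)].

Definition active G s : {set E} :=
  [set e | [exists C, directed_cycle G s C && is_min C e]].
Definition dual_active G s : {set E} :=
  [set e | [exists C, directed_cocycle G s C && is_min C e]].

Definition bipolar G s p : bool :=
  [&& p \in edges G,
      [forall e in edges G, exists C, directed_cocycle G s C && (e \in C)]
    & [forall C, directed_cocycle G s C ==> (p \in C)]].
Definition cyclic_bipolar G s p : bool :=
  [&& p \in edges G,
      [forall e in edges G, exists C, directed_cycle G s C && (e \in C)]
    & [forall C, directed_cycle G s C ==> (p \in C)]].

(* The pairs (F_(k-1), F_k) and (F'_k, F'_(k-1)), for k = 1, 2, .. *)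
Definition up_steps (Fs : filtration E) : seq ({set E} * {set E}) :=
  zip (fcyc Fs :: fup Fs) (fup Fs).
Definition down_steps (Fs : filtration E) : seq ({set E} * {set E}) :=
  zip (fdown Fs) (fcyc Fs :: fdown Fs).

Definition part (FF : {set E} * {set E}) : {set E} := FF.2 :\: FF.1.

Definition is_filtration G (Fs : filtration E) : bool :=
  [&& path (fun A B : {set E} => A \proper B) (fcyc Fs) (fup Fs),
      last (fcyc Fs) (fup Fs) == edges G,
      path (fun A B : {set E} => B \proper A) (fcyc Fs) (fdown Fs),
      last (fcyc Fs) (fdown Fs) == set0,
      sorted min_lt [seq part FF | FF <- up_steps Fs]
    & sorted min_lt [seq part FF | FF <- down_steps Fs]].

Definition sort_set A : seq E := sort <=%O (enum A).

(* With a_1 < .. < a_iota the dual-active edges, the list under the first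
   [behead] is F_0, .., F_(iota-1), E, where F_k is determined by a_(k+1);
   similarly for F'_0, .., F'_(eps-1), set0 with the active edges. *)
Definition active_filtration G s : filtration E :=
  Filtration
    (\bigcup_(C | directed_cycle G s C) C)
    (behead (rcons
       [seq edges G :\: \bigcup_(C | directed_cocycle G s C && min_ge a C) C
       | a <- sort_set (dual_active G s)]
       (edges G)))
    (behead (rcons
       [seq \bigcup_(C | directed_cycle G s C && min_ge a C) C
       | a <- sort_set (active G s)]
       set0)).

Definition active_partition G s : {set {set E}} :=
  let Fs := active_filtration G s in
  [set A in [seq part FF | FF <- up_steps Fs ++ down_steps Fs]].

Definition activity_class G s : {set orientation E} :=
  [set reverse (cover Q) s | Q in powerset (active_partition G s)].

Definition tree_filtration G T (Fs : filtration E) : bool :=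
  [&& is_filtration G Fs,
      all (fun FF => uniactive_internal (minor G FF) (T :&: part FF))
          (up_steps Fs)
    & all (fun FF => uniactive_external (minor G FF) (T :&: part FF))
          (down_steps Fs)].

(* The characterization of alpha(G) when G is bipolar, resp. cyclic-bipolar,
   with respect to p = min(E). *)
Definition bipolar_tree G s p T : bool :=
  [&& spanning_tree G T,
      [forall b in T, (b != p) ==> opp_min_cocycle G s (fund_cocycle G T b) b]
    & [forall e in edges G :\: T, opp_min_cycle G s (fund_cycle G T e) e]].
Definition cyclic_bipolar_tree G s p T : bool :=
  [&& spanning_tree G T,
      [forall b in T, opp_min_cocycle G s (fund_cocycle G T b) b]
    & [forall e in edges G :\: T,
         (e != p) ==> opp_min_cycle G s (fund_cycle G T e) e]].

Definition tree_map := graph V E -> orientation E -> {set E}.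
Implicit Type alpha : tree_map.

Definition extends_bipolar alpha : Prop := forall G s,
  [/\ edges G = set0 -> alpha G s = set0,
      forall p, is_min (edges G) p -> bipolar G s p ->
        forall T, bipolar_tree G s p T <-> T = alpha G s
    & forall p, is_min (edges G) p -> cyclic_bipolar G s p ->
        forall T, cyclic_bipolar_tree G s p T <-> T = alpha G s].

Definition splits_at alpha G s F : Prop :=
  disjoint_union [:: alpha (contract G F) s; alpha (restrict G F) s]
                 (alpha G s).

Definition alpha_inductive alpha : Prop :=
  extends_bipolar alpha /\ forall G s,
    (forall a, is_max (active G s) a ->
       splits_at alpha G s (\bigcup_(C | directed_cycle G s C && is_min C a) C))
    /\
    (forall a, is_max (dual_active G s) a ->
       splits_at alpha G s
         (edges G :\: \bigcup_(C | directed_cocycle G s C && is_min C a) C)).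

Definition alpha_sequential alpha : Prop :=
  extends_bipolar alpha /\ forall G s,
    let Fs := active_filtration G s in
    disjoint_union
      [seq alpha (minor G FF) s | FF <- up_steps Fs ++ down_steps Fs]
      (alpha G s).

Definition alpha_relaxed alpha : Prop :=
  extends_bipolar alpha /\ forall G s e, e \in edges G ->
    splits_at alpha G s (\bigcup_(C | directed_cycle G s C && min_gt e C) C)
    /\
    splits_at alpha G s
      (edges G :\: \bigcup_(C | directed_cocycle G s C && min_gt e C) C).

(* a, defined on orientations, is constant on each set of orientations in K,
   and the induced map on K is a bijection onto the set of edge sets TT. *)
Definition induces_bijection (a : orientation E -> {set E})
    (K : {set {set orientation E}}) (TT : {set {set E}}) : Prop :=
  exists f : {set orientation E} -> {set E},
    [/\ forall k, k \in K -> forall s, s \in k -> a s = f k,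
        {in K &, injective f}
      & f @: K = TT].

End Graphs.

(* Main.v *)
From Stdlib Require Import Classical IndefiniteDescription.
Require Import Defs.
From mathcomp Require Import all_boot all_order all_algebra.
From mathcomp Require Import zify ring lra.

Set Implicit Arguments.
Unset Strict Implicit.
Unset Printing Implicit Defensive.

Import Order.TTheory GRing.Theory Num.Theory.

(** The active bijection, through linear algebra over the rationals.

    The tensions and the flows of a graph are two orthogonal spaces of vectors
    on its edges; their vectors of minimal support are, up to scaling, the
    signed cocycles and the signed cycles.  A spanning tree T yields for each
    edge f a fundamental vector u f, a tension if f is in T and a flow
    otherwise, and the matrix of these vectors is antisymmetric between T and
    its complement.  This picture is invariant under exchanging tensions with
    flows and T with its complement, so each argument is made for one side only
    and the other side is obtained by duality.

    Levels.  A filtration of the tree T is encoded by a map lev from edges to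
    integers: the part whose smallest edge is a gets the level rank(a) + 1 if
    it is an internal part and -(rank(a) + 1) if it is an external one, so that
    the sets of the filtration are the lower sets of lev.  That every part is
    uniactive amounts to three local conditions on lev ([levelling]), which
    form a recursion along the order of the edges; hence a tree has exactly one
    such filtration.  The sign conditions defining alpha in the bipolar minors
    say that every non-active edge f disagrees with the smallest edge of its
    fundamental set having the same level ([compat]).  An orientation s and a
    tree T satisfying them all are called optimal ([opt]), and alpha sends s to
    its optimal tree.

    From T to s.  If weights on the edges are of very different magnitudes, the
    combination of fundamental tensions with these weights has, at every
    non-active edge, the sign of its leading term, which [compat] controls
    ([tab_weights]).  This produces non-negative tensions and flows with
    prescribed supports, and orthogonality shows that they are as large as
    possible: an edge is in a directed cocycle with all its edges of rank at
    least j exactly if its level exceeds j ([pos_iff]).  So the active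
    filtration of s is the filtration of T.

    Uniqueness.  For two trees T and T' optimal for the same s, let x and x' be
    the tensions with entries w on the tree and entries exceeding w elsewhere,
    let y and y' be the flows with entries w' off the tree and entries
    exceeding w' on it, relatively to the signs of s and leaving aside the
    active edges, which belong to both trees or to none.  The sum of
    (x - x')(y' - y) over the edges is zero by orthogonality, although every
    term is non-negative and the terms of the symmetric difference of T and T'
    are positive ([opt_tree]).

    Existence.  An arbitrary subset A of E, seen as a sign vector v, lies
    between T minus its internally active edges and T plus its externally
    active ones for some tree T ([crapo_interval]).  Let s be the orientation
    optimal for T that agrees with v on the active edges.  By uniqueness s
    determines T, and then v, so that v |-> s is an injection of a finite set
    into itself, hence a surjection: every orientation has an optimal tree
    ([opt_exists]).

    The three definitions of alpha split the graph at lower sets of lev, to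
    which optimality restricts ([gopt_restrict], [gopt_contract]); conversely,
    each of them can always split at a lower set that is neither empty nor
    full unless there is a single level, which is the (cyclic-)bipolar case.
    Finally, two orientations have the same optimal tree exactly if they differ
    by a union of levels, which identifies the fibres of alpha with the
    activity classes. *)

(** * Ranks in a finite order *)

Section Ranks.
Context {d : Order.disp_t} {E : finOrderType d}.
Implicit Types (e f g : E).

Definition rk e : nat := #|[set f | (f < e)%O]|.

Lemma rk_lt e f : (rk e < rk f)%N = (e < f)%O.
Proof.
case: (ltP e f) => [ef | fe].
  apply: proper_card; apply/properP; split.
    by apply/subsetP => g; rewrite !inE => /lt_trans; apply.
  by exists e; rewrite !inE ?ltxx.
apply/negbTE; rewrite -leqNgt; apply: subset_leq_card.
by apply/subsetP => g; rewrite !inE => /lt_le_trans; apply.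
Qed.

Lemma rk_le e f : (rk e <= rk f)%N = (e <= f)%O.
Proof. by rewrite leqNgt rk_lt -leNgt. Qed.

Lemma rk_inj : injective rk.
Proof. by move=> e f ef; apply/le_anti; rewrite -!rk_le ef leqnn. Qed.

Lemma rk_max e : (rk e < #|E|)%N.
Proof.
apply: leq_trans (max_card [set f | (f <= e)%O]); apply: proper_card.
apply/properP; split; last by exists e; rewrite !inE ?ltxx.
by apply/subsetP => g; rewrite !inE => /ltW.
Qed.

Lemma order_rec (X : Type) (x0 : X) (body : (E -> X) -> E -> X) :
    (forall phi psi f,
       (forall g, (g < f)%O -> phi g = psi g) -> body phi f = body psi f) ->
  exists phi, forall f, phi f = body phi f.
Proof.
move=> bodyP; pose it n := iter n body (fun=> x0).
have itP n : forall f, (rk f < n)%N -> it n.+1 f = it n f.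
  elim: n => [//|n IHn] f fn; apply: bodyP => g; rewrite -rk_lt => gf.
  by apply: IHn; lia.
exists (it #|E|) => f; rewrite -[RHS]/(it #|E|.+1 f).
by rewrite itP ?rk_max.
Qed.

Lemma rk_ind (P : E -> Prop) :
  (forall f, (forall g, (g < f)%O -> P g) -> P f) -> forall f, P f.
Proof.
move=> IH f; have [n] := ubnP (rk f); elim: n f => // n IHn f fn.
by apply: IH => g; rewrite -rk_lt => gf; apply: IHn; lia.
Qed.

Implicit Type A : {set E}.

Lemma set_min A : A != set0 -> exists a, is_min A a.
Proof.
case/set0Pn=> e eA; case: (arg_minnP (P := fun g => g \in A) rk eA) => m mA
  mmin.
exists m; rewrite /is_min mA; apply/forallP => g; apply/implyP; rewrite -rk_le.
exact: mmin.
Qed.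

End Ranks.

(** * Vectors on the edges *)

Section Vectors.
Context {E : finType}.
Implicit Types (S T A : {set E}) (e f g h : E) (s : E -> bool).
Implicit Types (x y z : E -> rat).
Local Open Scope ring_scope.

(** Vectors are plain functions, so that closure under pointwise equality has
    to be part of the definition. *)
Record subspace S (V : (E -> rat) -> Prop) : Prop := Subspace {
  sub0 : V (fun=> 0);
  sub_lin : forall a b x y, V x -> V y -> V (fun e => a * x e + b * y e);
  sub_ext : forall x y, x =1 y -> V x -> V y;
  sub_supp : forall x e, V x -> x e != 0 -> e \in S }.

Lemma sub_sum S V (P : pred E) (c : E -> rat) (u : E -> E -> rat) :
    subspace S V -> (forall i, P i -> V (u i)) ->
  V (fun e => \sum_(i | P i) c i * u i e).
Proof.
move=> subV Vu.
suff IH (r : seq E) : V (fun e => \sum_(i <- r | P i) c i * u i e) by exact: IH.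
elim: r => [|i r IHr].
  by apply: (sub_ext subV) (sub0 subV) => e; rewrite big_nil.
have [Pi|nPi] := boolP (P i).
  apply: (sub_ext subV) (sub_lin subV (c i) 1 (Vu _ Pi) IHr) => e.
  by rewrite big_cons Pi mul1r.
by apply: (sub_ext subV) IHr => e; rewrite big_cons (negbTE nPi).
Qed.

Lemma sub_scale S V a x : subspace S V -> V x -> V (fun e => a * x e).
Proof.
move=> subV Vx; apply: (sub_ext subV) (sub_lin subV a 0 Vx Vx) => e.
by rewrite mul0r addr0.
Qed.

(** The sign of an edge for the orientation s, so that sg s e * x e > 0 means
    that x goes through e in the direction given by s. *)
Definition sg s e : rat := if s e then -1 else 1.

Lemma sgsg s e : sg s e * sg s e = 1.
Proof. by rewrite /sg; case: (s e); rewrite ?mulrNN mulr1. Qed.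

Lemma sg_neq0 s e : sg s e != 0.
Proof. by rewrite /sg; case: (s e). Qed.

Definition npos s x := forall e, 0 <= sg s e * x e.

(** The vectors of minimal support: the signed (co)cycles, up to scaling. *)
Definition elem (V : (E -> rat) -> Prop) x : Prop :=
  [/\ V x, exists e, x e != 0
    & forall z, V z -> (exists e, z e != 0) ->
        (forall e, z e != 0 -> x e != 0) -> forall e, x e != 0 -> z e != 0].

Lemma npos_gt0 s x e : npos s x -> x e != 0 -> 0 < sg s e * x e.
Proof. by move=> px xe; rewrite lt_def px mulf_neq0 ?sg_neq0. Qed.

Lemma sg_gt0_neq0 s x e : 0 < sg s e * x e -> x e != 0.
Proof. by apply: contraTneq => ->; rewrite mulr0 ltxx. Qed.

(** The ratio test of linear programming: moving from x in the direction - z,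
    the first coordinate that vanishes stops the move. *)
Lemma ratio_step s x z h :
    npos s x -> (forall e, z e != 0 -> x e != 0) -> 0 < sg s h * z h ->
  exists2 t, 0 < t & npos s (fun e => 1 * x e + - t * z e) /\
    exists2 g, x g != 0 & 1 * x g + - t * z g = 0.
Proof.
move=> px zx zh.
case: (arg_minP (P := [pred g | 0 < sg s g * z g]) (fun g => x g / z g) zh).
move=> g /= zg gmin; have zg0 := sg_gt0_neq0 zg; have xg0 := zx _ zg0.
have tE e : z e != 0 -> x e / z e = (sg s e * x e) / (sg s e * z e).
  by move=> ze; have sge := sg_neq0 s e; field; rewrite ze sge.
exists (x g / z g).
  by rewrite tE // divr_gt0 //; exact: npos_gt0.
split; last by exists g => //; rewrite mulNr divfK // mul1r subrr.
have tgt0: 0 < x g / z g by rewrite tE // divr_gt0 // npos_gt0.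
move=> e; have [ze|ze] := ltP 0 (sg s e * z e); last first.
  by have := px e; nra.
have := gmin _ ze; rewrite [leRHS]tE ?(sg_gt0_neq0 ze) // ler_pdivlMr //; nra.
Qed.

(** If a smaller support is possible, moving from x along some z, or along
    - z, kills a coordinate; one of the vectors obtained, or z itself, keeps
    the coordinate f, and induction on the size of the support applies. *)
Lemma conformal S V s x f :
    subspace S V -> V x -> npos s x -> x f != 0 ->
  exists z, [/\ elem V z, npos s z, z f != 0 & forall e, z e != 0 -> x e != 0].
Proof.
move=> subV; have [n] := ubnP #|[pred e | x e != 0]|.
elim: n x f => // n IHn x f xn Vx px xf.
have rec y : V y -> npos s y -> y f != 0 -> (forall e, y e != 0 -> x e != 0) ->
    (exists2 g, x g != 0 & y g = 0) ->
  exists z, [/\ elem V z, npos s z, z f != 0 & forall e, z e != 0 -> x e != 0].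
  move=> Vy py yf yx [g xg yg].
  have [|z [ez pz zf zy]] := IHn y f _ Vy py yf.
    apply: leq_trans (xn : (_ <= n)%N); apply: proper_card.
    by apply/properP; split; [apply/subsetP => e /yx | exists g;
      rewrite !inE ?yg ?eqxx].
  by exists z; split => // e /zy /yx.
have [ex|nex] := classic (elem V x); first by exists x.
have [z [Vz [e0 ze0] zx [e1 xe1 ze1]]] : exists z,
    [/\ V z, exists e, 0 < sg s e * z e, forall e, z e != 0 -> x e != 0
      & exists2 e, x e != 0 & z e = 0].
  apply: NNPP => noz; apply: nex; split=> //; first by exists f.
  move=> z Vz [e0 ze0] zx e xe; apply/negP => /eqP ze; apply: noz.
  have [pe0|] := ltP 0 (sg s e0 * z e0).
    by exists z; split=> //; [exists e0 | exists e].
  rewrite le_eqVlt mulf_eq0 (negbTE ze0) (negbTE (sg_neq0 _ _)) /= => ne0.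
  exists (fun e => -1 * z e); split; [exact: (sub_scale _ subV Vz) | exists e0 |
    |].
  - by rewrite mulN1r mulrN oppr_gt0.
  - by move=> g; rewrite mulN1r oppr_eq0 => /zx.
  - by exists e => //; rewrite ze mulr0.
have [t t0 [pt [g xg gt]]] := ratio_step px zx ze0.
have lin a : V (fun e => 1 * x e + a * z e) by exact: (sub_lin subV).
have supp a e : 1 * x e + a * z e != 0 -> x e != 0.
  apply: contraNneq => xe; have [->|/zx] := eqVneq (z e) 0.
    by rewrite xe !mulr0 addr0.
  by rewrite xe eqxx.
have [tf|tf] := eqVneq (1 * x f + - t * z f) 0; last first.
  by apply: (rec _ (lin (- t))) => //; [exact: supp | exists g].
have zf : 0 < sg s f * z f.
  have := npos_gt0 px xf; have -> : x f = t * z f by lra.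
  by rewrite mulrCA pmulr_rgt0.
have [/existsP[h zh]|/existsPn zpos] := boolP [exists h, sg s h * z h < 0];
  last first.
  apply: (rec z) => //; last by exists e1.
    by move=> e; rewrite leNgt zpos.
  exact: sg_gt0_neq0 zf.
pose z' e := -1 * z e.
have [||t' t'0 [pt' [g' xg' gt']]] := @ratio_step s x z' h px.
- by move=> e; rewrite /z' mulN1r oppr_eq0 => /zx.
- by rewrite /z' mulN1r mulrN oppr_gt0.
apply: (rec (fun e => 1 * x e + t' * z e) (lin t')).
- by move=> e; have := pt' e; rewrite /z'; lra.
- apply: (@sg_gt0_neq0 s (fun e => 1 * x e + t' * z e)).
  by have := npos_gt0 px xf; have := mulr_gt0 t'0 zf; lra.
- exact: supp.
- by exists g' => //; move: gt'; rewrite /z'; lra.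
Qed.

(** With the weight of h a power of a large base B, whose exponent decreases
    along R, the leading term of each of finitely many forms outweighs the sum
    of its other terms. *)
Lemma lex_weights (I : finType) (P : pred I) (R : rel E) (phi : I -> E -> rat) :
    irreflexive R -> transitive R ->
    (forall i, P i -> exists2 g, 0 < phi i g
       & forall h, h != g -> phi i h != 0 -> R g h) ->
  exists w : E -> rat, (forall e, 0 < w e) /\
    forall i, P i -> 0 < \sum_h phi i h * w h.
Proof.
move=> irR trR lead.
pose r h := #|[set g | R g h]|.
have rlt g h : R g h -> (r g < r h)%N.
  move=> gh; apply: proper_card; apply/properP; split.
    by apply/subsetP => k; rewrite !inE => /trR; apply.
  by exists g; rewrite !inE ?gh ?irR.
have rmax g : (r g < #|E|)%N.
  rewrite -cardsT; apply: proper_card; apply/properP; split;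
    first exact: subsetT.
  by exists g; rewrite !inE ?irR.
(* B exceeds each quotient of the norm of a form by its leading term. *)
pose B : rat := 1 + \sum_i \sum_g \sum_h `|phi i h| / `|phi i g|.
have B1 i g : 1 + \sum_h `|phi i h| / `|phi i g| <= B.
  rewrite lerD2l.
  apply: (le_trans (y := \sum_g' \sum_h `|phi i h| / `|phi i g'|)).
    rewrite [leRHS](bigD1 g) //= lerDl; apply: sumr_ge0 => g' _.
    by apply: sumr_ge0 => h _; exact: divr_ge0.
  rewrite [leRHS](bigD1 i) //= lerDl; apply: sumr_ge0 => i' _.
  by apply: sumr_ge0 => g' _; apply: sumr_ge0 => h _; exact: divr_ge0.
have Bge1 : 1 <= B.
  rewrite /B lerDl; apply: sumr_ge0 => i _; apply: sumr_ge0 => g _.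
  by apply: sumr_ge0 => h _; exact: divr_ge0.
have Bgt0 : 0 < B by lra.
exists (fun h => B ^+ (#|E| - r h)); split=> [e|i Pi]; first exact: exprn_gt0.
have [g phig glead] := lead i Pi.
set N := (#|E| - r g).-1.
have NE : (#|E| - r g = N.+1)%N by rewrite prednK // subn_gt0.
rewrite (bigD1 g) //= NE.
have BN : 0 < B ^+ N by exact: exprn_gt0.
suff: - (\sum_(h | h != g) `|phi i h|) * B ^+ N
      <= \sum_(h | h != g) phi i h * B ^+ (#|E| - r h).
  have : \sum_(h | h != g) `|phi i h| < phi i g * B.
    have := B1 i g; rewrite -mulr_suml (gtr0_norm phig) (bigD1 g) //=.
    set Q := \sum_(h | _) _; rewrite (gtr0_norm phig) => BQ.
    apply: (lt_le_trans (y := phi i g * (1 + (phi i g + Q) / phi i g))).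
      rewrite mulrDr [X in _ + X]mulrC divfK ?gt_eqF //; lra.
    by rewrite ler_pM2l.
  rewrite -(ltr_pM2r BN) exprS; lra.
rewrite mulNr mulr_suml -sumrN; apply: ler_sum => h hg.
have [->|ph] := eqVneq (phi i h) 0; first by rewrite normr0 !mul0r oppr0.
have /rlt rgh := glead h hg ph.
have le : B ^+ (#|E| - r h) <= B ^+ N.
  by apply: ler_weXn2l => //; rewrite /N; lia.
have ge0 : 0 <= B ^+ (#|E| - r h) by exact: exprn_ge0 (ltW Bgt0).
have := ler_norm (- phi i h); rewrite normrN => ?; have := normr_ge0 (phi i h);
  nra.
Qed.

End Vectors.
(** * Fundamental vectors, levels and signs *)

Section Tableaux.
Context {d : Order.disp_t} {E : finOrderType d}.
Implicit Types (S T A : {set E}) (e f g h a b m : E) (s : E -> bool).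
Implicit Types (x y z : E -> rat) (lev : E -> int) (cv fv : (E -> rat) -> Prop).
Implicit Types (u : E -> E -> rat).
Local Open Scope ring_scope.

(** The roles of the tensions and of the flows. A tableau makes the two spaces
    orthogonal complements of each other, see [tab_span]. *)
Record opair S cv fv : Prop := Opair {
  cv_sub : subspace S cv;
  fv_sub : subspace S fv;
  orth : forall x y, cv x -> fv y -> \sum_e x e * y e = 0 }.

Lemma opair_dual S cv fv : opair S cv fv -> opair S fv cv.
Proof.
case=> c f o; split=> // x y fx cy; rewrite -[RHS](o _ _ cy fx).
by apply: eq_bigr => e _; rewrite mulrC.
Qed.

(** The fundamental vectors of a basis T: u b is the fundamental cocycle of an
    element b of T, u e the fundamental cycle of an element e outside T. *)
Record tableau cv fv S T u : Prop := Tableau {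
  tab_sub : T \subset S;
  tab_cv : forall b, b \in T -> cv (u b);
  tab_fv : forall e, e \in S :\: T -> fv (u e);
  tab_diag : forall f, f \in S -> u f f = 1;
  tab_off : forall f g, f \in S -> g \in S -> f != g ->
              (f \in T) = (g \in T) -> u f g = 0 }.

Lemma tableau_dual cv fv S T u :
  tableau cv fv S T u -> tableau fv cv S (S :\: T) u.
Proof.
case=> sub c f di off; split=> //; first exact: subsetDl.
  by move=> e; rewrite !inE; case: (e \in S); rewrite ?andbT ?andbF // negbK =>
    /c.
by move=> e g eS gS ne; rewrite !inE eS gS !andbT => /negb_inj; apply: off.
Qed.

(** The sign by which duality acts on levels. *)
Definition tau T f : int := if f \in T then 1 else -1.

Lemma tau_dual S T f : f \in S -> tau (S :\: T) f = - tau T f.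
Proof. by move=> fS; rewrite /tau !inE fS andbT; case: (f \in T). Qed.

Definition actv u f : bool := [forall g, (u f g != 0) ==> (f <= g)%O].

Lemma actvP u f : reflect (forall g, u f g != 0 -> (f <= g)%O) (actv u f).
Proof. by apply: (iffP forallP) => P g; [apply/implyP | apply/implyP/P]. Qed.

Lemma actvPn u f : reflect (exists2 g, u f g != 0 & (g < f)%O) (~~ actv u f).
Proof.
apply: (iffP idP) => [/forallPn[g]|[g ug gf]].
  by rewrite negb_imply -ltNge => /andP[]; exists g.
by apply/actvP => /(_ g ug); rewrite leNgt gf.
Qed.

(** The level of the part with smallest element a is rank(a) + 1 or
    - (rank(a) + 1).  Monotonicity says that T meets each lower set of levels
    in one of its bases.  The fundamental vector of f in the minor of its part
    is then the restriction of u f to the level of f, and the two other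
    conditions say that the only active elements of the minors are those that
    are active for T. *)
Record levelling S T u lev : Prop := Levelling {
  lev_mono : forall f g, f \in S -> u f g != 0 ->
               tau T f * lev f <= tau T f * lev g;
  lev_pred : forall f, f \in S -> ~~ actv u f ->
               exists h, [/\ u f h != 0, (h < f)%O & lev h = lev f];
  lev_actv : forall f, f \in S -> actv u f -> lev f = tau T f * (rk f).+1%:Z }.

Lemma levelling_dual S T u lev :
  levelling S T u lev -> levelling S (S :\: T) u (fun e => - lev e).
Proof.
case=> mono pre act; split=> [f g fS fg|f fS /(pre f fS)[h [uh hf lh]]|f fS
  /(act f fS) ->].
- by rewrite tau_dual // !mulrNN; exact: mono.
- by exists h; split=> //; rewrite lh.
- by rewrite tau_dual // mulNr.
Qed.

(** In the minor of its part, f and the smallest element m of its fundamental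
    set have opposite directions; the entry of u f at f is 1. *)
Definition compat S u lev s : Prop := forall f m,
  f \in S -> u f m != 0 -> lev m = lev f -> (m < f)%O ->
  (forall h, u f h != 0 -> lev h = lev f -> (m <= h)%O) ->
  sg s f * sg s m * u f m < 0.

Lemma compat_dual S u lev s :
  compat S u lev s -> compat S u (fun e => - lev e) s.
Proof.
move=> co f m fS um /oppr_inj lm mf mmin; apply: co => // h uh lh.
by apply: mmin => //; rewrite lh.
Qed.

Section OneTableau.
Variables (S T : {set E}) (cv fv : (E -> rat) -> Prop) (u : E -> E -> rat).
Hypotheses (op : opair S cv fv) (tab : tableau cv fv S T u).

Let TS := subsetP (tab_sub tab).

(** Two fundamental vectors of opposite kinds share at most two elements of
    their supports, and are orthogonal. *)
Lemma tab_anti f g : f \in S -> g \in S -> (f \in T) != (g \in T) ->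
  u f g = - u g f.
Proof.
wlog fT : f g / f \in T.
  move=> wl fS gS fg; have [fT|fT] := boolP (f \in T); first exact: wl.
  rewrite [u g f]wl ?opprK // 1?eq_sym //.
  by move: fg; rewrite (negbTE fT); case: (g \in T).
rewrite fT eq_sym eqb_id => fS gS gT.
have fg : f != g by apply: contraNneq gT => <-.
have gST : g \in S :\: T by rewrite inE gT.
have := orth op (tab_cv tab fT) (tab_fv tab gST).
rewrite (bigD1 f) // (bigD1 g) 1?eq_sym //= big1 => [|h /andP[hf hg]].
  rewrite !(tab_diag tab) // mul1r mulr1 addr0 => /eqP.
  by rewrite addr_eq0 => /eqP ->; rewrite opprK.
have [hS|hS] := boolP (h \in S); last first.
  apply/eqP; rewrite mulf_eq0; apply/orP; left; apply: contraNT hS.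
  exact: (sub_supp (cv_sub op) (tab_cv tab fT)).
have [hT|hT] := boolP (h \in T).
  by rewrite (tab_off tab fS hS) ?mul0r ?fT ?hT // eq_sym.
by rewrite (tab_off tab gS hS) ?mulr0 ?(negbTE gT) ?(negbTE hT) // eq_sym.
Qed.

Lemma tab_in f g : f \in S -> u f g != 0 -> g \in S.
Proof.
move=> fS; have [fT|fT] := boolP (f \in T).
  exact: (sub_supp (cv_sub op) (tab_cv tab fT)).
by apply: (sub_supp (fv_sub op) (tab_fv tab _)); rewrite inE fT.
Qed.

Lemma tab_sym f g : f \in S -> u f g != 0 -> u g f != 0.
Proof.
move=> fS ufg; have gS := tab_in fS ufg.
have [<-|fg] := eqVneq f g; first by rewrite (tab_diag tab) ?oner_eq0.
have [side|ne] := eqVneq (f \in T) (g \in T).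
  by rewrite (tab_off tab fS gS fg side) eqxx in ufg.
by rewrite (tab_anti gS fS) ?oppr_eq0 // eq_sym.
Qed.

Lemma tab_side f g : f \in S -> u f g != 0 -> g != f -> (g \in T) = (f \notin
  T).
Proof.
move=> fS ufg gf; have gS := tab_in fS ufg.
apply/eqP; apply: contraNT ufg => ne; rewrite (tab_off tab fS gS) //.
  by rewrite eq_sym.
by move: ne; case: (f \in T); case: (g \in T).
Qed.

(** Off T, the coordinates follow from orthogonality to the vectors u e. *)
Lemma tab_span x : cv x -> forall e, x e = \sum_(b in T) x b * u b e.
Proof.
move=> cx e; have [eS|eS] := boolP (e \in S); last first.
  have -> : x e = 0 by apply/eqP; apply: contraNT eS;
    exact: (sub_supp (cv_sub op) cx).
  rewrite big1 // => b bT; suff -> : u b e = 0 by rewrite mulr0.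
  by apply/eqP; apply: contraNT eS; exact: (sub_supp (cv_sub op) (tab_cv tab
    bT)).
have [eT|eT] := boolP (e \in T).
  rewrite (bigD1 e) //= (tab_diag tab) // mulr1 big1 ?addr0 // => b /andP[bT
    be].
  by rewrite (tab_off tab) ?mulr0 ?TS ?bT ?eT.
have eST : e \in S :\: T by rewrite inE eT.
have := orth op cx (tab_fv tab eST).
rewrite (bigID (mem T)) /= [X in _ + X](bigD1 e) //= (tab_diag tab) // mulr1.
rewrite [X in _ + (_ + X)]big1 ?addr0 => [|g /andP[gT ge]]; last first.
  have [gS|gS] := boolP (g \in S).
    by rewrite (tab_off tab) ?mulr0 1?eq_sym // (negbTE gT) (negbTE eT).
  suff -> : x g = 0 by rewrite mul0r.
  by apply/eqP; apply: contraNT gS; exact: (sub_supp (cv_sub op) cx).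
move/eqP; rewrite addrC addr_eq0 => /eqP ->; rewrite -sumrN.
by apply: eq_bigr => b bT; rewrite (tab_anti eS (TS bT)) ?bT ?(negbTE eT) //
  mulrN opprK.
Qed.

Lemma tab_fund x b : b \in T -> cv x -> (forall g, g \in T -> g != b -> x g = 0)
  ->
  forall e, x e = x b * u b e.
Proof.
move=> bT cx xT e; rewrite {1}(tab_span cx) (bigD1 b) //= big1 ?addr0 // => g.
by case/andP=> gT gb; rewrite xT ?mul0r.
Qed.

Lemma tab_zero x : cv x -> (forall g, g \in T -> x g = 0) -> forall e, x e = 0.
Proof. by move=> cx xT e; rewrite (tab_span cx) big1 // => b /xT ->;
  rewrite mul0r. Qed.

Lemma tab_elem b : b \in T -> elem cv (u b).
Proof.
move=> bT; split; first exact: (tab_cv tab bT).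
  by exists b; rewrite (tab_diag tab) ?TS ?oner_eq0.
move=> z cz [e0 ze0] zu e ue.
have zT g : g \in T -> g != b -> z g = 0.
  move=> gT gb; apply/eqP; apply: contraT => /zu.
  by rewrite (tab_off tab (TS bT) (TS gT)) ?eqxx ?bT ?gT // eq_sym.
have zE := tab_fund bT cz zT.
rewrite zE mulf_neq0 //; apply: contraNneq ze0 => zb.
by rewrite zE zb mul0r.
Qed.

(** The conditions determine the level of f by those of smaller elements, as
    an extremum over the smaller elements of its fundamental set.  They are
    consistent: of two elements in each other's fundamental sets, the larger
    one gets its level knowing that of the smaller one. *)
Lemma levelling_exists : exists lev, levelling S T u lev.
Proof.
pose P (f g : E) := (u f g != 0) && (g < f)%O.
pose mn (phi : E -> int) f :=
  [pick g | P f g && [forall h, P f h ==> (tau T f * phi g <= tau T f * phi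
    h)]].
pose body phi f := if mn phi f is Some g then phi g else tau T f * (rk f).+1%:Z.
have [|lev levE] := @order_rec _ E int 0 body.
  move=> phi psi f pp; rewrite /body.
  have -> : mn phi f = mn psi f.
    apply: eq_pick => g; rewrite /=; have [/andP[_ gf]|//] := boolP (P f g).
    apply: eq_forallb => h; have [/andP[_ hf]|//] := boolP (P f h).
    by rewrite !pp.
  by rewrite /mn; case: pickP => // g /andP[/andP[_ gf] _]; exact: pp.
have low f g : P f g -> exists h, [/\ P f h, lev h = lev f
    & forall h, P f h -> tau T f * lev f <= tau T f * lev h].
  move=> Pg; rewrite levE /body /mn; case: pickP => [h /andP[Ph /forallP
    hmin]|no].
    by exists h; split=> // k Pk; apply: (implyP (hmin k)).
  case: (arg_minP (P := P f) (fun g => tau T f * lev g) Pg) => h Ph hmin.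
  have /andP[] := negbT (no h); rewrite Ph; split=> //.
  by apply/forallP => k; apply/implyP/hmin.
exists lev; split.
- have lt f g : f \in S -> u f g != 0 -> (g < f)%O -> tau T f * lev f <= tau T f
    * lev g.
    move=> fS ufg gf; have [|h [_ _]] := low f g; first exact/andP.
    by apply; apply/andP.
  move=> f g fS ufg; have [//|gf|->//] := ltgtP g f; first exact: lt.
  have gS := tab_in fS ufg; have := lt g f gS (tab_sym fS ufg) gf.
  have := tab_side fS ufg; rewrite (gt_eqF gf) /tau => /(_ isT) ->.
  by case: (f \in T); rewrite /=; lia.
- move=> f fS /actvPn[g ug gf]; have [|h [/andP[uh hf] lh _]] := low f g.
    exact/andP.
  by exists h.
- move=> f fS /actvP act; rewrite levE /body /mn; case: pickP => // g.
  by move=> /andP[/andP[/act fg]]; rewrite ltNge fg.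
Qed.

Lemma level_active lev f : levelling S T u lev -> f \in S ->
  exists a, [/\ a \in S, actv u a, lev a = lev f & (a <= f)%O].
Proof.
case=> _ pre _; move: f; apply: (@rk_ind d E) => f IH fS.
have [af|/(pre f fS)[h [uh hf lh]]] := boolP (actv u f).
  by exists f; rewrite fS af lexx.
have [a [aS aa al ah]] := IH h hf (tab_in fS uh).
by exists a; rewrite aS aa al lh (le_trans ah (ltW hf)).
Qed.

Lemma lev_neq0 lev f : levelling S T u lev -> f \in S -> lev f != 0.
Proof.
move=> lv fS; have [a [aS aa <- _]] := level_active lv fS.
by rewrite (lev_actv lv aS aa) /tau; case: ifP.
Qed.

Lemma actv_lev lev f : levelling S T u lev -> f \in S ->
  actv u f = (`|lev f| == (rk f).+1%:Z).
Proof.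
move=> lv fS; have [af|naf] := boolP (actv u f).
  by rewrite (lev_actv lv fS af) /tau; case: ifP => _;
    rewrite ?mulN1r ?normrN ?mul1r eqxx.
have [a [aS aa <-]] := level_active lv fS.
rewrite le_eqVlt => /orP[/eqP E0|]; first by rewrite E0 (negbTE naf) in aa.
rewrite -rk_lt (lev_actv lv aS aa) /tau; case: ifP => _; lia.
Qed.

Lemma actv_levT lev f : levelling S T u lev -> f \in S ->
  (f \in T) && actv u f = (lev f == (rk f).+1%:Z).
Proof.
move=> lv fS; rewrite (actv_lev lv fS).
have [af|naf] := boolP (actv u f); last first.
  by have := actv_lev lv fS; rewrite (negbTE naf) => /esym/negbT; lia.
by have := lev_actv lv fS af; rewrite /tau; case: (f \in T); lia.
Qed.

End OneTableau.

(** Weights dominated first by level, then by rank, work for two tableaux at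
    once, which is what the comparison of two optimal bases needs. *)
Lemma tab_weights S cv fv lev s (k : int) (T : bool -> {set E})
    (u : bool -> E -> E -> rat) :
    opair S cv fv -> (forall i, tableau cv fv S (T i) (u i)) ->
    (forall i, levelling S (T i) (u i) lev) ->
    (forall i, compat S (u i) lev s) ->
  exists w : E -> rat, (forall e, 0 < w e) /\
    forall i f, f \in S -> f \notin T i -> ~~ actv (u i) f -> k <= lev f ->
      w f < \sum_(b in T i | k <= lev b) (- (sg s f * sg s b * u i f b)) * w b.
Proof.
move=> op tab lv co.
pose P (i : bool * E) :=
  [&& i.2 \in S, i.2 \notin T i.1, ~~ actv (u i.1) i.2 & k <= lev i.2].
pose phi (i : bool * E) h :=
  if k <= lev h then - (sg s i.2 * sg s h * u i.1 i.2 h) else 0.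
(* Higher levels weigh more, and within a level smaller elements do. *)
pose R := [rel g h : E | (lev h < lev g) || ((lev g == lev h) && (g < h)%O)].
have irR : irreflexive R by move=> g; rewrite /= !ltxx andbF.
have trR : transitive R.
  move=> h g j /= /orP[gh|/andP[/eqP gh gh']] /orP[hj|/andP[/eqP hj hj']].
  - by rewrite (lt_trans hj gh).
  - by rewrite -hj gh.
  - by rewrite gh hj.
  - by rewrite gh hj eqxx (lt_trans gh' hj') orbT.
have [[i f] /and4P[/= fS fT fa kf]|w [w0 wP]] := lex_weights (P := P) (phi :=
  phi) irR trR.
  have [h [uh hf lh]] := lev_pred (lv i) fS fa.
  case: (arg_minnP (P := [pred g | (u i f g != 0) && (lev g == lev f)]) rk (i0
    := h)).
    by rewrite /= uh lh eqxx.
  move=> m /= /andP[um /eqP lm] mmin.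
  have mle g : u i f g != 0 -> lev g = lev f -> (m <= g)%O.
    by move=> ug lg; rewrite -rk_le; apply: mmin; rewrite ug lg eqxx.
  exists m => [|g gm]; first by rewrite /phi /= lm kf oppr_gt0;
    apply: (co i) => //; exact: le_lt_trans (mle h uh lh) hf.
  rewrite /phi /=; case: ifP => _; last by rewrite eqxx.
  rewrite oppr_eq0 !mulf_eq0 !negb_or => /andP[_ ug].
  have := lev_mono (lv i) fS ug; rewrite /tau (negbTE fT) !mulN1r lerN2 lm.
  rewrite le_eqVlt => /orP[/eqP lg|->//].
  by rewrite lg ltxx eqxx /= lt_neqAle (mle g ug lg) andbT eq_sym.
exists w; split=> // i f fS fT fa kf.
have /= := wP (i, f); rewrite /P /= fS fT fa kf => /(_ isT).
rewrite (bigD1 f) //= {1}/phi /= kf (tab_diag (tab i)) // mulr1 sgsg mulN1r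
  addrC subr_gt0.
congr (_ < _); rewrite big_mkcond [RHS]big_mkcond; apply: eq_bigr => h _.
rewrite /phi /=; have [->|hf] := eqVneq h f; first by rewrite (negbTE fT).
have [_|_] := boolP (k <= lev h); last by rewrite andbF mul0r.
rewrite andbT; case: ifPn => // hT.
have [hS|hS] := boolP (h \in S).
  by rewrite (tab_off (tab i)) ?mulr0 ?oppr0 ?mul0r 1?eq_sym // (negbTE fT)
    (negbTE hT).
suff -> : u i f h = 0 by rewrite mulr0 oppr0 mul0r.
by apply/eqP; apply: contraNT hS; exact: (tab_in op (tab i) fS).
Qed.

Lemma combo_sg S cv fv T u s (w : E -> rat) (k : int) lev f :
    opair S cv fv -> tableau cv fv S T u -> f \in S ->
  sg s f * \sum_(b in T | k <= lev b) (sg s b * w b) * u b f =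
  if f \in T then (if k <= lev f then w f else 0)
  else \sum_(b in T | k <= lev b) (- (sg s f * sg s b * u f b)) * w b.
Proof.
move=> op tab fS; case: ifPn => fT.
  rewrite big_mkcondr /= (bigD1 f) //= [X in _ + X]big1 ?addr0 => [|b /andP[bT
    bf]].
    case: ifP => _; last by rewrite mulr0.
    by rewrite (tab_diag tab) // mulr1 mulrA sgsg mul1r.
  by rewrite (tab_off tab) ?mulr0 ?if_same ?bT ?fT //;
    exact: (subsetP (tab_sub tab)).
rewrite mulr_sumr; apply: eq_bigr => b /andP[bT _].
rewrite (@tab_anti _ _ _ _ _ op tab f b) ?bT ?(negbTE fT) //;
  last exact: (subsetP (tab_sub tab)).
lra.
Qed.

Section Positivity.
Variables (S T : {set E}) (cv fv : (E -> rat) -> Prop) (u : E -> E -> rat).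
Variables (lev : E -> int) (s : E -> bool).
Hypotheses (op : opair S cv fv) (tab : tableau cv fv S T u).
Hypotheses (lv : levelling S T u lev) (co : compat S u lev s).

(** Externally active elements are the only ones of level at least k where the
    sign of the combination is not controlled. *)
Lemma pos_vec (k : int) : exists x, [/\ cv x, forall e, x e != 0 -> k <= lev e
  & forall e, e \in S -> k <= lev e -> (e \in T) || ~~ actv u e -> 0 < sg s e *
    x e].
Proof.
have [w [w0 wP]] := @tab_weights S cv fv lev s k (fun=> T) (fun=> u) op
  (fun=> tab) (fun=> lv) (fun=> co).
exists (fun e => \sum_(b in T | k <= lev b) (sg s b * w b) * u b e); split.
- by apply: (sub_sum (fun b => sg s b * w b) (cv_sub op)) => b /andP[bT _];
    exact: (tab_cv tab bT).
- move=> e; have [//|ek] := boolP (k <= lev e);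
    rewrite big1 ?eqxx // => b /andP[bT kb].
  suff -> : u b e = 0 by rewrite mulr0.
  apply/eqP; apply: contraNT ek => ub; apply: le_trans kb _.
  by have := lev_mono lv (subsetP (tab_sub tab) _ bT) ub;
    rewrite /tau bT !mul1r.
- move=> e eS ke; rewrite (combo_sg s w k lev op tab eS) ke.
  case: ifPn => [_ _|eT /= ea]; first exact: w0.
  exact: lt_trans (w0 e) (wP true e eS eT ea ke).
Qed.

End Positivity.

(** Otherwise, with k the lowest level in the support of x, the dual of
    [pos_vec] gives a vector of the other space that lives on levels at most k
    and is positive at each element of level k in the support of x; the two
    vectors could not be orthogonal. *)
Lemma nonneg_low S T cv fv u lev s x f :
    opair S cv fv -> tableau cv fv S T u -> levelling S T u lev ->
    compat S u lev s -> cv x -> npos s x -> x f != 0 ->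
  exists a, [/\ a \in T, actv u a, lev a <= lev f & x a != 0].
Proof.
move=> op tab lv co cx px xf.
have supp e : x e != 0 -> e \in S by exact: (sub_supp (cv_sub op) cx).
case: (arg_minP (P := [pred e | x e != 0]) lev xf) => f0 /= xf0 fmin.
have [y [fy ysupp ypos]] := pos_vec (opair_dual op) (tableau_dual tab)
  (levelling_dual lv) (compat_dual co) (- lev f0).
have [/existsP[a /and4P[aT aa al xa]]|/existsPn no] :=
  boolP [exists a, [&& a \in T, actv u a, lev a <= lev f & x a != 0]].
  by exists a.
have pos e : x e != 0 -> lev e = lev f0 -> 0 < x e * y e.
  move=> xe le; have eS := supp e xe.
  have : 0 < sg s e * y e.
    apply: ypos => //; rewrite ?le //.
    rewrite inE eS andbT -negb_and; apply: contra (no e) => /andP[-> ->] /=.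
    by rewrite xe le fmin.
  have := npos_gt0 px xe; rewrite /sg; case: (s e); nra.
have := orth op cx fy; rewrite (bigD1 f0) //= => E0.
suff : 0 <= \sum_(i | i != f0) x i * y i by have := pos f0 xf0 erefl; lra.
apply: sumr_ge0 => e _; have [->|xe] := eqVneq (x e) 0; first by rewrite mul0r.
have [->|/ysupp ye] := eqVneq (y e) 0; first by rewrite mulr0.
apply/ltW/pos => //; apply/eqP; rewrite eq_le fmin // andbT; lia.
Qed.

(** The levels are read from the orientation alone: this is the link between
    the filtration of a basis and the active filtration of an orientation. *)
Lemma pos_iff S T cv fv u lev s f (j : nat) :
    opair S cv fv -> tableau cv fv S T u -> levelling S T u lev ->
    compat S u lev s -> f \in S ->
  (exists x, [/\ cv x, npos s x, x f != 0 & forall e, x e != 0 -> (j <= rk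
    e)%N])
  <-> j%:Z < lev f.
Proof.
move=> op tab lv co fS; split=> [[x [cx px xf xj]]|jf].
  have [a [aT aa af /xj ja]] := nonneg_low op tab lv co cx px xf.
  have aS := subsetP (tab_sub tab) _ aT.
  have := lev_actv lv aS aa; rewrite /tau aT; lia.
have [x [cx xsupp xpos]] := pos_vec op tab lv co (lev f).
have supp e : x e != 0 -> e \in S by exact: (sub_supp (cv_sub op) cx).
have pos e : e \in S -> lev f <= lev e -> 0 < sg s e * x e.
  move=> eS fe; apply: xpos => //; have [//|eT /=] := boolP (e \in T).
  by apply/negP => ea; have := lev_actv lv eS ea; rewrite /tau (negbTE eT); lia.
exists x; split=> // [e||e xe].
- have [->|xe] := eqVneq (x e) 0; first by rewrite mulr0.
  exact/ltW/pos/xsupp/xe/supp.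
- by apply: (@sg_gt0_neq0 _ s); exact: pos.
- have [a [aS aa al]] := level_active op tab lv (supp e xe).
  have := xsupp e xe; rewrite -rk_le -al (lev_actv lv aS aa) /tau;
    case: ifP => _; lia.
Qed.

End Tableaux.
(** * Uniqueness of the optimal tree *)

Section Optimal.
Context {d : Order.disp_t} {E : finOrderType d}.
Implicit Types (T A : {set E}) (e f g h a b m : E) (s : E -> bool).
Implicit Types (lev : E -> int) (u : E -> E -> rat).
Local Open Scope ring_scope.

Definition opt S (cv fv : (E -> rat) -> Prop) s T lev : Prop :=
  exists u, [/\ tableau cv fv S T u, levelling S T u lev & compat S u lev s].

Lemma opt_dual S cv fv s T lev : opt S cv fv s T lev ->
  opt S fv cv s (S :\: T) (fun e => - lev e).
Proof.
case=> u [tab lv co]; exists u; split; first exact: (tableau_dual tab).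
  exact: (levelling_dual lv).
exact: (compat_dual co).
Qed.

Variables (S : {set E}) (cv fv : (E -> rat) -> Prop).
Hypothesis op : opair S cv fv.

Lemma opt_ext s T lev lev' : {in S, lev =1 lev'} ->
  opt S cv fv s T lev -> opt S cv fv s T lev'.
Proof.
move=> le [u [tab lv co]]; exists u; split=> //.
  split=> [f g fS ufg|f fS /(lev_pred lv fS)[h [uh hf lh]]|f fS af].
  - rewrite -(le f fS) -(le g (tab_in op tab fS ufg)).
    exact: (lev_mono lv fS ufg).
  - by exists h; rewrite -(le f fS) -(le h (tab_in op tab fS uh)).
  - by rewrite -(le f fS) (lev_actv lv).
move=> f m fS um; rewrite -(le f fS) -(le m (tab_in op tab fS um)) => lm mf
  mmin.
apply: (co f m fS um lm mf) => h uh lh; apply: mmin => //.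
by rewrite -(le h (tab_in op tab fS uh)).
Qed.

Lemma opt_lev_pos s T lev T' lev' f :
    opt S cv fv s T lev -> opt S cv fv s T' lev' -> f \in S ->
  0 < lev f -> lev' f = lev f.
Proof.
move=> [u [tab lv co]] [u' [tab' lv' co']] fS f0.
have iff j : j%:Z < lev f <-> j%:Z < lev' f.
  by apply: iff_trans (pos_iff j op tab' lv' co' fS); apply: iff_sym;
    apply: pos_iff op tab lv co fS.
have := iff (absz (lev f)); have := iff (absz (lev f)).-1;
  have := iff (absz (lev' f)). lia.
Qed.

End Optimal.

Section Uniqueness.
Context {d : Order.disp_t} {E : finOrderType d}.
Variables (S : {set E}) (cv fv : (E -> rat) -> Prop).
Hypothesis op : opair S cv fv.
Local Open Scope ring_scope.

Lemma opt_lev s T lev T' lev' :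
    opt S cv fv s T lev -> opt S cv fv s T' lev' ->
  {in S, lev =1 lev'}.
Proof.
move=> o o' f fS; have [u [tab lv _]] := o.
have := lev_neq0 op tab lv fS; rewrite neq_lt => /orP[fN|fP].
  have := opt_lev_pos (opair_dual op) (opt_dual o) (opt_dual o') fS.
  rewrite oppr_gt0 => /(_ fN); lia.
by rewrite (opt_lev_pos op o o').
Qed.

Lemma opt_min s T lev f : opt S cv fv s T lev -> f \in S ->
  exists a, [/\ a \in S, (a <= f)%O, lev a = lev f & `|lev a| = (rk a).+1%:Z].
Proof.
case=> u [tab lv _] fS; have [a [aS aa la al]] := level_active op tab lv fS.
by exists a; split=> //; have := actv_lev op tab lv aS; rewrite aa => /esym/eqP.
Qed.

Lemma opt_le_rk s T lev f : opt S cv fv s T lev -> f \in S ->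
  `|lev f| <= (rk f).+1%:Z.
Proof. by move=> o fS; have [a [_ + <- ->]] := opt_min o fS;
  rewrite -rk_le. Qed.

(** The sum D of (x - x')(y' - y) vanishes by orthogonality, with x, x' at
    least w and tight on T, T', and y, y' at least w' and tight off T, T'.
    Active elements, where the bounds may fail, are those whose rank is one
    less than the absolute value of their level; they lie in both bases or in
    none, and contribute zero. *)
Lemma opt_tree s T lev T' lev' :
  opt S cv fv s T lev -> opt S cv fv s T' lev' -> T = T'.
Proof.
move=> o o'; have ll := opt_lev o' o.
have {ll}o' := opt_ext op ll o'; have bound := opt_le_rk o.
have [[u [tab lv co]] [u' [tab' lv' co']]] := (o, o').
pose TT i := if i then T' else T; pose uu i := if i then u' else u.
have tabs i : tableau cv fv S (TT i) (uu i) by case: i.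
have lvs i : levelling S (TT i) (uu i) lev by case: i.
have cos i : compat S (uu i) lev s by case: i.
have lo f : f \in S -> - #|E|%:Z <= lev f by move/bound; have := rk_max f; lia.
have lo' f : f \in S -> - #|E|%:Z <= - lev f by move/bound; have := rk_max f;
  lia.
have [w [w0 wP]] := tab_weights (- #|E|%:Z) op tabs lvs cos.
(* The weights w' for the other space come from the dual tableaux. *)
have [w' [w0' wP']] := tab_weights (- #|E|%:Z) (opair_dual op)
  (fun i => tableau_dual (tabs i)) (fun i => levelling_dual (lvs i))
  (fun i => compat_dual (cos i)).
pose x i e := \sum_(b in TT i | - #|E|%:Z <= lev b) (sg s b * w b) * uu i b e.
pose y i e := \sum_(b in S :\: TT i | - #|E|%:Z <= - lev b)
  (sg s b * w' b) * uu i b e.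
have cx i : cv (x i).
  apply: (sub_sum (fun b => sg s b * w b) (cv_sub op)) => b /andP[bT _].
  exact: (tab_cv (tabs i) bT).
have fy i : fv (y i).
  apply: (sub_sum (fun b => sg s b * w' b) (fv_sub op)) => b /andP[bT _].
  exact: (tab_fv (tabs i) bT).
have act f : f \in S -> actv (uu true) f = actv (uu false) f.
  by move=> fS; rewrite !(actv_lev op (tabs _) (lvs _) fS).
have actT f : f \in S -> actv (uu false) f -> (f \in T) = (f \in T').
  move=> fS af; have := lev_actv (lvs false) fS af; rewrite -act // in af.
  have := lev_actv (lvs true) fS af; rewrite /tau /TT.
  by case: (f \in T); case: (f \in T'); lia.
have sx i f : f \in S -> f \in TT i -> sg s f * x i f = w f.
  by move=> fS fT; rewrite (combo_sg s w _ lev op (tabs i) fS) fT lo.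
have sx' i f : f \in S -> f \notin TT i -> ~~ actv (uu i) f -> w f < sg s f * x
  i f.
  move=> fS fT fa; rewrite (combo_sg s w _ lev op (tabs i) fS) (negbTE fT).
  by apply: wP => //; exact: lo.
have sy i f : f \in S -> f \notin TT i -> sg s f * y i f = w' f.
  move=> fS fT.
  rewrite (combo_sg s w' _ (fun e => - lev e) (opair_dual op) (tableau_dual
    (tabs i)) fS).
  by rewrite inE fT fS lo'.
have sy' i f : f \in S -> f \in TT i -> ~~ actv (uu i) f -> w' f < sg s f * y i
  f.
  move=> fS fT fa.
  rewrite (combo_sg s w' _ (fun e => - lev e) (opair_dual op) (tableau_dual
    (tabs i)) fS).
  by rewrite ifN ?inE ?fT //; apply: wP' => //; rewrite ?inE ?fT //; exact: lo'.
have xsupp i f : f \notin S -> x i f = 0.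
  by move=> fS; apply/eqP; apply: contraNT fS; exact: (sub_supp (cv_sub op) (cx
    i)).
have sgE f X Y : X * Y = (sg s f * X) * (sg s f * Y).
  by rewrite mulrACA sgsg mul1r.
pose D f := (x false f - x true f) * (y true f - y false f).
have sumD : \sum_f D f = 0.
  have E0 i j : \sum_f x i f * y j f = 0 by exact: orth op _ _ (cx i) (fy j).
  rewrite (eq_bigr (fun f => (x false f * y true f - x false f * y false f)
    - (x true f * y true f - x true f * y false f))).
    by rewrite !sumrB !E0 !subr0.
  by move=> f _; rewrite /D; ring.
have pos f : (f \in T) != (f \in T') -> 0 < D f.
  move=> ne; have fS : f \in S.
    move: ne; case: (boolP (f \in T)) => [/(subsetP (tab_sub tab))//|_].
    by case: (boolP (f \in T')) => [/(subsetP (tab_sub tab'))|].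
  have na : ~~ actv (uu false) f by apply: contraNN ne => /(actT f fS) ->.
  have na' : ~~ actv (uu true) f by rewrite act.
  rewrite /D (sgE f) mulrBr [sg s f * (y _ f - _)]mulrBr; move: ne.
  have [fT|fT] := boolP (f \in T); have [fT'|fT'] := boolP (f \in T') => // _.
    have := sx false f fS fT; have := sx' true f fS fT' na'.
    have := sy true f fS fT'; have := sy' false f fS fT na; nra.
  have := sx true f fS fT'; have := sx' false f fS fT na.
  have := sy false f fS fT; have := sy' true f fS fT' na'; nra.
have nneg f : 0 <= D f.
  have [eqT|/pos/ltW//] := eqVneq (f \in T) (f \in T').
  have [fS|fS] := boolP (f \in S); last by rewrite /D !xsupp // subrr mul0r.
  rewrite /D (sgE f) mulrBr [sg s f * (y _ f - _)]mulrBr;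
    have [fT|fT] := boolP (f \in T).
    have fT' : f \in TT true by rewrite /TT -eqT.
    by rewrite (sx false f fS fT) (sx true f fS fT') subrr mul0r.
  have fT' : f \notin TT true by rewrite /TT -eqT.
  by rewrite (sy false f fS fT) (sy true f fS fT') subrr mulr0.
apply/setP => f; have [//|/pos Df] := eqVneq (f \in T) (f \in T').
move: sumD; rewrite (bigD1 f) //= => /eqP; rewrite gt_eqF //.
by rewrite ltr_pwDl // sumr_ge0.
Qed.

End Uniqueness.

(** * Existence of an optimal tree *)

Section Existence.
Context {d : Order.disp_t} {E : finOrderType d}.
Variables (S : {set E}) (cv fv : (E -> rat) -> Prop).
Hypothesis op : opair S cv fv.
Implicit Types (T A : {set E}) (e f g h a b m : E).
Local Open Scope ring_scope.

Lemma tab_pivot T u b e : tableau cv fv S T u -> b \in T -> e \in S :\: T ->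
  u b e != 0 -> exists u', tableau cv fv S (e |: T :\ b) u'.
Proof.
move=> tab bT eST p0; have [eT eS] : e \notin T /\ e \in S by move: eST;
  rewrite inE => /andP[].
have bS := subsetP (tab_sub tab) _ bT; have TS := subsetP (tab_sub tab).
have eb : (e == b) = false by apply: contraNF eT => /eqP ->.
have anti : u e b = - u b e by rewrite (tab_anti op tab) ?bT ?(negbTE eT).
have ub f : f \in T -> f != b -> u b f = 0.
  by move=> fT fb; rewrite (tab_off tab bS (TS f fT)) ?bT ?fT // eq_sym.
have ue f : f \in S -> f \notin T -> f != e -> u e f = 0.
  by move=> fS fT fe; rewrite (tab_off tab eS fS) ?(negbTE fT) ?(negbTE eT) //
    eq_sym.
exists (fun f => if f == e then (fun g => (u b e)^-1 * u b g)
  else if f == b then (fun g => (u e b)^-1 * u e g)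
  else if f \in T then (fun g => 1 * u f g + - (u f e / u b e) * u b g)
  else (fun g => 1 * u f g + - (u f b / u e b) * u e g)).
split.
- by rewrite subUset sub1set eS (subset_trans (subsetDl _ _) (tab_sub tab)).
- move=> f; rewrite !inE; case: eqP => [_ _|_ /andP[fb fT]].
    exact: (sub_scale _ (cv_sub op) (tab_cv tab bT)).
  rewrite (negbTE fb) fT.
  exact: (sub_lin (cv_sub op) _ _ (tab_cv tab fT) (tab_cv tab bT)).
- move=> f; rewrite !inE; have [//|fe] := eqVneq f e;
    have [-> _|fb /= fT] := eqVneq f b.
    exact: (sub_scale _ (fv_sub op) (tab_fv tab eST)).
  rewrite (negbTE (proj1 (andP fT))).
  by apply: (sub_lin (fv_sub op) _ _ (tab_fv tab _) (tab_fv tab eST));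
    rewrite inE.
- move=> f fS; have [->|fe] := eqVneq f e; first by rewrite mulVf.
  have [->|fb] := eqVneq f b; first by rewrite mulVf // anti oppr_eq0.
  case: ifP => fT; rewrite (tab_diag tab) //.
    by rewrite (ub f) // mulr0 addr0 mulr1.
  by rewrite (ue f) ?fT // mulr0 addr0 mulr1.
- move=> f g fS gS fg; rewrite !inE.
  have [fe|fe] := eqVneq f e; have [ge|ge] := eqVneq g e => /=.
  + by rewrite fe ge eqxx in fg.
  + case: (eqVneq g b) => //= gb /esym gT; subst f.
    by rewrite (ub g) ?mulr0.
  + case: (eqVneq f b) => //= fb fT; rewrite fT ge; field; exact: p0.
  + have [fb|fb] := eqVneq f b; have [gb|gb] := eqVneq g b => /=.
    * by rewrite fb gb eqxx in fg.
    * by move=> /esym gT; rewrite (ue g) ?mulr0 ?gT.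
    * by move=> fT; rewrite fT gb; field; rewrite anti oppr_eq0.
    * move=> fgT; case: ifP => fT; rewrite (tab_off tab fS gS fg fgT).
        by rewrite (ub g) -?fgT // !mulr0 addr0.
      by rewrite (ue g) -?fgT ?fT // !mulr0 addr0.
Qed.

Section Crapo.
Variable basis : pred {set E}.
Hypothesis basisP : forall T, basis T <-> exists u, tableau cv fv S T u.
Hypothesis basis_ex : exists T, basis T.

(** Take a basis of maximal weight, where the elements of A are heavier than
    the others, increasingly with their rank, and the weights outside A
    decrease with the rank.  An exchange that does not increase the weight is
    an inequality between ranks. *)
Lemma crapo_interval A : exists T u, [/\ tableau cv fv S T u,
  forall b, b \in T -> b \notin A -> actv u b
  & forall e, e \in S :\: T -> e \in A -> actv u e].
Proof.
have [T0 bT0] := basis_ex.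
(* The term #|E| makes each element of A heavier than all others. *)
pose om f : int := if f \in A then (#|E| + rk f)%:Z else - (rk f)%:Z.
case: (arg_maxP (P := basis) (fun T => \sum_(f in T) om f) bT0) => T /basisP[u
  tab] max.
have swap b e : b \in T -> e \in S :\: T -> u b e != 0 -> om e <= om b.
  move=> bT eT ube; have [u' tab'] := tab_pivot tab bT eT ube.
  have /max := proj2 (basisP _) (ex_intro _ u' tab').
  rewrite /= big_setU1 /=; last by move: eT; rewrite !inE => /andP[/negbTE ->];
    rewrite andbF.
  by rewrite [leRHS](big_setD1 b) //=; lia.
exists T, u; split=> // [b bT bA|e eST eA].
  have bS := subsetP (tab_sub tab) _ bT.
  apply/actvP => g ubg; have [->//|gb] := eqVneq g b.
  have gS := tab_in op tab bS ubg.
  have := swap b g bT _ ubg; rewrite inE gS (tab_side op tab bS ubg gb) bT =>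
    /(_ isT).
  by rewrite /om (negbTE bA) -rk_le; have := rk_max b; case: (g \in A); lia.
have /setDP[eS eT] := eST.
apply/actvP => g ueg; have [->//|ge] := eqVneq g e.
have gT := tab_side op tab eS ueg ge; rewrite eT in gT.
have := swap g e gT eST (tab_sym op tab eS ueg).
by rewrite /om eA -rk_le; have := rk_max e; case: (g \in A); lia.
Qed.

(** The sign of a non-active element is forced by the one of a smaller element,
    whereas the signs of the active elements are free. *)
Lemma orient_exists u lev (v : E -> bool) : exists s : E -> bool,
  compat S u lev s /\ forall f, (f \notin S) || actv u f -> s f = v f.
Proof.
pose lead f := [pick m | [&& u f m != 0, lev m == lev f, (m < f)%O
  & [forall h, (u f h != 0) && (lev h == lev f) ==> (m <= h)%O]]].
pose body (s : E -> bool) f :=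
  if (f \notin S) || actv u f then v f
  else if lead f is Some m then s m (+) (0 < u f m) else v f.
have [|s sE] := @order_rec _ E bool false body.
  move=> phi psi f pp; rewrite /body; case: ifP => // _; rewrite /lead.
  by case: pickP => // m /and4P[_ _ mf _]; rewrite pp.
exists s; split=> [f m fS um lm mf mmin|f nf]; last by rewrite sE /body nf.
have na : ~~ actv u f by apply/actvPn; exists m.
rewrite [sg s f]/sg sE /body fS (negbTE na) /= /lead.
case: pickP => [m' /and4P[um' /eqP lm' _ /forallP mmin']|/(_ m)]; last first.
  rewrite um lm mf eqxx /= => /negbT/forallPn[h].
  by rewrite negb_imply => /andP[/andP[uh /eqP lh]]; rewrite mmin.
have -> : m' = m.
  apply/le_anti; rewrite mmin // andbT.
  by apply: (implyP (mmin' m)); rewrite um lm eqxx.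
rewrite /sg; case: (s m) => /=; have [u0|u0] := ltP 0 (u f m) => /=;
  rewrite ?mulrNN ?mulN1r ?mulr1 ?mul1r ?opprK ?oppr_lt0 //;
  by rewrite lt_neqAle um.
Qed.

(** Off A the basis elements are active, and so are the elements of A outside
    the basis; hence v is given by the basis at non-active elements, and by s
    at active ones.  Since s determines the basis and the levels, the map from
    v to s is injective, and therefore onto. *)
Theorem opt_exists (s : {ffun E -> bool}) : exists T lev, opt S cv fv s T lev.
Proof.
pose Q (v : {ffun E -> bool}) (sT : {ffun E -> bool} * {set E}) :=
  exists lev, [/\ opt S cv fv sT.1 sT.2 lev,
    forall f, f \notin S -> sT.1 f = v f,
    forall f, f \in S -> `|lev f| == (rk f).+1%:Z -> sT.1 f = v f
    & forall f, f \in S -> `|lev f| != (rk f).+1%:Z -> v f = (f \in sT.2)].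
have [|phi phiP] := @fin_all_exists _ _ Q.
  move=> v; have [T [u [tab actT actN]]] := crapo_interval [set f | v f].
  have [lev lv] := levelling_exists op tab.
  have [s0 [co s0v]] := orient_exists u lev v.
  have sE : finfun s0 =1 s0 by move=> f; rewrite ffunE.
  exists (finfun s0, T), lev; split=> /=.
  - exists u; split=> // f m fS um lm mf mmin.
    by rewrite /sg !sE; apply: co.
  - by move=> f fS; rewrite sE s0v ?fS.
  - by move=> f fS; rewrite -(actv_lev op tab lv fS) sE => af;
      rewrite s0v ?af ?orbT.
  - move=> f fS; rewrite -(actv_lev op tab lv fS).
    have [fT|fT] := boolP (f \in T).
      by apply: contraNT => vf; apply: actT; rewrite ?inE.
    by apply: contraNF => vf; apply: actN; rewrite !inE ?fT.
have inj : injective (fun v => (phi v).1).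
  move=> v v' /= Es; apply/ffunP => f.
  have [lev [o out act nact]] := phiP v; have [lev' [o' out' act' nact']] :=
    phiP v'.
  rewrite Es in o out act.
  have [fS|fS] := boolP (f \in S); last by rewrite -out // -out'.
  have ET := opt_tree op o o'; have El := opt_lev op o o' fS.
  have [af|naf] := boolP (`|lev f| == (rk f).+1%:Z).
    by rewrite -act // -act' // -El.
  by rewrite nact // nact' -?El // ET.
have [g _ gK] := injF_bij inj; rewrite -(gK s).
by have [lev [o _ _ _]] := phiP (g s); exists (phi (g s)).2, lev.
Qed.

End Crapo.
End Existence.
(** * Tensions and flows of a graph *)

Section Graphs.
Context {V : finType} {d : Order.disp_t} {E : finOrderType d}.
Implicit Types (G : graph V E) (s : orientation E) (e f g b : E).
Implicit Types (C F T : {set E}) (X : {set V}) (D : {set E * bool}).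
Implicit Types (x y z : E -> rat) (pi : V -> rat) (t : E * bool).
Local Open Scope ring_scope.

Definition dif G pi e : rat := pi (ends G e).1 - pi (ends G e).2.

Definition tension G x : Prop :=
  exists pi, forall e, x e = if e \in edges G then dif G pi e else 0.

(** Conservation at a vertex is the case where pi is its indicator; testing
    against all potentials makes flows easy to push to a contraction. *)
Definition flow G y : Prop :=
  (forall e, y e != 0 -> e \in edges G) /\
  forall pi, \sum_e y e * dif G pi e = 0.

Lemma graph_opair G : opair (edges G) (tension G) (flow G).
Proof.
split.
- split.
  + by exists (fun=> 0) => e; rewrite /dif subrr if_same.
  + move=> a b x y [pi xE] [pi' yE]; exists (fun v => a * pi v + b * pi' v) =>
      e.
    by rewrite xE yE /dif; case: ifP => _; [ring | rewrite !mulr0 addr0].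
  + by move=> x y xy [pi xE]; exists pi => e; rewrite -xy.
  + by move=> x e [pi ->]; case: ifP => //; rewrite eqxx.
- split.
  + by split=> [e|pi]; rewrite ?eqxx // big1 // => e _; rewrite mul0r.
  + move=> a b x y [xs xf] [ys yf]; split=> [e|pi].
      have [x0|/xs//] := eqVneq (x e) 0; have [y0|/ys//] := eqVneq (y e) 0.
      by rewrite x0 y0 !mulr0 addr0 eqxx.
    transitivity (a * (\sum_e x e * dif G pi e) + b * \sum_e y e * dif G pi e).
      by rewrite !mulr_sumr -big_split; apply: eq_bigr => e _ /=; ring.
    by rewrite xf yf !mulr0 addr0.
  + move=> x y xy [xs xf]; split=> [e|pi]; first by rewrite -xy; exact: xs.
    by rewrite -[RHS](xf pi); apply: eq_bigr => e _; rewrite xy.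
  + by move=> x e [xs _]; exact: xs.
- move=> x y [pi xE] [ys yf]; rewrite -[RHS](yf pi); apply: eq_bigr => e _.
  have [->|/ys eG] := eqVneq (y e) 0; first by rewrite mulr0 mul0r.
  by rewrite xE eG mulrC.
Qed.

Definition sgnd x : {set E * bool} :=
  [set t | if t.2 then x t.1 < 0 else 0 < x t.1].

Lemma sgnd_neq0 x t : t \in sgnd x -> x t.1 != 0.
Proof. by rewrite inE neq_lt; case: t.2 => ->; rewrite ?orbT. Qed.

Definition supp x : {set E} := [set e | x e != 0].

Lemma dedges_sgnd x : dedges (sgnd x) = supp x.
Proof.
apply/setP => e; rewrite inE; apply/imsetP/idP => [[t /sgnd_neq0 tx ->] //|].
rewrite neq_lt => /orP[xe|xe]; [exists (e, true) | exists (e, false)] => //;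
  by rewrite inE.
Qed.

Lemma directed_sgnd s x : reflect (npos s x) (directed s (sgnd x)).
Proof.
apply: (iffP forallP) => [dir e|px [e c]].
  have := dir (e, true); have := dir (e, false); rewrite !inE /sg /=.
  by case: (s e) => /=; case: ltgtP => //=; lra.
apply/implyP; rewrite inE /=; have := px e; rewrite /sg.
by case: (s e); case: c => //=; rewrite ?mulN1r ?mul1r ?oppr_ge0 leNgt =>
  /negbTE ->.
Qed.

(** The bridge between signed sets and vectors. *)
Definition represents (W : (E -> rat) -> Prop) (P : {set E * bool} -> bool) :=
  forall D, P D <-> exists2 x, elem W x & D = sgnd x.

Definition dsg t : rat := if t.2 then -1 else 1.

Lemma dsg_dif G pi t :
  dsg t * dif G pi t.1 = pi (dtail G t) - pi (dhead G t).
Proof. by rewrite /dsg /dif /dhead /dtail /=; case: t => e [] /=; ring. Qed.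

(** A vector supported by the edges of a walk, given by its values zeta in the
    directions of the darts. *)
Definition walk_vec (w : seq (E * bool)) (zeta : E * bool -> rat) e : rat :=
  \sum_(t <- w) if t.1 == e then dsg t * zeta t else 0.

Lemma walk_vec_dif G w zeta pi :
  \sum_e walk_vec w zeta e * dif G pi e =
  \sum_(t <- w) zeta t * (pi (dtail G t) - pi (dhead G t)).
Proof.
under eq_bigr => e _ do rewrite mulr_suml.
rewrite exchange_big; apply: eq_bigr => t _ /=.
rewrite (bigD1 t.1) //= eqxx big1 ?addr0 => [|e]; last first.
  by rewrite eq_sym => /negbTE ->; rewrite mul0r.
by rewrite -dsg_dif; ring.
Qed.

Lemma walk_vec_edge w zeta t : uniq [seq t.1 | t <- w] -> t \in w ->
  walk_vec w zeta t.1 = dsg t * zeta t.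
Proof.
elim: w => //= t' w IHw /andP[t'w uw]; rewrite inE /walk_vec big_cons.
have [tt' _|tt' /= tw] := eqVneq t t'.
  subst t'; rewrite eqxx big1_seq ?addr0 // => t'' /andP[_ t''w].
  by case: eqP => // tt; case/negP: t'w; rewrite -tt; apply/mapP; exists t''.
rewrite ifN ?add0r; first exact: IHw.
by apply: contraNneq t'w => ->; apply/mapP; exists t.
Qed.

Lemma walk_vec_out w zeta e : e \notin [seq t.1 | t <- w] -> walk_vec w zeta e =
  0.
Proof.
move=> ew; rewrite /walk_vec big1_seq // => t /andP[_ tw].
by case: eqP => // te; case/negP: ew; rewrite -te; apply/mapP; exists t.
Qed.

Lemma cycle_heads G t0 w : cycle (fun t t' => dhead G t == dtail G t') (t0 :: w)
  ->
  [seq dhead G t | t <- t0 :: w] = rcons [seq dtail G t | t <- w] (dtail G t0).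
Proof.
rewrite /=; move: {2 4}t0 => t1; elim: w t0 => [|t w IHw] t0 /=.
  by case/andP=> /eqP ->.
by case/andP=> /eqP -> /IHw ->.
Qed.

Lemma uniq_map_sum (A : eqType) (w : seq (E * bool)) (h : E * bool -> A) zeta t
  :
  uniq [seq h t | t <- w] -> t \in w ->
  \sum_(t' <- w) zeta t' * (h t' == h t)%:R = zeta t :> rat.
Proof.
elim: w => //= t' w IHw /andP[t'w uw]; rewrite inE big_cons.
have [tt' _|tt' /= tw] := eqVneq t t'.
  subst t'; rewrite eqxx mulr1 big1_seq ?addr0 // => t'' /andP[_ t''w].
  case: eqP => [tt|]; last by rewrite mulr0.
  by case/negP: t'w; rewrite -tt; apply/mapP; exists t''.
rewrite IHw //; case: eqP => [tt|_]; last by rewrite mulr0 add0r.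
by case/negP: t'w; rewrite tt; apply/mapP; exists t.
Qed.

(** A flow z supported by a circuit has the same value on consecutive darts,
    by conservation at their common vertex, so it is zero as soon as it vanishes
    on one edge of the circuit. *)
Lemma circuit_flow G D : circuit G D -> exists2 x, elem (flow G) x & D = sgnd x.
Proof.
case/existsP=> k /existsP[w /and5P[/eqP -> k0 wG ue /andP[ut cw]]].
have [t0 [p wE]] : exists t0 p, tval w = t0 :: p.
  by case: w {wG ue ut cw} => -[|t0 p] /= sz; [move: k0;
    rewrite -(eqP sz) | exists t0, p].
have hE := cycle_heads; move: cw; rewrite wE => cw; have {}hE := hE _ _ _ cw.
rewrite wE in wG ue ut.
set q := t0 :: p in wG ue ut hE cw.
have wq t : (t \in w) = (t \in q) by rewrite memtE wE.
have uh : uniq [seq dhead G t | t <- q] by rewrite hE rcons_uniq -cons_uniq.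
have vE t : t \in q -> walk_vec q (fun=> 1) t.1 = dsg t.
  by move=> tq; rewrite walk_vec_edge // mulr1.
have edge e : e \in [seq t.1 | t <- q] -> exists2 t, t \in q & e = t.1 by
  move/mapP.
exists (walk_vec q (fun=> 1)); last first.
  apply/setP => t; rewrite [LHS]in_set [RHS]in_set wq; apply/idP/idP => [tq|].
    by rewrite vE // /dsg; case: t.2.
  move=> tx; have /edge[t' t'q tt'] : t.1 \in [seq t.1 | t <- q].
    by apply: contraLR tx => /walk_vec_out ->; rewrite ltxx if_same.
  move: tx; rewrite tt' vE // /dsg; case: t tt' => e [] /=;
    case: t' t'q => e' [] //= + -> //.
split.
- split=> [e|pi].
    have [/edge[t tq ->] _|/walk_vec_out->] := boolP (e \in [seq t.1 | t <- q]).
      exact: allP wG t tq.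
    by rewrite eqxx.
  rewrite walk_vec_dif; under eq_bigr do rewrite mul1r; rewrite sumrB.
  have -> : \sum_(t <- q) pi (dhead G t) = \sum_(v <- [seq dhead G t | t <- q])
    pi v.
    by rewrite big_map.
  by rewrite hE big_rcons /= big_map /q big_cons addrC subrr.
- by exists t0.1; rewrite vE ?inE ?eqxx // /dsg; case: t0.2.
move=> z [zG zf] [e0 ze0] zx.
pose zeta t := dsg t * z t.1.
have zw e : e \notin [seq t.1 | t <- q] -> z e = 0.
  by move=> eq; apply/eqP; apply: contraT => /zx; rewrite walk_vec_out ?eqxx.
have zE : walk_vec q zeta =1 z.
  move=> e; have [/edge[t tq ->]|eq] := boolP (e \in [seq t.1 | t <- q]);
    last first.
    by rewrite walk_vec_out // zw.
  by rewrite walk_vec_edge // /zeta /dsg; case: t.2; ring.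
have step t t' : t \in q -> t' \in q -> dhead G t = dtail G t' -> zeta t = zeta
  t'.
  move=> tq t'q tt'; have := zf (fun v => (v == dhead G t)%:R).
  under eq_bigr => e _ do rewrite -zE.
  rewrite walk_vec_dif; under eq_bigr do rewrite mulrBr; rewrite sumrB.
  by rewrite (uniq_map_sum zeta uh tq) tt' (uniq_map_sum zeta ut t'q) => /eqP;
    rewrite subr_eq0 => /eqP.
have along p' t2 t : {subset t2 :: p' <= q} ->
    path (fun t t' => dhead G t == dtail G t') t2 p' -> t \in t2 :: p' ->
    zeta t = zeta t2.
  elim: p' t2 => [|t1 p' IHp] t2 sub /=; first by rewrite inE => _ /eqP ->.
  case/andP=> /eqP h12 pth; rewrite inE => /predU1P[->//|tp].
  rewrite (IHp t1) //; last by move=> t3 t3p; apply: sub; rewrite inE t3p orbT.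
  by apply/esym/step => //; apply: sub; rewrite !inE eqxx ?orbT.
have const t : t \in q -> zeta t = zeta t0.
  by apply: along => //; move: cw; rewrite /= rcons_path => /andP[].
have z0 : zeta t0 != 0.
  have /edge[t tq e0E] : e0 \in [seq t.1 | t <- q] by apply: contraNT ze0 => /zw
    ->.
  by rewrite -(const t tq) /zeta -e0E /dsg; case: t.2;
    rewrite ?mulN1r ?mul1r ?oppr_eq0.
move=> e; have [/edge[t tq ->] _|/walk_vec_out->] := boolP (e \in [seq t.1 | t
  <- q]); last first.
  by rewrite eqxx.
by apply: contraNneq z0 => zt; rewrite -(const t tq) /zeta zt mulr0.
Qed.

Lemma flow_next G x t : flow G x -> t \in sgnd x ->
  exists2 t', t' \in sgnd x & dtail G t' = dhead G t.
Proof.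
move=> [_ xf] tx; pose v := dhead G t.
have [/existsP[t' /andP[t'x /eqP t'v]]|/existsPn no] :=
  boolP [exists t', (t' \in sgnd x) && (dtail G t' == v)]; first by exists t'.
pose pi u : rat := (u == v)%:R.
have nonpos e : x e * dif G pi e <= 0.
  have := no (e, true); have := no (e, false); rewrite !inE /= /dif /pi /dtail
    /=.
  case: ltgtP => [x0|x0|<-]; rewrite /= ?mul0r ?lexx //.
    by move=> /negbTE ->; rewrite sub0r => _; rewrite mulrN oppr_le0 mulr_ge0
      ?ler0n // ltW.
  by move=> _ /negbTE ->; rewrite subr0 mulr_le0_ge0 ?ler0n // ltW.
have lt : x t.1 * dif G pi t.1 < 0.
  have := no t; rewrite tx /= => tv.
  have : dsg t * dif G pi t.1 = -1.
    by rewrite dsg_dif /pi (negbTE tv) eqxx sub0r.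
  move: tx; rewrite inE /dsg; case: t.2 => xt; nra.
have := xf pi; rewrite (bigD1 t.1) //=; set Q := \sum_(_ | _) _.
have : Q <= 0 by rewrite /Q; apply: sumr_le0 => i _; exact (nonpos i).
lra.
Qed.

(** Follow the flow from vertex to vertex until it loops: the loop is a
    circuit inside the support of x, hence all of it by minimality. *)
Lemma flow_circuit G x : elem (flow G) x -> circuit G (sgnd x).
Proof.
move=> [fx [e0 xe0] xmin].
have [t0 t0x] : exists t0, t0 \in sgnd x.
  have : e0 \in dedges (sgnd x) by rewrite dedges_sgnd inE.
  by case/imsetP => t0 t0x _; exists t0.
pose out v := [pick t | (t \in sgnd x) && (dtail G t == v)].
pose o v := odflt t0 (out v).
pose nx v := dhead G (o v).
pose good v := out v != None.
have goodP v : good v -> (o v \in sgnd x) /\ dtail G (o v) = v.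
  by rewrite /good /o /out; case: pickP => // t /andP[tx /eqP].
have good_next v : good v -> good (nx v).
  move=> /goodP[ox _]; have [t tx tv] := flow_next fx ox.
  by rewrite /good /out; case: pickP => // /(_ t); rewrite tx tv eqxx.
have good0 : good (dtail G t0).
  by rewrite /good /out; case: pickP => // /(_ t0); rewrite t0x eqxx.
have good_iter n v : good v -> good (iter n nx v).
  by move=> gv; elim: n => //= n; exact: good_next.
set v0 := dtail G t0 in good0; pose n := order nx v0.
have un : uniq (traject nx v0 n) by exact: orbit_uniq.
have /trajectP[i i_n vE] : iter n nx v0 \in traject nx v0 n by exact:
  looping_order.
set v := iter i nx v0 in vE; pose k := (n - i).-1.
have kE : (n - i)%N = k.+1 by rewrite prednK // subn_gt0.
have vk : iter k.+1 nx v = v by rewrite -kE /v -iterD subnK // ltnW.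
have uv : uniq (traject nx v k.+1).
  by move: un; rewrite -(subnKC (ltnW i_n)) trajectD cat_uniq kE => /and3P[].
have gv u : u \in traject nx v k.+1 -> good u.
  by case/trajectP=> j _ ->; apply/good_iter/good_iter.
pose w := [seq o u | u <- traject nx v k.+1].
have wx t : t \in w -> t \in sgnd x by case/mapP=> u /gv/goodP[ou _] ->.
have tails : [seq dtail G t | t <- w] = traject nx v k.+1.
  rewrite -map_comp -[RHS]map_id; apply/eq_in_map => u /gv/goodP[_ +] //.
have sgnd_inj t t' : t \in sgnd x -> t' \in sgnd x -> t.1 = t'.1 -> t = t'.
  rewrite !inE; case: t t' => e [] [e' []] /= + + ee; rewrite -ee //;
    by case: ltgtP.
have ue : uniq [seq t.1 | t <- w].
  rewrite map_inj_in_uniq; first by apply: (@map_uniq _ _ (dtail G));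
    rewrite tails.
  by move=> t t' /wx tx /wx; exact: sgnd_inj.
have cw : cycle (fun t t' => dhead G t == dtail G t') w.
  rewrite /w /= -map_rcons path_map.
  have -> : rcons (traject nx (nx v) k) v = traject nx (nx v) k.+1.
    by rewrite trajectSr -iterSr vk.
  apply: (sub_in_path (P := good) (e := frel nx)); last exact: fpath_traject.
    by move=> u u' _ /goodP[_ u'E] /= /eqP uu'; rewrite u'E -uu'.
  apply/allP => u; rewrite inE => /predU1P[->|]; first by exact: good_iter.
  by case/trajectP=> j _ ->; apply/good_iter/good_next/good_iter.
have sw : (size w < #|E|.+1)%N.
  by rewrite ltnS -(size_map fst w) -(card_uniqP ue) max_card.
have wC : circuit G [set t in w].
  apply/existsP; exists (Ordinal sw); apply/existsP; exists (in_tuple w).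
  apply/and5P; split=> //; last by rewrite tails uv.
  apply/allP => t /wx tx; have [xs _] := fx; apply: xs.
  exact: sgnd_neq0.
have [y [fy ney _] wE] := circuit_flow wC.
have suppw e : y e != 0 -> exists2 t, t \in w & t.1 = e.
  move=> ye; have : e \in dedges (sgnd y) by rewrite dedges_sgnd inE.
  by rewrite -wE => /imsetP[t]; rewrite inE; exists t.
suff -> : sgnd x = [set t in w] by [].
apply/setP => t; rewrite [RHS]inE; apply/idP/idP => [tx|/wx//].
have xt := sgnd_neq0 tx.
have /suppw[t' t'w tt'] : y t.1 != 0.
  by apply: xmin => // e /suppw[t' /wx t'x <-]; exact: sgnd_neq0.
by rewrite (sgnd_inj t t' tx (wx _ t'w)).
Qed.

Lemma circuit_rep G : represents (flow G) (circuit G).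
Proof.
by move=> D; split=> [/circuit_flow|[x /flow_circuit + ->]].
Qed.

Lemma represents_cycle (W : (E -> rat) -> Prop) P C : represents W P ->
  (exists2 D, P D & dedges D = C) <-> exists2 x, elem W x & C = supp x.
Proof.
move=> rep; split=> [[D /rep[x ex ->] <-]|[x ex ->]].
  by exists x; rewrite // dedges_sgnd.
by exists (sgnd x); [apply/rep; exists x | rewrite dedges_sgnd].
Qed.

Definition ind X (v : V) : rat := (v \in X)%:R.
Definition cut_vec G X e : rat := if e \in edges G then dif G (ind X) e else 0.

Lemma sgnd_cut G X : sgnd (cut_vec G X) = cut_darts G X.
Proof.
apply/setP => -[e c]; rewrite !inE /cut_vec /dif /ind /dhead /dtail /=.
case: (e \in edges G) => /=; last by rewrite ltxx if_same.
by case: c => /=; case: (_ \in X); case: (_ \in X).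
Qed.

Lemma supp_cut G X : supp (cut_vec G X) = dedges (cut_darts G X).
Proof. by rewrite -sgnd_cut dedges_sgnd. Qed.

Lemma tension_cut G X : tension G (cut_vec G X).
Proof. by exists (ind X). Qed.

(** The indicator of a level set of the potential keeps the sign on e. *)
Lemma tension_level_cut G x e : tension G x -> x e != 0 ->
  exists X, supp (cut_vec G X) \subset supp x /\ 0 < cut_vec G X e * x e.
Proof.
move=> [pi xE] xe; pose c := Order.min (pi (ends G e).1) (pi (ends G e).2).
exists [set v | c < pi v]; split.
  apply/subsetP => f; rewrite !inE xE /cut_vec; case: ifP => // _.
  apply: contraNneq => /eqP; rewrite /dif /ind !inE subr_eq0 => /eqP ->.
  by rewrite subrr.
move: xe; rewrite xE /cut_vec; case: ifP => [_|]; last by rewrite eqxx.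
rewrite /dif /ind !inE subr_eq0 /c.
have [lt|lt|->] := ltgtP (pi (ends G e).1) (pi (ends G e).2); last by [].
  by rewrite ltxx lt /= => _; lra.
by rewrite ltxx lt /= => _; lra.
Qed.

(** A tension whose support lies in a minimal cut contains a cut, by
    [tension_level_cut], which can only be the minimal one. *)
Lemma cocycle_elem G X : is_cocycle G (dedges (cut_darts G X)) ->
  elem (tension G) (cut_vec G X).
Proof.
case/minsetP => /andP[/set0Pn[e0 e0X] _] min; split; first exact: tension_cut.
  by exists e0; move: e0X; rewrite -supp_cut inE.
move=> z tz [e ze] zx f fx.
have [Y [Yz Ye]] := tension_level_cut tz ze.
have eY : e \in supp (cut_vec G Y) by rewrite inE; apply: contraTneq Ye => ->;
  rewrite mul0r ltxx.
have := min (dedges (cut_darts G Y)); rewrite /= -!supp_cut => E0.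
have /setP/(_ f) : supp (cut_vec G Y) = supp (cut_vec G X).
  apply: E0; last by apply: subset_trans Yz _; apply/subsetP => g; rewrite !inE;
    exact: zx.
  apply/andP; split; first by apply/set0Pn; exists e.
  by apply/existsP; exists Y; rewrite supp_cut.
rewrite [RHS]inE fx => fY.
by have := subsetP Yz f; rewrite fY => /(_ isT); rewrite inE.
Qed.

(** The support of x contains that of a cut vector, so they are equal; the two
    vectors are proportional since a combination vanishing at one more edge
    has to be zero. *)
Lemma elem_cocycle G x : elem (tension G) x ->
  is_cocycle G (supp x) /\ exists X, sgnd x = cut_darts G X.
Proof.
move=> [tx [e xe] xmin].
have supp_min z : tension G z -> (exists f, z f != 0) -> supp z \subset supp x
  ->
    supp z = supp x.
  move=> tz nz zx; apply/eqP; rewrite eqEsubset zx; apply/subsetP => f;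
    rewrite !inE.
  by apply: xmin => // g gz; have := subsetP zx g; rewrite !inE; apply.
have [X [Xx Xe]] := tension_level_cut tx xe.
have Xe0 : cut_vec G X e != 0 by apply: contraTneq Xe => ->; rewrite mul0r ltxx.
have suppX : supp (cut_vec G X) = supp x.
  by apply: supp_min Xx; [exact: tension_cut | exists e].
split.
  apply/minsetP; split.
    apply/andP; split; first by apply/set0Pn; exists e; rewrite inE.
    by apply/existsP; exists X; rewrite -supp_cut suppX.
  move=> A /andP[/set0Pn[f fA] /existsP[Y /eqP YA]] Ax.
  rewrite -YA -supp_cut; apply: supp_min; first exact: tension_cut.
    by exists f; move: fA; rewrite -YA -supp_cut inE.
  by rewrite supp_cut YA.
exists X; rewrite -sgnd_cut.
pose c := x e / cut_vec G X e.
have c0 : 0 < c.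
  have -> : c = (cut_vec G X e * x e) / (cut_vec G X e) ^+ 2 by rewrite /c;
    field.
  by rewrite divr_gt0 // exprn_even_gt0.
have xE f : x f = c * cut_vec G X f.
  pose z g := 1 * x g + - c * cut_vec G X g.
  have tz : tension G z by apply: (sub_lin (cv_sub (graph_opair G))) => //;
    exact: tension_cut.
  have ze : z e = 0 by rewrite /z mul1r mulNr divfK // subrr.
  have [zf|zf] := eqVneq (z f) 0; first by move: zf; rewrite /z; lra.
  have : supp z = supp x.
    apply: supp_min => //; first by exists f.
    apply/subsetP => g; rewrite !inE /z; apply: contraNneq => xg.
    have : g \notin supp (cut_vec G X) by rewrite suppX inE xg eqxx.
    by rewrite inE negbK => /eqP ->; rewrite xg !mulr0 addr0.
  by move/setP/(_ e); rewrite !inE ze eqxx xe.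
by apply/setP => t; rewrite !inE xE pmulr_rlt0 // pmulr_rgt0.
Qed.

Lemma cocircuit_rep G : represents (tension G) (cocircuit G).
Proof.
move=> D; split=> [/andP[coc /existsP[X /eqP XD]]|[x ex ->]].
  by exists (cut_vec G X); rewrite ?sgnd_cut // ; apply: cocycle_elem;
    rewrite XD.
have [coc [X XD]] := elem_cocycle ex; rewrite /cocircuit dedges_sgnd coc.
by apply/existsP; exists X; rewrite XD.
Qed.

Lemma is_cycleP G C : is_cycle G C <-> exists2 x, elem (flow G) x & C = supp x.
Proof.
apply: iff_trans (represents_cycle C (circuit_rep G)).
split=> [/existsP[D /andP[cD /eqP <-]]|[D cD <-]]; first by exists D.
by apply/existsP; exists D; rewrite cD eqxx.
Qed.

Lemma is_cocycleP G C :
  is_cocycle G C <-> exists2 x, elem (tension G) x & C = supp x.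
Proof.
split=> [coc|[x ex ->]]; last by have [] := elem_cocycle ex.
have /minsetP[/andP[_ /existsP[X /eqP XC]] _] := coc.
by exists (cut_vec G X); rewrite ?supp_cut //; apply: cocycle_elem; rewrite XC.
Qed.

Lemma adj_sym G F : symmetric (adj G F).
Proof. by move=> u v; apply: eq_existsb => e; rewrite orbC. Qed.

Lemma connect_sym_adj G F : connect_sym (adj G F).
Proof. exact/sym_connect_sym/adj_sym. Qed.

Lemma adj_edge G F e : e \in F -> adj G F (ends G e).1 (ends G e).2.
Proof. by move=> eF; apply/existsP; exists e; rewrite eF -surjective_pairing
  eqxx. Qed.

Lemma adjP G F u v : adj G F u v -> exists2 e, e \in F &
  exists c : rat, forall pi, pi u - pi v = c * dif G pi e.
Proof.
case/existsP=> e /andP[eF /orP[] /eqP ee]; exists e => //;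
  [exists 1 | exists (-1)] => pi;
  by rewrite /dif ee /=; ring.
Qed.

Lemma connect_pot G F pi u v : connect (adj G F) u v ->
  (forall e, e \in F -> dif G pi e = 0) -> pi u = pi v.
Proof.
case/connectP=> p + -> piF; elim: p u => //= w p IHp u /andP[/adjP[e eF [c eE]]
  /IHp <-].
by apply/eqP; rewrite -subr_eq0 eE piF ?mulr0.
Qed.

Lemma connect_flow G F u v : connect (adj G F) u v -> exists z,
  (forall e, z e != 0 -> e \in F) /\
  forall pi, \sum_e z e * dif G pi e = pi u - pi v.
Proof.
case/connectP=> p + ->; elim: p u => /= [|w p IHp] u.
  by exists (fun=> 0); split=> [e|pi]; rewrite ?eqxx // big1 ?subrr // => e _;
    rewrite mul0r.
case/andP=> /adjP[e eF [c eE]] /IHp[z [zF zpi]].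
exists (fun f => (if f == e then c else 0) + z f); split=> [f|pi].
  by case: (eqVneq f e) => [->//|_]; rewrite add0r; exact: zF.
under eq_bigr do rewrite mulrDl.
rewrite big_split /= zpi (bigD1 e) //= eqxx -eE big1 => [|f /negbTE ->];
  last by rewrite mul0r.
by ring.
Qed.

(** Conformal decomposition for the signs of y itself. *)
Lemma flow_cycle G y : flow G y -> (exists e, y e != 0) ->
  exists2 C, is_cycle G C & C \subset supp y.
Proof.
move=> fy [e ye]; pose s f := y f < 0.
have py : npos s y.
  by move=> f; rewrite /sg /s; case: ltP => yf; lra.
have [z [ez _ _ zy]] := conformal (fv_sub (graph_opair G)) fy py ye.
exists (supp z); first by apply/is_cycleP; exists z.
by apply/subsetP => f; rewrite !inE; exact: zy.
Qed.

Definition comp G F v : {set V} := [set w | connect (adj G F) v w].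

Lemma cut_comp G F v e : e \in F -> dif G (ind (comp G F v)) e = 0.
Proof.
move=> eF; rewrite /dif /ind !inE.
have cs := same_connect_r (connect_sym_adj G F) (connect1 (adj_edge G eF)).
by rewrite cs subrr.
Qed.

(** Removing b from T separates the ends of b, which gives the fundamental cut;
    the path of T between the ends of e gives the fundamental cycle.
    Conversely, pairing with fundamental vectors shows that no flow lives on T
    and that no tension vanishes on T. *)
Lemma spanning_tree_tab G T : spanning_tree G T <->
  exists u, tableau (tension G) (flow G) (edges G) T u.
Proof.
split=> [/and3P[/subsetP TG /forallP acyc /forallP conn]|[u tab]].
  have noflow y : flow G y -> (forall e, y e != 0 -> e \in T) -> forall e, y e =
    0.
    move=> fy yT e; apply/eqP; apply: contraT => ye.
    have [|C cC Cy] := flow_cycle fy; first by exists e.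
    have := acyc C; rewrite cC => /negP[]; apply: subset_trans Cy _.
    by apply/subsetP => f; rewrite inE; exact: yT.
  suff: forall f, exists uf : E -> rat,
      [/\ f \in T -> tension G uf, f \in edges G :\: T -> flow G uf,
          f \in edges G -> uf f = 1
        & forall g, f \in edges G -> g \in edges G -> f != g ->
            (f \in T) = (g \in T) -> uf g = 0].
    case/fin_all_exists => u uP; exists u; split.
    - exact/subsetP.
    - by move=> b bT; have [/(_ bT)] := uP b.
    - by move=> e eT; have [_ /(_ eT)] := uP e.
    - by move=> f fG; have [_ _ /(_ fG)] := uP f.
    - by move=> f g; have [_ _ _] := uP f; exact.
  move=> f; have [fG|fG] := boolP (f \in edges G); last first.
    by exists (fun=> 0); split; rewrite ?inE ?(negbTE fG) ?andbF // => /TG;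
      rewrite (negbTE fG).
  have [fT|fT] := boolP (f \in T).
    pose v := (ends G f).1; pose X := comp G (T :\ f) v.
    have vX : v \in X by rewrite inE connect0.
    have fX : (ends G f).2 \notin X.
      apply/negP; rewrite inE => /connect_flow[z [zT zpi]].
      pose y e := (e == f)%:R - z e.
      have yf : y f = 1.
        rewrite /y eqxx; have [->|/zT] := eqVneq (z f) 0;
          first by rewrite subr0.
        by rewrite !inE eqxx.
      have yT e : y e != 0 -> e \in T.
        rewrite /y; case: (eqVneq e f) => [->//|_];
          rewrite sub0r oppr_eq0 => /zT.
        by rewrite inE => /andP[].
      have fy : flow G y.
        split=> [e /yT/TG//|pi].
        under eq_bigr do rewrite mulrBl.
        rewrite sumrB zpi (bigD1 f) //= eqxx mul1r big1 ?addr0 ?subrr // => e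
          /negbTE ->.
        by rewrite mul0r.
      by have /eqP := noflow y fy yT f; rewrite yf oner_eq0.
    exists (cut_vec G X); split; rewrite ?inE ?fT //.
    - by move=> _; exact: tension_cut.
    - by rewrite /cut_vec fG /dif /ind vX (negbTE fX) subr0.
    - move=> g _ gG fg /esym gT; rewrite /cut_vec gG cut_comp // !inE eq_sym fg.
      exact: gT.
  have /forallP/(_ (ends G f).2)/implyP := conn (ends G f).1.
  move=> /(_ (connect1 (adj_edge G fG)))/connect_flow[z [zT zpi]].
  pose y e := (e == f)%:R - z e.
  have zf e : e \notin T -> z e = 0 by move=> eT; apply/eqP; apply: contraNT eT;
    exact: zT.
  exists y; split; rewrite ?inE ?(negbTE fT) //.
  - move=> _; split=> [e|pi].
      rewrite /y; case: (eqVneq e f) => [->//|_]; rewrite sub0r oppr_eq0 => /zT;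
        exact: TG.
    under eq_bigr do rewrite mulrBl.
    rewrite sumrB zpi (bigD1 f) //= eqxx mul1r big1 ?addr0 ?subrr // => e
      /negbTE ->.
    by rewrite mul0r.
  - by rewrite /y eqxx zf // subr0.
  - by move=> g _ _ fg /esym/negbT gT; rewrite /y eq_sym (negbTE fg) zf //
      subrr.
have op := graph_opair G.
apply/and3P; split; first exact: tab_sub tab.
  apply/forallP => C; apply/implyP => /is_cycleP[y [fy [e ye] _] ->].
  apply/negP => /subsetP yT.
  have := tab_zero (opair_dual op) (tableau_dual tab) fy.
  move=> /(_ _ e) y0; rewrite y0 ?eqxx // in ye => g.
  rewrite inE => /andP[gT _]; apply/eqP; apply: contraNT gT => yg.
  by apply: yT; rewrite inE.
apply/forallP => v; apply/forallP => w; apply/implyP => vw.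
have X0 := tab_zero op tab (tension_cut G (comp G T v)).
have {}X0 e : e \in edges G -> dif G (ind (comp G T v)) e = 0.
  move=> eG; have := X0 _ e; rewrite /cut_vec eG; apply => g gT.
  by case: ifP => // _; exact: cut_comp.
have := connect_pot vw X0; rewrite /ind !inE connect0.
by case: (connect _ v w) => // /eqP; rewrite oner_eq0.
Qed.

(** A maximal acyclic set spans: an edge leaving a component could be added,
    as a cycle through it would cross the cut around this component once. *)
Lemma spanning_tree_ex G : exists T, spanning_tree G T.
Proof.
pose ind_set := [pred T : {set E} | (T \subset edges G) && [forall C, is_cycle G
  C ==> ~~ (C \subset T)]].
have i0 : ind_set set0.
  rewrite /= sub0set /=; apply/forallP => C; apply/implyP => /is_cycleP[y [_ [e
    ye] _] ->].
  by apply/negP => /subsetP/(_ e); rewrite !inE => /(_ ye).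
case: (arg_maxnP (P := ind_set) (fun T => #|T|) i0) => T /andP[TG /forallP acyc]
  max.
exists T; rewrite /spanning_tree TG /=; apply/andP; split; first exact/forallP.
apply/forallP => v; apply/forallP => w; apply/implyP => vw;
  apply: contraT => nvw.
have [/existsP[e /andP[eG eX]]|/existsPn noe] :=
  boolP [exists e, (e \in edges G) && (dif G (ind (comp G T v)) e != 0)];
    last first.
  have : ind (comp G T v) v = ind (comp G T v) w.
    by apply: connect_pot vw _ => e eG; apply/eqP; have := noe e;
      rewrite eG negbK.
  by rewrite /ind !inE connect0 (negbTE nvw) => /eqP; rewrite oner_eq0.
have eT : e \notin T by apply: contraNN eX => /cut_comp ->.
suff /max : ind_set (e |: T) by rewrite /= cardsU1 eT add1n ltnn.
rewrite /= subUset sub1set eG TG /=; apply/forallP => C; apply/implyP => cC.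
apply/negP => /subsetP CT; have := acyc C; rewrite cC => /negP; apply.
have /is_cycleP[y [fy _ _] CE] := cC; apply/subsetP => f fC.
have := CT f fC; rewrite !inE => /predU1P[fe|//].
have := orth (graph_opair G) (tension_cut G (comp G T v)) fy.
rewrite (bigD1 e) //= big1 => [|g ge]; last first.
  have [yg|yg] := eqVneq (y g) 0; first by rewrite yg mulr0.
  have := CT g; rewrite CE !inE yg (negbTE ge) => /(_ isT) /= gT.
  by rewrite /cut_vec cut_comp // if_same mul0r.
rewrite /cut_vec eG addr0 => /eqP; rewrite mulf_eq0 (negbTE eX) /= => ye.
by move: fC; rewrite CE inE fe (eqP ye) eqxx.
Qed.

End Graphs.
(** * Optimality in minors *)

Section OptMinor.
Context {d : Order.disp_t} {E : finOrderType d}.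
Implicit Types (S T : {set E}) (e f g h b m : E) (s : E -> bool).
Local Open Scope ring_scope.

(** Optimality only involves pairs of elements of equal level, so it passes to
    a set S' of whole levels, provided that the minor on S' contains the
    restrictions of the fundamental vectors. *)
Lemma opt_minor S cv fv s T lev S' cv' fv' :
    opair S cv fv -> opt S cv fv s T lev -> opair S' cv' fv' -> S' \subset S ->
    (forall f g, f \in S' -> g \in S -> lev g = lev f -> g \in S') ->
    (forall x, cv x -> (forall e, x e != 0 -> exists2 f, f \in S' & lev f <= lev
      e) ->
       cv' (fun e => if e \in S' then x e else 0)) ->
    (forall y, fv y -> (forall e, y e != 0 -> exists2 f, f \in S' & lev e <= lev
      f) ->
       fv' (fun e => if e \in S' then y e else 0)) ->
  opt S' cv' fv' s (T :&: S') lev.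
Proof.
move=> op [u [tab lv co]] op' /subsetP S'S lvl hcv hfv.
have S'T f : f \in S' -> (f \in T :&: S') = (f \in T) by move=> fS;
  rewrite inE fS andbT.
have same f h : f \in S' -> u f h != 0 -> lev h = lev f -> h \in S'.
  by move=> fS ufh; apply: lvl => //; exact: (tab_in op tab (S'S f fS) ufh).
pose u' f g := if g \in S' then u f g else 0.
have u'u f g : u' f g != 0 -> u f g != 0 /\ g \in S'.
  by rewrite /u'; case: ifP; rewrite ?eqxx.
have actE f : f \in S' -> actv u' f = actv u f.
  move=> fS; apply/idP/idP => [/actvP act|/actvP act]; last first.
    by apply/actvP => g /u'u[/act].
  apply: contraT => /(lev_pred lv (S'S f fS))[h [uh hf lh]].
  by have := act h; rewrite /u' (same f h) // leNgt hf => /(_ uh).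
exists u'; split.
- split.
  + exact: subsetIr.
  + move=> b; rewrite inE => /andP[bT bS]; apply: hcv;
      first exact: (tab_cv tab bT).
    move=> e ube; exists b => //; have := lev_mono lv (S'S b bS) ube.
    by rewrite /tau bT !mul1r.
  + move=> e; rewrite !inE => /andP[+ eS]; rewrite eS andbT => eT.
    apply: hfv; first by apply: (tab_fv tab); rewrite inE eT S'S.
    move=> f uef; exists e => //; have := lev_mono lv (S'S e eS) uef.
    by rewrite /tau (negbTE eT) !mulN1r lerN2.
  + by move=> f fS; rewrite /u' fS (tab_diag tab) ?S'S.
  + move=> f g fS gS fg; rewrite !S'T // => fgT.
    by rewrite /u' gS (tab_off tab) ?S'S.
- split=> f.
  + move=> g fS /u'u[ufg gS]; have := lev_mono lv (S'S f fS) ufg.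
    by rewrite /tau S'T.
  + move=> fS; rewrite actE // => /(lev_pred lv (S'S f fS))[h [uh hf lh]].
    by exists h; rewrite /u' (same f h).
  + by move=> fS; rewrite actE // => /(lev_actv lv (S'S f fS));
      rewrite /tau S'T.
- move=> f m fS /u'u[ufm mS] lm mf mmin; rewrite /u' mS.
  apply: (co f m (S'S f fS) ufm lm mf) => h uh lh; apply: mmin => //.
  by rewrite /u' (same f h).
Qed.

End OptMinor.

(** * Directed cycles and cocycles *)

Section DirectedSets.
Context {d : Order.disp_t} {E : finOrderType d}.
Implicit Types (S T C : {set E}) (e f a p m : E) (s : orientation E).
Local Open Scope ring_scope.

Definition dirset (P : {set E * bool} -> bool) s C : bool :=
  [exists D, [&& P D, dedges D == C & directed s D]].

Lemma dirset_elem W P s C : represents W P ->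
  dirset P s C <-> exists x, [/\ elem W x, npos s x & C = supp x].
Proof.
move=> rep; split.
  case/existsP=> D /and3P[/rep[x ex ->] /eqP <- /directed_sgnd px].
  by exists x; rewrite dedges_sgnd.
case=> x [ex px ->]; apply/existsP; exists (sgnd x); apply/and3P; split.
- by apply/rep; exists x.
- by rewrite dedges_sgnd.
- exact/directed_sgnd.
Qed.

Lemma dirset_min W P s C : represents W P -> dirset P s C ->
  exists m, is_min C m.
Proof.
move=> rep /(dirset_elem s C rep)[x [[_ [e xe] _] _ ->]].
by apply: set_min; apply/set0Pn; exists e; rewrite inE.
Qed.

Variables (S : {set E}) (cv fv : (E -> rat) -> Prop) (P : {set E * bool} ->
  bool).
Variables (s : orientation E) (T : {set E}) (lev : E -> int).
Hypotheses (op : opair S cv fv) (rep : represents cv P).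
Hypothesis o : opt S cv fv s T lev.

(** A minimal directed set through f exists as soon as a non-negative vector
    is non-zero at f, by conformal decomposition. *)
Lemma dirset_union (j : nat) (Q : pred {set E}) :
    (forall C, Q C = [forall g in C, (j <= rk g)%N]) ->
  \bigcup_(C | dirset P s C && Q C) C = [set f in S | j%:Z < lev f].
Proof.
move=> QE; have [u [tab lv co]] := o; apply/setP => f; rewrite [RHS]inE.
apply/bigcupP/andP => [[C /andP[/(dirset_elem s C rep)[x [[cx _ _] px
  ->]]]]|[fS]].
  rewrite QE inE => /forallP jx xf; have fS := sub_supp (cv_sub op) cx xf.
  split=> //; apply/(pos_iff j op tab lv co fS); exists x; split=> // e xe.
  by apply: (implyP (jx e)); rewrite inE.
case/(pos_iff j op tab lv co fS)=> x [cx px xf xj].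
have [z [ez pz zf zx]] := conformal (cv_sub op) cx px xf.
exists (supp z); last by rewrite inE.
apply/andP; split; first by apply/(dirset_elem s _ rep); exists z.
by rewrite QE; apply/forallP => e; apply/implyP; rewrite inE => /zx/xj.
Qed.

Lemma dirset_union_all :
  \bigcup_(C | dirset P s C) C = [set f in S | 0 < lev f].
Proof.
rewrite (eq_bigl (fun C => dirset P s C && true)) => [|C];
  last by rewrite andbT.
by rewrite (@dirset_union 0) // => C; apply/esym/forallP => g; rewrite implybT.
Qed.

Lemma min_geE e C : min_ge e C = [forall g in C, (rk e <= rk g)%N].
Proof. by apply: eq_forallb => g; rewrite rk_le. Qed.

Lemma min_gtE e C : min_gt e C = [forall g in C, ((rk e).+1 <= rk g)%N].
Proof. by apply: eq_forallb => g; rewrite rk_lt. Qed.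

Lemma dirset_active :
  [set e | [exists C, dirset P s C && is_min C e]] =
  [set a in S | lev a == (rk a).+1%:Z].
Proof.
apply/setP => a; rewrite [LHS]inE.
have -> : [exists C, dirset P s C && is_min C a] =
    (a \in \bigcup_(C | dirset P s C && min_ge a C) C).
  apply/existsP/bigcupP => [[C /andP[dC /andP[aC mC]]]|[C /andP[dC mC] aC]].
    by exists C; rewrite // dC.
  by exists C; rewrite dC /is_min aC.
rewrite (dirset_union (min_geE a)) !inE; have [aS|//] := boolP (a \in S).
by have := opt_le_rk op o aS; lia.
Qed.

Lemma dirset_bipolar p : is_min S p ->
  [forall e in S, exists C, dirset P s C && (e \in C)] &&
    [forall C, dirset P s C ==> (p \in C)] =
  [forall f in S, lev f == (rk p).+1%:Z].
Proof.
move=> /andP[pS /forallP pmin]; have allE := dirset_union_all.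
apply/andP/forallP => [[/forallP cov /forallP thru] f|levp].
  apply/implyP => fS; have : f \in [set f in S | 0 < lev f].
    rewrite -allE; have /existsP[C /andP[dC fC]] := implyP (cov f) fS.
    by apply/bigcupP; exists C; rewrite ?dC.
  rewrite inE fS => f0; have [a [aS _ la aE]] := opt_min op o fS.
  have : a \in [set a in S | lev a == (rk a).+1%:Z] by rewrite inE aS; lia.
  rewrite -dirset_active inE => /existsP[C /andP[dC /andP[_ /forallP amin]]].
  have pC := implyP (thru C) dC.
  have -> : p = a by apply/le_anti; rewrite (implyP (amin p) pC) (implyP (pmin
    a) aS).
  lia.
split; apply/forallP => f; apply/implyP.
  move=> fS; have : f \in [set f in S | 0 < lev f].
    by rewrite inE fS (eqP (implyP (levp f) fS)).
  rewrite -allE => /bigcupP[C dC fC].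
  by apply/existsP; exists C; rewrite dC.
case/(dirset_elem s _ rep)=> x [[cx [e xe] _] px ->].
have [u [tab lv co]] := o.
have [a [aT aa _ xa]] := nonneg_low op tab lv co cx px xe.
have aS := subsetP (tab_sub tab) _ aT.
have := lev_actv lv aS aa; rewrite (eqP (implyP (levp a) aS)) /tau aT => rkE.
have -> : p = a by apply: rk_inj; lia.
by rewrite inE.
Qed.

(** Bipolarity, expressed by levels on the one hand and by the numbers of
    active elements on the other hand. *)
Lemma single_level_card p : is_min S p ->
  [forall f in S, lev f == (rk p).+1%:Z] =
  (#|[set a in S | lev a == (rk a).+1%:Z]| == 1)%N &&
  (#|[set a in S | lev a == - (rk a).+1%:Z]| == 0)%N.
Proof.
move=> /andP[pS /forallP pmin]; apply/forallP/andP => [levp|].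
  have lE f : f \in S -> lev f = (rk p).+1%:Z.
    by move=> fS; apply/eqP/(implyP (levp f)).
  split; last first.
    rewrite cards_eq0; apply/eqP/setP => f; rewrite inE [RHS]inE.
    by case: (boolP (f \in S)) => //= /lE ->; lia.
  apply/cards1P; exists p; apply/setP => f; rewrite inE [RHS]inE.
  apply/andP/eqP => [[/lE -> /eqP E0]|->]; last by rewrite pS lE.
  by apply: rk_inj; lia.
case=> /cards1P[a /setP aE]; rewrite cards_eq0 => /eqP/setP noneg f.
apply/implyP => fS; have leva g : g \in S -> lev g = (rk a).+1%:Z.
  move=> gS; have [c [cS _ <- lc]] := opt_min op o gS.
  have := noneg c; have := aE c; rewrite !inE cS /=.
  by case: (eqVneq c a) => [<-|_]; lia.
have aS : a \in S by have := aE a; rewrite !inE eqxx => /andP[].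
have := implyP (pmin a) aS; have := opt_le_rk op o pS.
by rewrite leva // -rk_le => ? ?; rewrite leva //; lia.
Qed.

End DirectedSets.

(** * Optimal trees of graphs *)

Section Minors.
Context {V : finType} {d : Order.disp_t} {E : finOrderType d}.
Implicit Types (G : graph V E) (s : orientation E) (e f g b p : E).
Implicit Types (C F T : {set E}) (x y z : E -> rat) (lev : E -> int).
Local Open Scope ring_scope.

Lemma root_edge G F e : e \in F ->
  fingraph.root (adj G F) (ends G e).1 = fingraph.root (adj G F) (ends G e).2.
Proof.
move=> eF; apply/eqP; rewrite (root_connect (@connect_sym_adj _ _ _ G F)).
exact/connect1/adj_edge.
Qed.

(** A potential without tension on F is constant on the components of F, so it
    takes the same values at their representatives. *)
Lemma tension_contract G F x : tension G x -> (forall e, e \in F -> x e = 0) ->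
  tension (contract G F) x.
Proof.
move=> [pi xE] xF; exists pi => e; rewrite inE.
have piF f : f \in edges G :&: F -> dif G pi f = 0.
  by rewrite inE => /andP[fG /xF]; rewrite xE fG.
have [eF|eF] := boolP (e \in F); first by rewrite xF.
rewrite xE /=; case: ifP => // eG; rewrite /dif /=.
by rewrite -!(connect_pot (connect_root _ _) piF).
Qed.

Lemma flow_contract G F y : flow G y ->
  flow (contract G F) (fun e => if e \in F then 0 else y e).
Proof.
move=> [ys yf]; split=> [e|pi].
  by rewrite inE /=; case: (e \in F); rewrite ?eqxx //=; exact: ys.
rewrite -[RHS](yf (fun v => pi (fingraph.root (adj G (edges G :&: F)) v))).
apply: eq_bigr => e _; have [->|/ys eG] := eqVneq (y e) 0;
  first by rewrite if_same !mul0r.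
case: ifP => // eF; rewrite mul0r /dif root_edge ?subrr ?mulr0 //.
by rewrite inE eG.
Qed.

Lemma tension_restrict G F x : tension G x ->
  tension (restrict G F) (fun e => if e \in F then x e else 0).
Proof.
by move=> [pi xE]; exists pi => e; rewrite inE /= xE; case: (e \in F);
  rewrite ?andbT ?andbF.
Qed.

Lemma flow_restrict G F y : flow G y -> (forall e, y e != 0 -> e \in F) ->
  flow (restrict G F) y.
Proof. by move=> [ys yf] yF; split=> [e ye|pi];
  [rewrite inE ys ?yF | exact: yf]. Qed.

Definition gopt G s T lev := opt (edges G) (tension G) (flow G) s T lev.

Lemma gopt_restrict G s T lev F (k : int) : gopt G s T lev ->
    {in edges G, forall f, (f \in F) = (lev f <= k)} ->
  gopt (restrict G F) s (T :&: F) lev.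
Proof.
move=> o FE; have [u [tab _ _]] := o; have TG := tab_sub tab.
suff -> : T :&: F = T :&: edges (restrict G F).
  apply: opt_minor (graph_opair G) o (graph_opair _) _ _ _ _;
    first exact: subsetIl.
  - by move=> f g; rewrite !inE => /andP[fG fF] gG lg; rewrite gG FE // lg -FE.
  - move=> x tx _; have op := graph_opair (restrict G F).
    apply: (sub_ext (cv_sub op)) (tension_restrict F tx) => e; rewrite inE.
    case: (boolP (e \in edges G)) => //= eG; case: ifP => // _.
    apply/eqP; apply: contraNT eG; exact: (sub_supp (cv_sub (graph_opair G))
      tx).
  - move=> y fy ysupp; have op := graph_opair (restrict G F).
    have yF e : y e != 0 -> e \in F.
      move=> ye; have [f] := ysupp e ye; rewrite inE => /andP[fG fF] ef.
      have eG := sub_supp (fv_sub (graph_opair G)) fy ye.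
      by rewrite FE // (le_trans ef) // -FE.
    apply: (sub_ext (fv_sub op)) (flow_restrict fy yF) => e; rewrite inE.
    have [->|ye] := eqVneq (y e) 0; first by rewrite if_same.
    by rewrite yF // (sub_supp (fv_sub (graph_opair G)) fy ye).
by rewrite /= setIA (setIidPl TG).
Qed.

Lemma gopt_contract G s T lev F (k : int) : gopt G s T lev ->
    {in edges G, forall f, (f \in F) = (lev f <= k)} ->
  gopt (contract G F) s (T :\: F) lev.
Proof.
move=> o FE; have [u [tab _ _]] := o; have TG := tab_sub tab.
suff -> : T :\: F = T :&: edges (contract G F).
  apply: opt_minor (graph_opair G) o (graph_opair _) _ _ _ _;
    first exact: subsetDl.
  - by move=> f g; rewrite !inE => /andP[fF fG] gG lg;
      rewrite gG FE // lg -FE // fF.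
  - move=> x tx xsupp; have op := graph_opair (contract G F).
    have xF e : e \in F -> x e = 0.
      move=> eF; apply/eqP; apply: contraT => xe; have [f] := xsupp e xe.
      have eG := sub_supp (cv_sub (graph_opair G)) tx xe.
      rewrite inE => /andP[fF fG] fe; case/negP: fF.
      by rewrite FE // (le_trans fe) // -FE.
    apply: (sub_ext (cv_sub op)) (tension_contract tx xF) => e; rewrite inE.
    have [->|xe] := eqVneq (x e) 0; first by rewrite if_same.
    rewrite (sub_supp (cv_sub (graph_opair G)) tx xe) andbT ifT //.
    by apply: contraNN xe => /xF ->.
  - move=> y fy _; have op := graph_opair (contract G F).
    apply: (sub_ext (fv_sub op)) (flow_contract F fy) => e; rewrite inE.
    have [->|ye] := eqVneq (y e) 0; first by rewrite !if_same.
    by rewrite (sub_supp (fv_sub (graph_opair G)) fy ye) andbT; case: (e \in F).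
by rewrite /= setIDA (setIidPl TG).
Qed.

Lemma gopt_exists G s : exists T lev, gopt G s T lev.
Proof.
exact: (@opt_exists d E (edges G) _ _ (graph_opair G) (spanning_tree G)
  (spanning_tree_tab G) (spanning_tree_ex G) s).
Qed.

Lemma gopt_spanning G s T lev : gopt G s T lev -> spanning_tree G T.
Proof. by move=> [u [tab _ _]]; apply/spanning_tree_tab; exists u. Qed.

Section OptGraph.
Variables (G : graph V E) (s : orientation E) (T : {set E}) (lev : E -> int).
Hypothesis o : gopt G s T lev.
Let op := graph_opair G.

Lemma lev_le_rk f : f \in edges G -> `|lev f| <= (rk f).+1%:Z.
Proof. exact: (opt_le_rk op o). Qed.

Lemma lev_nz f : f \in edges G -> lev f != 0.
Proof. by have [u [tab lv _]] := o; exact: (lev_neq0 op tab lv). Qed.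

Lemma lev_min f : f \in edges G ->
  exists a, [/\ a \in edges G, (a <= f)%O, lev a = lev f & `|lev a| = (rk
    a).+1%:Z].
Proof. exact: (opt_min op o). Qed.

Lemma dcocycle_union (j : nat) (Q : pred {set E}) :
    (forall C, Q C = [forall g in C, (j <= rk g)%N]) ->
  \bigcup_(C | directed_cocycle G s C && Q C) C =
  [set f in edges G | j%:Z < lev f].
Proof. exact: (dirset_union op (cocircuit_rep G) o). Qed.

Lemma dcycle_union (j : nat) (Q : pred {set E}) :
    (forall C, Q C = [forall g in C, (j <= rk g)%N]) ->
  \bigcup_(C | directed_cycle G s C && Q C) C =
  [set f in edges G | j%:Z < - lev f].
Proof. exact: (dirset_union (opair_dual op) (circuit_rep G) (opt_dual o)). Qed.

Lemma dcycle_union_all :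
  \bigcup_(C | directed_cycle G s C) C = [set f in edges G | lev f < 0].
Proof.
have := dirset_union_all (opair_dual op) (circuit_rep G) (opt_dual o).
by move=> E0; rewrite [LHS]E0; apply/setP => f; rewrite !inE oppr_gt0.
Qed.

Lemma dual_activeE :
  dual_active G s = [set a in edges G | lev a == (rk a).+1%:Z].
Proof. exact: (dirset_active op (cocircuit_rep G) o). Qed.

Lemma activeE :
  active G s = [set a in edges G | lev a == - (rk a).+1%:Z].
Proof.
have := dirset_active (opair_dual op) (circuit_rep G) (opt_dual o).
by move=> E0; rewrite [LHS]E0; apply/setP => a; rewrite !inE eqr_oppLR.
Qed.

Lemma bipolarE p : is_min (edges G) p ->
  bipolar G s p = [forall f in edges G, lev f == (rk p).+1%:Z].
Proof.
move=> pm; rewrite /bipolar (proj1 (andP pm)) /=.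
exact: (dirset_bipolar op (cocircuit_rep G) o pm).
Qed.

Lemma cyclic_bipolarE p : is_min (edges G) p ->
  cyclic_bipolar G s p = [forall f in edges G, lev f == - (rk p).+1%:Z].
Proof.
move=> pm; rewrite /cyclic_bipolar (proj1 (andP pm)) /=.
have E0 := dirset_bipolar (opair_dual op) (circuit_rep G) (opt_dual o) pm.
by rewrite [LHS]E0; apply: eq_forallb => f; rewrite eqr_oppLR.
Qed.

End OptGraph.

Section FundamentalSets.
Variables (G : graph V E) (T : {set E}) (u : E -> E -> rat).
Hypothesis tab : tableau (tension G) (flow G) (edges G) T u.
Let op := graph_opair G.

(** A vector that vanishes on T' except at b is a multiple of u b. *)
Lemma fund_set (P : pred {set E}) cv fv S T' b :
    opair S cv fv -> tableau cv fv S T' u -> b \in T' ->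
    (forall C, P C <-> exists2 x, elem cv x & C = supp x) ->
  odflt set0 [pick C | P C & C \subset b |: (S :\: T')] = supp (u b).
Proof.
move=> op' tab' bT PE; have bS := subsetP (tab_sub tab') _ bT.
case: pickP => /= [C /andP[/PE[x ex ->] /subsetP xs]|/(_ (supp (u b)))/negP[]];
  last first.
  apply/andP; split; first by apply/PE; exists (u b) => //;
    exact: (tab_elem op' tab' bT).
  apply/subsetP => f; rewrite !inE => uf; have [//|fb] := eqVneq f b.
  by rewrite (tab_side op' tab' bS uf fb) bT (tab_in op' tab' bS uf).
have [cx [e xe] _] := ex.
have xE := tab_fund op' tab' bT cx _.
have {}xE : forall f, x f = x b * u b f.
  apply: xE => g gT gb; apply/eqP; apply: contraT => xg.
  by have := xs g; rewrite !inE xg (negbTE gb) gT => /(_ isT).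
have xb : x b != 0 by apply: contraNneq xe => xb; rewrite xE xb mul0r.
by apply/setP => f; rewrite !inE xE mulf_eq0 negb_or xb.
Qed.

Lemma fund_cocycleE b : b \in T -> fund_cocycle G T b = supp (u b).
Proof. by move=> bT; apply: (fund_set op tab bT); exact: is_cocycleP. Qed.

Lemma fund_cycleE e : e \in edges G :\: T -> fund_cycle G T e = supp (u e).
Proof.
move=> eT; rewrite -(fund_set (opair_dual op) (tableau_dual tab) eT (is_cycleP
  G)).
congr odflt; apply: eq_pick => C /=.
by rewrite setDDr setDv set0U (setIidPr (tab_sub tab)).
Qed.

Lemma is_min_supp f : f \in edges G -> is_min (supp (u f)) f = actv u f.
Proof.
move=> fG; rewrite /is_min inE (tab_diag tab) // oner_eq0 /=.
by apply: eq_forallb => g; rewrite inE.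
Qed.

Lemma IntE lev : levelling (edges G) T u lev ->
  Int G T = [set a in edges G | lev a == (rk a).+1%:Z].
Proof.
move=> lv; apply/setP => a; rewrite [RHS]inE [LHS]inE.
have [aG|aG] := boolP (a \in edges G); last first.
  by apply: contraNF aG => /andP[/(subsetP (tab_sub tab))].
rewrite -(actv_levT op tab lv aG); have [aT|//] := boolP (a \in T).
by rewrite fund_cocycleE // is_min_supp.
Qed.

Lemma ExtE lev : levelling (edges G) T u lev ->
  Ext G T = [set a in edges G | lev a == - (rk a).+1%:Z].
Proof.
move=> lv; apply/setP => a; rewrite [RHS]inE [LHS]inE.
have [aG|aG] := boolP (a \in edges G); last by rewrite inE (negbTE aG) andbF.
have := actv_levT (opair_dual op) (tableau_dual tab) (levelling_dual lv) aG.
rewrite eqr_oppLR => <-; have [aT|//] := boolP (a \in edges G :\: T).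
by rewrite fund_cycleE // is_min_supp.
Qed.

Lemma opposite_sgnd s x e f : opposite_in s (sgnd x) e f =
  ((sg s e * x e) * (sg s f * x f) < 0).
Proof.
have inD g : ((g, s g) \in sgnd x) = (0 < sg s g * x g).
  by rewrite inE /sg /=; case: (s g); rewrite ?mul1r // mulN1r oppr_gt0.
have nz g : (x g != 0) = (sg s g * x g != 0) by rewrite mulf_eq0 negb_or
  sg_neq0.
rewrite /opposite_in !dedges_sgnd !inD ![_ \in supp _]inE !nz.
move: (sg s e * x e) (sg s f * x f) => X Y.
case: (ltgtP 0 X) => [X0|X0|<-]; case: (ltgtP 0 Y) => [Y0|Y0|<-] /=;
  rewrite ?mulr0 ?mul0r ?ltxx //; apply/esym.
- by apply/negbTE; rewrite -leNgt; apply: mulr_ge0; exact: ltW.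
- by rewrite pmulr_rlt0.
- by rewrite nmulr_rlt0.
- by apply/negbTE; rewrite -leNgt; apply: mulr_le0; exact: ltW.
Qed.

(** The (co)circuits with the support of u b are the signs of its multiples. *)
Lemma opp_min_tab (P : pred {set E * bool}) cv fv S T' s b :
    opair S cv fv -> tableau cv fv S T' u -> b \in T' -> represents cv P ->
  [exists D, [&& P D, dedges D == supp (u b)
     & [exists m, is_min (supp (u b)) m && opposite_in s D b m]]] <->
  exists2 m, is_min (supp (u b)) m & sg s b * sg s m * u b m < 0.
Proof.
move=> op' tab' bT rep; have bS := subsetP (tab_sub tab') _ bT.
split=> [/existsP[D /and3P[/rep[x ex ->] /eqP sx /existsP[m /andP[mm opp]]]]|[m
  mm opp]].
  exists m => //; move: opp; rewrite opposite_sgnd; rewrite dedges_sgnd in sx.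
  have [cx _ _] := ex; have xE := tab_fund op' tab' bT cx _.
  have {}xE : forall f, x f = x b * u b f.
    apply: xE => g gT gb; apply/eqP; apply: contraT => xg.
    have : g \in supp x by rewrite inE.
    by rewrite sx inE (tab_off tab' bS) ?eqxx ?(subsetP (tab_sub tab')) ?gT ?bT
      // eq_sym.
  rewrite (xE m); move: (sg s b) (sg s m) (x b) (u b m) => X Y Z W.
  have -> : X * Z * (Y * (Z * W)) = Z ^+ 2 * (X * Y * W) by ring.
  by apply: contraLR; rewrite -!leNgt => ?; exact: mulr_ge0 (sqr_ge0 _) _.
apply/existsP; exists (sgnd (u b)); apply/and3P; split.
- by apply/rep; exists (u b) => //; exact: (tab_elem op' tab' bT).
- by rewrite dedges_sgnd.
- apply/existsP; exists m; rewrite mm opposite_sgnd (tab_diag tab') //.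
  by rewrite mulr1 mulrA.
Qed.

Definition opp_min s f : bool :=
  if f \in T then opp_min_cocycle G s (fund_cocycle G T f) f
  else opp_min_cycle G s (fund_cycle G T f) f.

Lemma opp_minP s f : f \in edges G -> opp_min s f <->
  exists2 m, is_min (supp (u f)) m & sg s f * sg s m * u f m < 0.
Proof.
move=> fG; rewrite /opp_min; case: ifPn => fT.
  by rewrite fund_cocycleE //; apply: (opp_min_tab s op tab fT (cocircuit_rep
    G)).
have fGT : f \in edges G :\: T by rewrite inE fT.
rewrite fund_cycleE //.
exact: (opp_min_tab s (opair_dual op) (tableau_dual tab) fGT (circuit_rep G)).
Qed.

End FundamentalSets.

(** With a single level, the restriction to equal levels in [compat] is void,
    and an element other than p is not active because it would have the same
    direction as itself. *)
Lemma const_gopt G s T p (c : int) : is_min (edges G) p ->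
    `|c| = (rk p).+1%:Z ->
  gopt G s T (fun=> c) <->
  spanning_tree G T /\
  {in edges G, forall f, (f != p) || (c != tau T p * `|c|) -> opp_min G T s f}.
Proof.
move=> /andP[pG /forallP pmin] cE.
have act u : tableau (tension G) (flow G) (edges G) T u -> actv u p.
  move=> tab; apply/actvP => g upg; apply: (implyP (pmin g)).
  exact: (tab_in (graph_opair G) tab pG upg).
split=> [o|[/spanning_tree_tab[u tab] opp]].
  split; first exact: gopt_spanning o.
  have [u [tab lv co]] := o; move=> f fG fp; apply/(opp_minP tab s fG).
  have nact : ~~ actv u f.
    apply: contraL fp => af; have := lev_actv lv fG af => /= cf.
    have fp : f = p by apply: rk_inj; move: cE cf; rewrite /tau; case: ifP; lia.
    by rewrite negb_or !negbK fp eqxx cE {1}cf fp eqxx.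
  have [|m mm] := @set_min _ _ (supp (u f)).
    by apply/set0Pn; exists f; rewrite inE (tab_diag tab) // oner_eq0.
  have /andP[mf /forallP mmin] := mm; rewrite inE in mf.
  have mle g : u f g != 0 -> (m <= g)%O.
    by move=> ufg; apply: (implyP (mmin g)); rewrite inE.
  exists m => //.
  apply: (co f m fG mf erefl _ (fun h uh _ => mle h uh)).
  by have /actvPn[h uh hf] := nact; exact: le_lt_trans (mle h uh) hf.
have nactv f : f \in edges G -> actv u f -> opp_min G T s f = false.
  move=> fG af; apply/negP => /(opp_minP tab s fG)[m /andP[mf /forallP mmin]].
  have -> : m = f.
    apply/le_anti; have := mmin f; rewrite !inE (tab_diag tab) // oner_eq0 /= =>
      ->.
    by rewrite (actvP _ _ af) //; move: mf; rewrite inE.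
  by rewrite sgsg (tab_diag tab).
exists u; split=> //.
- split=> [f g _ _|f fG /actvPn[h uh hf]|f fG af];
    [exact: lexx | by exists h | ].
  have := nactv f fG af; have [->|fp] := eqVneq f p; last first.
    by rewrite opp // fp.
  have := opp p pG; rewrite eqxx /= => oppp nopp; apply/eqP;
    apply: contraFT nopp.
  by rewrite -cE.
- move=> f m fG ufm _ mf mmin; have naf : ~~ actv u f by apply/actvPn; exists m.
  have fp : f != p by apply: contraNneq naf => ->; exact: act.
  have /(opp_minP tab s fG)[m' /andP[]] : opp_min G T s f by rewrite opp ?fp.
  rewrite inE => m'f /forallP m'min; suff -> : m' = m by [].
  apply/le_anti; rewrite mmin // andbT.
  by apply: (implyP (m'min m)); rewrite inE.
Qed.

Lemma bipolar_treeP G s p T : is_min (edges G) p ->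
  bipolar_tree G s p T <-> gopt G s T (fun=> (rk p).+1%:Z).
Proof.
move=> pm; apply: iff_trans (iff_sym (const_gopt s T pm _)); last by lia.
have /andP[pG pmin] := pm.
split=> [/and3P[spT /forallP oT /forallP oN]|[spT opp]].
  split=> // f fG fp; rewrite /opp_min; case: ifPn => fT.
    apply: (implyP (implyP (oT f) fT)).
    by move: fp; have [<-|//] := eqVneq f p; rewrite /tau fT /=; lia.
  by apply: (implyP (oN f)); rewrite inE fT.
have TG f : f \in T -> f \in edges G by move/(subsetP (proj1 (andP spT))).
apply/and3P; split=> //; apply/forallP => f; apply/implyP.
  move=> fT; apply/implyP => fp; have := opp f (TG f fT).
  by rewrite fp /opp_min fT => /(_ isT).
rewrite inE => /andP[fT fG]; have := opp f fG; rewrite /opp_min (negbTE fT);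
  apply.
by have [<-|//] := eqVneq f p; rewrite /tau (negbTE fT); lia.
Qed.

Lemma cyclic_bipolar_treeP G s p T : is_min (edges G) p ->
  cyclic_bipolar_tree G s p T <-> gopt G s T (fun=> - (rk p).+1%:Z).
Proof.
move=> pm; apply: iff_trans (iff_sym (const_gopt s T pm _)); last by lia.
have /andP[pG pmin] := pm.
split=> [/and3P[spT /forallP oT /forallP oN]|[spT opp]].
  split=> // f fG fp; rewrite /opp_min; case: ifPn => fT.
    exact: (implyP (oT f) fT).
  have fGT : f \in edges G :\: T by rewrite inE fT.
  apply: (implyP (implyP (oN f) fGT)).
  by move: fp; have [<-|//] := eqVneq f p; rewrite /tau (negbTE fT) /=; lia.
have TG f : f \in T -> f \in edges G by move/(subsetP (proj1 (andP spT))).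
apply/and3P; split=> //; apply/forallP => f; apply/implyP.
  move=> fT; have := opp f (TG f fT); rewrite /opp_min fT; apply.
  by have [<-|//] := eqVneq f p; rewrite /tau fT; lia.
rewrite inE => /andP[fT fG]; apply/implyP => fp; have := opp f fG.
by rewrite fp /opp_min (negbTE fT) => /(_ isT).
Qed.

Lemma dcocycle_min G s C : directed_cocycle G s C -> exists m, is_min C m.
Proof. exact: (dirset_min (cocircuit_rep G)). Qed.

Lemma dcycle_min G s C : directed_cycle G s C -> exists m, is_min C m.
Proof. exact: (dirset_min (circuit_rep G)). Qed.

Lemma is_min_max A C a m : is_max A a -> is_min C m -> m \in A ->
  is_min C a = min_ge a C.
Proof.
move=> /andP[_ /forallP amax] /andP[mC /forallP mmin] mA; rewrite /is_min.
apply: andb_idl => /forallP aC; suff -> : a = m by [].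
by apply/le_anti; rewrite (implyP (aC m) mC) (implyP (amax m) mA).
Qed.

End Minors.
(** * The active filtration of an orientation *)

Section Filtrations.
Context {V : finType} {d : Order.disp_t} {E : finOrderType d}.
Implicit Types (G : graph V E) (s : orientation E) (a b c e f g p : E).
Implicit Types (S T A F : {set E}) (lev : E -> int).
Local Open Scope ring_scope.

(** With no key strictly between consecutive ones, to be below a key is to be
    at most equal to the preceding one. *)
Lemma level_chain S (key : E -> int) a l :
    path (fun a b => key a < key b) a l ->
    (forall f, f \in S -> key a < key f -> exists2 c, c \in l & key c = key f)
      ->
  rcons [seq [set f in S | key f < key b] | b <- l] S =
  [seq [set f in S | key f <= key b] | b <- a :: l].
Proof.
elim: l a => [|b l IHl] a /=.
  move=> _ no; congr [:: _]; apply/setP => f; rewrite inE.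
  by case: (boolP (f \in S)) => //= fS; case: ltP => // /(no f fS)[].
case/andP=> ab pth rep; rewrite (IHl b) //=.
  congr (_ :: _); apply/setP => f; rewrite !inE;
    case: (boolP (f \in S)) => //= fS.
  apply/idP/idP => [fb|fa]; last exact: le_lt_trans fa ab.
  rewrite leNgt; apply/negP => /(rep f fS)[c cl cf].
  move: fb; rewrite -cf; move: cl; rewrite inE => /predU1P[->|cl];
    first by rewrite ltxx.
  have tr : transitive (fun a b => key a < key b) by move=> x y z;
    exact: lt_trans.
  by have /allP/(_ c cl) := order_path_min tr pth; lia.
move=> f fS bf; have [|c] := rep f fS; first exact: lt_trans ab bf.
by rewrite inE => /predU1P[-> cb|cl cf]; [rewrite cb ltxx in bf | exists c].
Qed.

Lemma sort_set_lt A : sorted (fun a b => (a < b)%O) (sort_set A).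
Proof. by rewrite lt_sorted_uniq_le sort_uniq enum_uniq sort_le_sorted. Qed.

Lemma mem_sort_set A a : (a \in sort_set A) = (a \in A).
Proof. by rewrite mem_sort mem_enum. Qed.

Lemma sort_set_uniq A : uniq (sort_set A).
Proof. by rewrite sort_uniq enum_uniq. Qed.

Lemma sort_set_eq A l : sorted (fun a b => (a < b)%O) l ->
  (forall a, (a \in l) = (a \in A)) -> l = sort_set A.
Proof.
move=> sl lA; apply: lt_sorted_eq => // [|a]; first exact: sort_set_lt.
by rewrite mem_sort_set.
Qed.

Definition lo G lev a := [set f in edges G | lev f < lev a].
Definition hi G lev a := [set f in edges G | lev f <= lev a].

Lemma zip_map_pair (A B C : Type) (h : A -> B) (k : A -> C) (l : seq A) x :
  zip (rcons (map h l) x) (map k l) = [seq (h i, k i) | i <- l].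
Proof. by elim: l => //= i l ->. Qed.

Lemma zip_map_pair' (A B C : Type) (h : A -> B) (k : A -> C) (l : seq A) x :
  zip (map k l) (rcons (map h l) x) = [seq (k i, h i) | i <- l].
Proof. by elim: l => //= i l ->. Qed.

Section OptFiltration.
Variables (G : graph V E) (s : orientation E) (T : {set E}) (lev : E -> int).
Hypothesis o : gopt G s T lev.

Let levP a : a \in dual_active G s -> a \in edges G /\ lev a = (rk a).+1%:Z.
Proof. by rewrite (dual_activeE o) inE => /andP[-> /eqP]. Qed.

Let levN a : a \in active G s -> a \in edges G /\ lev a = - (rk a).+1%:Z.
Proof. by rewrite (activeE o) inE => /andP[-> /eqP]. Qed.

Lemma level_rep f : f \in edges G -> exists a, [/\ lev a = lev f,
   (0 < lev f -> a \in dual_active G s) & (lev f < 0 -> a \in active G s)].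
Proof.
move=> fG; have [a [aG _ la aE]] := lev_min o fG; exists a; split=> // f0.
  by rewrite (dual_activeE o) inE aG; lia.
by rewrite (activeE o) inE aG; lia.
Qed.

Lemma active_fcyc : fcyc (active_filtration G s) = [set f in edges G | lev f <
  0].
Proof. exact: dcycle_union_all o. Qed.

Lemma up_list : let l := sort_set (dual_active G s) in
  fup (active_filtration G s) = map (hi G lev) l /\
  fcyc (active_filtration G s) :: fup (active_filtration G s) =
  rcons (map (lo G lev) l) (edges G).
Proof.
move=> l; rewrite active_fcyc /=.
have -> : [seq edges G :\: \bigcup_(C | directed_cocycle G s C && min_ge a C) C
           | a <- sort_set (dual_active G s)] = map (lo G lev) l.
  apply/eq_in_map => a; rewrite mem_sort_set => /levP[aG la].
  rewrite (dcocycle_union o (min_geE a)); apply/setP => f; rewrite !inE la.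
  by case: (f \in edges G) => //=; rewrite andbT; lia.
have lP a : a \in l -> a \in edges G /\ lev a = (rk a).+1%:Z by rewrite
  mem_sort_set => /levP.
have lrep f : f \in edges G -> 0 < lev f -> exists2 c, c \in l & lev c = lev f.
  move=> fG f0; have [c [lc /(_ f0) cA _]] := level_rep fG.
  by exists c; rewrite ?mem_sort_set.
have := sort_set_lt (dual_active G s); rewrite -/l.
case: l lP lrep => [|a l] lP lrep pth; split=> //.
- congr [:: _]; apply/setP => f; rewrite inE; case: (boolP (f \in edges G)) =>
    //= fG.
  have := lev_nz o fG; rewrite neq_lt => /orP[//|f0].
  by have [] := lrep f fG f0.
- apply: level_chain.
    apply: (sub_in_path (P := mem (a :: l)) _ _ pth) => [b c|]; last exact/allP.
    by move=> /lP[_ ->] /lP[_ ->]; rewrite -rk_lt; lia.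
  move=> f fG af; have [|c cl cf] := lrep f fG;
    first by have [_] := lP a (mem_head _ _); lia.
  by move: cl; rewrite inE => /predU1P[ca|]; [rewrite -cf ca ltxx in af | exists
    c].
- rewrite /=; congr (_ :: _); apply/setP => f; rewrite !inE.
  case: (boolP (f \in edges G)) => //= fG; have [_ la] := lP a (mem_head _ _).
  have := lev_nz o fG; rewrite neq_lt => /orP[f0|f0]; first by lia.
  have [c cl cf] := lrep f fG f0; rewrite -cf; have [_ lc] := lP c cl.
  have : (a <= c)%O.
    move: cl; rewrite inE => /predU1P[->//|cl].
    by have /allP/(_ c cl) := order_path_min lt_trans pth => /ltW.
  by rewrite -rk_le; lia.
Qed.

(** The descending part is the complement of an ascending chain for the
    opposite keys. *)
Lemma down_list : let l := sort_set (active G s) in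
  fdown (active_filtration G s) = map (lo G lev) l /\
  fcyc (active_filtration G s) :: fdown (active_filtration G s) =
  rcons (map (hi G lev) l) set0.
Proof.
move=> l; rewrite active_fcyc /=.
have -> : [seq \bigcup_(C | directed_cycle G s C && min_ge a C) C
           | a <- sort_set (active G s)] = map (hi G lev) l.
  apply/eq_in_map => a; rewrite mem_sort_set => /levN[aG la].
  rewrite (dcycle_union o (min_geE a)); apply/setP => f; rewrite !inE la.
  by case: (f \in edges G) => //=; lia.
have lN a : a \in l -> a \in edges G /\ lev a = - (rk a).+1%:Z by rewrite
  mem_sort_set => /levN.
have lrep f : f \in edges G -> lev f < 0 -> exists2 c, c \in l & lev c = lev f.
  move=> fG f0; have [c [lc _ /(_ f0) cA]] := level_rep fG.
  by exists c; rewrite ?mem_sort_set.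
have := sort_set_lt (active G s); rewrite -/l.
case: l lN lrep => [|a l] lN lrep pth; split=> //.
- congr [:: _]; apply/setP => f; rewrite !inE; case: (boolP (f \in edges G)) =>
    //= fG.
  by apply/negP => f0; have [] := lrep f fG f0.
- have pth' : path (fun a b => - lev a < - lev b) a l.
    apply: (sub_in_path (P := mem (a :: l)) _ _ pth) => [b c|]; last exact/allP.
    by move=> /lN[_ ->] /lN[_ ->]; rewrite -rk_lt; lia.
  have := level_chain (S := edges G) (key := fun e => - lev e) pth'.
  have rep f : f \in edges G -> - lev a < - lev f -> exists2 c, c \in l & - lev
    c = - lev f.
    move=> fG af; have [|c cl cf] := lrep f fG.
      by have [_] := lN a (mem_head _ _); lia.
    by move: cl; rewrite inE => /predU1P[ca|cl];
      [rewrite -cf ca ltxx in af | exists c; rewrite ?cf].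
  move=> /(_ rep)/(congr1 (map (fun A => edges G :\: A))).
  rewrite map_rcons setDv -!map_comp => E0.
  rewrite [LHS]/= -[RHS](_ : map (fun b => edges G :\: [set f in edges G | - lev
    f <= - lev b]) (a :: l) = _).
    rewrite -E0; congr rcons; apply/eq_map => b; apply/setP => f; rewrite !inE.
    by case: (f \in edges G) => //=; lia.
  apply/eq_map => b; apply/setP => f; rewrite !inE.
  by case: (f \in edges G) => //=; lia.
- rewrite /=; congr (_ :: _); apply/setP => f; rewrite !inE.
  case: (boolP (f \in edges G)) => //= fG; have [_ la] := lN a (mem_head _ _).
  have := lev_nz o fG; rewrite neq_lt => /orP[f0|f0]; last by lia.
  have [c cl cf] := lrep f fG f0; rewrite -cf; have [_ lc] := lN c cl.
  have : (a <= c)%O.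
    move: cl; rewrite inE => /predU1P[->//|cl].
    by have /allP/(_ c cl) := order_path_min lt_trans pth => /ltW.
  by rewrite -rk_le; lia.
Qed.

(** The step of the filtration around the level of a. *)
Definition lohi a := (lo G lev a, hi G lev a).

Lemma up_stepsE :
  up_steps (active_filtration G s) = map lohi (sort_set (dual_active G s)).
Proof.
by rewrite /up_steps; have [-> ->] := up_list; exact: zip_map_pair.
Qed.

Lemma down_stepsE :
  down_steps (active_filtration G s) = map lohi (sort_set (active G s)).
Proof.
by rewrite /down_steps; have [-> ->] := down_list; exact: zip_map_pair'.
Qed.

Lemma part_lohi a : part (lohi a) = [set f in edges G | lev f == lev a].
Proof.
apply/setP => f; rewrite !inE; case: (f \in edges G) => //=.
by rewrite -leNgt -eq_le eq_sym.
Qed.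

Lemma gopt_minor a : gopt (minor G (lohi a)) s (T :&: part (lohi a)) lev.
Proof.
have o1 : gopt (restrict G (hi G lev a)) s (T :&: hi G lev a) lev.
  by apply: (gopt_restrict (k := lev a) o) => f fG; rewrite inE fG.
rewrite /part setIDA; apply: (gopt_contract (k := lev a - 1) o1) => f.
by rewrite !inE => /andP[-> _] /=; lia.
Qed.

Lemma minor_edges a : edges (minor G (lohi a)) = part (lohi a).
Proof.
rewrite part_lohi; apply/setP => f; rewrite !inE.
by case: (f \in edges G); rewrite ?andbF //= -leNgt -eq_le eq_sym.
Qed.

Lemma gopt_minor_const a :
  gopt (minor G (lohi a)) s (T :&: part (lohi a)) (fun=> lev a).
Proof.
apply: (opt_ext (graph_opair _) _ (gopt_minor a)) => f.
by rewrite minor_edges part_lohi inE => /andP[_ /eqP].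
Qed.

Lemma minor_min a : a \in edges G -> `|lev a| = (rk a).+1%:Z ->
  is_min (edges (minor G (lohi a))) a.
Proof.
move=> aG la; rewrite minor_edges part_lohi /is_min inE aG eqxx /=.
apply/forallP => f; apply/implyP; rewrite inE => /andP[fG /eqP lf].
by rewrite -rk_le; have := lev_le_rk o fG; rewrite lf; lia.
Qed.

End OptFiltration.
End Filtrations.

(** * The three definitions of alpha *)

Section Alpha.
Context {V : finType} {d : Order.disp_t} {E : finOrderType d}.
Implicit Types (G : graph V E) (s : orientation E) (a b c e f g p : E).
Implicit Types (S T A F : {set E}) (lev : E -> int).
Local Open Scope ring_scope.

Lemma gopt_tree G s T T' lev lev' :
  gopt G s T lev -> gopt G s T' lev' -> T = T'.
Proof. exact: (opt_tree (graph_opair G)). Qed.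

Lemma gopt_ext G s T lev lev' : {in edges G, lev =1 lev'} ->
  gopt G s T lev -> gopt G s T lev'.
Proof. exact: (opt_ext (graph_opair G)). Qed.

Variable alpha : tree_map (V := V) (E := E).
Hypothesis alphaP : forall G s, exists lev, gopt G s (alpha G s) lev.

Lemma alphaE G s T lev : gopt G s T lev -> alpha G s = T.
Proof. by have [lev' o'] := alphaP G s => o; exact: (gopt_tree o' o). Qed.

Lemma alpha_bipolar : extends_bipolar alpha.
Proof.
move=> G s; split=> [G0|p pm bip T|p pm bip T].
- have [lev [u [tab _ _]]] := alphaP G s.
  by apply/eqP; rewrite -subset0 -G0; exact: (tab_sub tab).
- have [lev o] := alphaP G s; apply: iff_trans (bipolar_treeP s T pm) _.
  split=> [/alphaE//|->]; move: bip; rewrite (bipolarE o pm) => /forallP levp.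
  by apply: gopt_ext o => f fG; apply/eqP/(implyP (levp f)).
- have [lev o] := alphaP G s; apply: iff_trans (cyclic_bipolar_treeP s T pm) _.
  split=> [/alphaE//|->]; move: bip; rewrite (cyclic_bipolarE o pm) => /forallP
    levp.
  by apply: gopt_ext o => f fG; apply/eqP/(implyP (levp f)).
Qed.

Lemma alpha_splits G s T lev F (k : int) : gopt G s T lev ->
  {in edges G, forall f, (f \in F) = (lev f <= k)} -> splits_at alpha G s F.
Proof.
move=> o FE; rewrite /splits_at (alphaE o) (alphaE (gopt_contract o FE)).
rewrite (alphaE (gopt_restrict o FE)); split.
  rewrite /= !andbT; apply/pred0P => f; rewrite !inE /=.
  by case: (f \in F); rewrite ?andbF ?andFb ?andbT.
by rewrite !big_cons big_nil setU0 setUC setID.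
Qed.

Lemma lower_cycles G s T lev (j : nat) (Q : pred {set E}) : gopt G s T lev ->
    (forall C, Q C = [forall g in C, (j <= rk g)%N]) ->
  {in edges G, forall f,
    (f \in \bigcup_(C | directed_cycle G s C && Q C) C) = (lev f <= - j.+1%:Z)}.
Proof. by move=> o QE f fG; rewrite (dcycle_union o QE) inE fG /=; lia. Qed.

Lemma lower_cocycles G s T lev (j : nat) (Q : pred {set E}) : gopt G s T lev ->
    (forall C, Q C = [forall g in C, (j <= rk g)%N]) ->
  {in edges G, forall f,
    (f \in edges G :\: \bigcup_(C | directed_cocycle G s C && Q C) C) =
    (lev f <= j%:Z)}.
Proof. by move=> o QE f fG; rewrite (dcocycle_union o QE) !inE fG /=; lia. Qed.

Lemma max_active_cycles G s a : is_max (active G s) a ->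
  \bigcup_(C | directed_cycle G s C && is_min C a) C =
  \bigcup_(C | directed_cycle G s C && min_ge a C) C.
Proof.
move=> am; apply: eq_bigl => C; apply: andb_id2l => dC.
have [m mC] := dcycle_min dC; apply: (is_min_max am mC).
by rewrite inE; apply/existsP; exists C; rewrite dC.
Qed.

Lemma max_dual_active_cocycles G s a : is_max (dual_active G s) a ->
  \bigcup_(C | directed_cocycle G s C && is_min C a) C =
  \bigcup_(C | directed_cocycle G s C && min_ge a C) C.
Proof.
move=> am; apply: eq_bigl => C; apply: andb_id2l => dC.
have [m mC] := dcocycle_min dC; apply: (is_min_max am mC).
by rewrite inE; apply/existsP; exists C; rewrite dC.
Qed.

Lemma alpha_is_inductive : alpha_inductive alpha.
Proof.
split=> [|G s]; first exact: alpha_bipolar.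
have [lev o] := alphaP G s; split=> a am.
  rewrite max_active_cycles //; apply: (alpha_splits o).
  exact: (lower_cycles o (min_geE a)).
rewrite max_dual_active_cocycles //; apply: (alpha_splits o).
exact: (lower_cocycles o (min_geE a)).
Qed.

Lemma alpha_is_relaxed : alpha_relaxed alpha.
Proof.
split=> [|G s e eG]; first exact: alpha_bipolar.
have [lev o] := alphaP G s; split; apply: (alpha_splits o).
  exact: (lower_cycles o (min_gtE e)).
exact: (lower_cocycles o (min_gtE e)).
Qed.

Lemma steps_list G s T lev : gopt G s T lev ->
  up_steps (active_filtration G s) ++ down_steps (active_filtration G s) =
  map (lohi G lev) (sort_set (dual_active G s) ++ sort_set (active G s)).
Proof. by move=> o; rewrite (up_stepsE o) (down_stepsE o) map_cat. Qed.

Lemma step_actives G s T lev a : gopt G s T lev ->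
  a \in sort_set (dual_active G s) ++ sort_set (active G s) ->
  a \in edges G /\ `|lev a| = (rk a).+1%:Z.
Proof.
move=> o; rewrite mem_cat !mem_sort_set (dual_activeE o) (activeE o) !inE.
by case/orP=> /andP[-> /eqP ->]; lia.
Qed.

Lemma step_actives_uniq G s T lev : gopt G s T lev ->
  uniq (sort_set (dual_active G s) ++ sort_set (active G s)).
Proof.
move=> o; rewrite cat_uniq !sort_set_uniq andbT /=; apply/hasPn => a.
rewrite /= !mem_sort_set (dual_activeE o) (activeE o) !inE => /andP[-> /eqP ->]
  /=.
lia.
Qed.

Lemma parts_disjoint G s T lev : gopt G s T lev ->
  pairwise (fun A B : {set E} => [disjoint A & B])
    (map (fun a => part (lohi G lev a))
      (sort_set (dual_active G s) ++ sort_set (active G s))).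
Proof.
move=> o; rewrite pairwise_map; have := step_actives_uniq o;
  rewrite uniq_pairwise.
apply: (sub_in_pairwise
  (P := mem (sort_set (dual_active G s) ++ sort_set (active G s))));
    last exact/allP.
move=> a b /(step_actives o)[aG la] /(step_actives o)[bG lb] ab /=.
apply/pred0P => f /=; rewrite !part_lohi !inE; apply/negP => /andP[/andP[_ /eqP
  fa] /andP[_ /eqP fb]].
by case/negP: ab; apply/eqP/rk_inj; lia.
Qed.

Lemma parts_cover G s T lev f : gopt G s T lev -> f \in edges G ->
  exists2 a, a \in sort_set (dual_active G s) ++ sort_set (active G s)
    & f \in part (lohi G lev a).
Proof.
move=> o fG; have [a [la aP aN]] := level_rep o fG; exists a; last first.
  by rewrite part_lohi inE fG la eqxx.
rewrite mem_cat !mem_sort_set; have := lev_nz o fG.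
by rewrite neq_lt => /orP[/aN|/aP] ->; rewrite ?orbT.
Qed.

Lemma disjoint_parts_union G s T lev (h : E -> {set E}) : gopt G s T lev ->
    (forall a, a \in sort_set (dual_active G s) ++ sort_set (active G s) ->
       h a = T :&: part (lohi G lev a)) ->
  disjoint_union [seq h a | a <- sort_set (dual_active G s) ++ sort_set (active
    G s)] T.
Proof.
move=> o hE; split.
  have := parts_disjoint o; rewrite !pairwise_map.
  apply: (sub_in_pairwise
    (P := mem (sort_set (dual_active G s) ++ sort_set (active G s))));
      last exact/allP.
  move=> a b al bl /= dis; rewrite !hE //.
  by apply: disjointWl (subsetIr _ _) _; apply: disjointWr (subsetIr _ _) dis.
rewrite big_map (eq_big_seq _ hE); apply/setP => f; apply/idP/idP => [fT|].
  have fG : f \in edges G by have [u [tab _ _]] := o;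
    exact: (subsetP (tab_sub tab)).
  have [a al fa] := parts_cover o fG.
  by rewrite (big_rem a) //= inE inE fT fa.
by elim/big_rec: _ => [|a A _ IH]; rewrite !inE // => /orP[/andP[]|/IH].
Qed.

Lemma alpha_is_sequential : alpha_sequential alpha.
Proof.
split=> [|G s Fs]; first exact: alpha_bipolar.
have [lev o] := alphaP G s; rewrite /Fs (steps_list o) -map_comp.
apply: (disjoint_parts_union o) => a _ /=; exact: (alphaE (gopt_minor o a)).
Qed.

(** With a single level the graph is bipolar or cyclic-bipolar. *)
Lemma extends_single beta G s T lev p : extends_bipolar beta ->
    gopt G s T lev -> is_min (edges G) p ->
    {in edges G, forall f, lev f = lev p} -> beta G s = alpha G s.
Proof.
move=> eb o pm single; have [_ bip cyc] := eb G s; have pG := proj1 (andP pm).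
have [a [aG ap _ la]] := lev_min o pG.
have lp : `|lev p| = (rk p).+1%:Z.
  suff -> : p = a by [].
  by apply/le_anti; rewrite ap andbT; exact: (implyP (forallP (proj2 (andP pm))
    a) aG).
rewrite (alphaE o); have [lp0|lp0] := ltP 0 (lev p).
  apply/esym/(bip p pm).
    by rewrite (bipolarE o pm); apply/forallP => f; apply/implyP => /single ->;
      lia.
  by apply/(bipolar_treeP s T pm); apply: gopt_ext o => f /single ->; lia.
apply/esym/(cyc p pm).
  by rewrite (cyclic_bipolarE o pm); apply/forallP => f;
    apply/implyP => /single ->; lia.
by apply/(cyclic_bipolar_treeP s T pm); apply: gopt_ext o => f /single ->; lia.
Qed.

Lemma sequential_unique beta : alpha_sequential beta ->
  forall G s, beta G s = alpha G s.
Proof.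
case=> eb seqb G s; have [lev o] := alphaP G s; have [_ ->] := seqb G s.
have [_ ->] := alpha_is_sequential.2 G s.
rewrite (steps_list o) -!map_comp !big_map; apply: eq_big_seq => a.
case/(step_actives o)=> aG la /=; have o' := gopt_minor_const o a.
exact: (extends_single eb o' (minor_min o aG la)).
Qed.

(** A splitting at a lower set of levels other than the empty and the full one
    reduces the comparison of two tree maps to smaller graphs. *)
Lemma splitting_unique beta : extends_bipolar beta ->
    (forall G s T lev p, gopt G s T lev -> is_min (edges G) p ->
       (exists2 f, f \in edges G & lev f != lev p) ->
     exists F (k : int), [/\ splits_at beta G s F,
       {in edges G, forall f, (f \in F) = (lev f <= k)},
       exists2 f, f \in edges G & lev f <= k
       & exists2 f, f \in edges G & k < lev f]) ->
  forall G s, beta G s = alpha G s.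
Proof.
move=> eb split_ex G s; have [n] := ubnP #|edges G|; elim: n G => // n IHn G Gn.
have [G0|/set_min[p pm]] := eqVneq (edges G) set0.
  by have [-> // _ _] := eb G s; have [-> // _ _] := alpha_bipolar G s.
have [lev o] := alphaP G s.
have [/existsP[f /andP[fG fp]]|/existsPn single] :=
  boolP [exists f, (f \in edges G) && (lev f != lev p)]; last first.
  apply: (extends_single eb o pm) => f fG; apply/eqP; have := single f.
  by rewrite fG /= negbK.
have [|F [k [[_ ->] FE [f1 f1G f1k] [f2 f2G f2k]]]] := split_ex G s _ lev p o
  pm.
  by exists f.
have [_ ->] := alpha_splits o FE; rewrite !big_cons big_nil !setU0;
  congr (_ :|: _).
  apply: IHn; apply: leq_trans (Gn : (_ <= n)%N); apply: proper_card.
  apply/properP; split; first exact: subsetDl.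
  by exists f1; rewrite // inE FE // f1k.
apply: IHn; apply: leq_trans (Gn : (_ <= n)%N); apply: proper_card.
apply/properP; split; first exact: subsetIl.
by exists f2; rewrite // inE FE // leNgt f2k andbF.
Qed.

(** Split at the greatest dual-active edge if there is one; otherwise all
    levels are negative, and the greatest active edge has the lowest one. *)
Lemma inductive_unique beta : alpha_inductive beta ->
  forall G s, beta G s = alpha G s.
Proof.
case=> eb ind; apply: (splitting_unique eb) => G s T lev p o pm [f fG fp].
have pG := proj1 (andP pm).
have [cyc coc] := ind G s.
have maxP (A : {set E}) c : c \in A -> exists a, is_max A a.
  move=> cA; case: (arg_maxnP (P := fun g => g \in A) rk cA) => m mA mmax;
    exists m.
  by rewrite /is_max mA; apply/forallP => g; apply/implyP; rewrite -rk_le;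
    exact: mmax.
have [[a am]|noa] := classic (exists a, is_max (dual_active G s) a).
  have /andP[aA /forallP amax] := am; have := aA;
    rewrite (dual_activeE o) inE => /andP[aG /eqP la].
  have := coc a am; rewrite max_dual_active_cocycles // => spl.
  exists (edges G :\: \bigcup_(C | directed_cocycle G s C && min_ge a C) C), (rk
    a)%:Z.
  split=> //; first exact: (lower_cocycles o (min_geE a)).
    have le_a g : g \in edges G -> lev g <= lev a.
      move=> gG; have := lev_nz o gG; rewrite neq_lt => /orP[g0|g0];
        first by lia.
      have [c [lc /(_ g0) cA _]] := level_rep o gG.
      have := implyP (amax c) cA; rewrite -rk_le.
      by move: cA; rewrite (dual_activeE o) inE => /andP[_ /eqP]; lia.
    have [f' f'G f'a] : exists2 f', f' \in edges G & lev f' != lev a.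
      by have [fa|fa] := eqVneq (lev f) (lev a); [exists p;
        rewrite // -fa eq_sym | exists f].
    by exists f' => //; have := le_a f' f'G; lia.
  by exists a => //; rewrite la; lia.
have neg g : g \in edges G -> lev g < 0.
  move=> gG; have := lev_nz o gG; rewrite neq_lt => /orP[//|g0].
  have [c [_ /(_ g0) cA _]] := level_rep o gG.
  by case: noa; exact: maxP cA.
have [c [_ _ /(_ (neg p pG)) cA]] := level_rep o pG.
have [a am] := maxP _ _ cA.
have /andP[aA /forallP amax] := am; have := aA;
  rewrite (activeE o) inE => /andP[aG /eqP la].
have := cyc a am; rewrite max_active_cycles // => spl.
exists (\bigcup_(C | directed_cycle G s C && min_ge a C) C), (- (rk a).+1%:Z).
split=> //; first exact: (lower_cycles o (min_geE a)).
  by exists a => //; rewrite la.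
have ge_a g : g \in edges G -> lev a <= lev g.
  move=> gG; have [c' [lc _ /(_ (neg g gG)) c'A]] := level_rep o gG.
  have := implyP (amax c') c'A; rewrite -rk_le.
  by move: c'A; rewrite (activeE o) inE => /andP[_ /eqP]; lia.
have [f' f'G f'a] : exists2 f', f' \in edges G & lev f' != lev a.
  by have [fa|fa] := eqVneq (lev f) (lev a); [exists p;
    rewrite // -fa eq_sym | exists f].
by exists f' => //; have := ge_a f' f'G; lia.
Qed.

(** The smallest edge p has the level of smallest absolute value, so the cycles
    or the cocycles above p separate it from any edge of another level. *)
Lemma relaxed_unique beta : alpha_relaxed beta ->
  forall G s, beta G s = alpha G s.
Proof.
case=> eb rel; apply: (splitting_unique eb) => G s T lev p o pm [f fG fp].
have /andP[pG /forallP pmin] := pm.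
have [cyc coc] := rel G s p pG.
have lp : `|lev p| <= (rk p).+1%:Z := lev_le_rk o pG.
have lf : (rk p).+1%:Z < `|lev f|.
  have [c [cG _ lc lc']] := lev_min o fG; have := implyP (pmin c) cG;
    rewrite -lc lc'.
  rewrite le_eqVlt => /orP[/eqP pc|]; last by rewrite -rk_lt; lia.
  by rewrite -lc -pc eqxx in fp.
have := lev_nz o fG; rewrite neq_lt => /orP[f0|f0].
  exists (\bigcup_(C | directed_cycle G s C && min_gt p C) C), (- (rk p).+2%:Z).
  split=> //; first exact: (lower_cycles o (min_gtE p)).
    by exists f => //; lia.
  by exists p => //; lia.
exists (edges G :\: \bigcup_(C | directed_cocycle G s C && min_gt p C) C), (rk
  p).+1%:Z.
split=> //; first exact: (lower_cocycles o (min_gtE p)).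
  by exists p => //; lia.
by exists f => //; lia.
Qed.

End Alpha.
(** * Chains of sets *)

Section Chains.
Context {d : Order.disp_t} {E : finOrderType d}.
Implicit Types (A B x : {set E}) (l : seq {set E}) (a b f : E).
Implicit Types (p q : {set E} * {set E}).

Lemma is_min_inj A a b : is_min A a -> is_min A b -> a = b.
Proof.
case/andP=> aA /forallP am /andP[bA /forallP bm]; apply/le_anti.
by rewrite (implyP (am b)) // (implyP (bm a)).
Qed.

Lemma min_ltP A B a b : is_min A a -> is_min B b -> min_lt A B = (a < b)%O.
Proof.
move=> am bm; apply/existsP/idP => [[a' /existsP[b' /and3P[am' bm' ab]]]|ab].
  by rewrite (is_min_inj am am') (is_min_inj bm bm').
by exists a; apply/existsP; exists b; rewrite am bm.
Qed.

Lemma min_lt_trans : transitive (@min_lt d E).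
Proof.
move=> B A C /existsP[a /existsP[b /and3P[am bm ab]]].
case/existsP=> b' /existsP[c /and3P[bm' cm bc]].
by rewrite (min_ltP am cm) (lt_trans ab) // (is_min_inj bm bm').
Qed.

Lemma path_zip (r : rel {set E}) x l :
  path r x l = all (fun p => r p.1 p.2) (zip (x :: l) l).
Proof. by elim: l x => //= y l IHl x; rewrite IHl. Qed.

Lemma path_zip' (r : rel {set E}) x l :
  path (fun A B => r B A) x l = all (fun p => r p.1 p.2) (zip l (x :: l)).
Proof. by elim: l x => //= y l IHl x; rewrite IHl. Qed.

Lemma chain_up x l : path (fun A B : {set E} => A \proper B) x l ->
  pairwise (fun p q => p.2 \subset q.1) (zip (x :: l) l) /\
  forall p, p \in zip (x :: l) l -> [/\ x \subset p.1, p.1 \proper p.2 & p.2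
    \subset last x l].
Proof.
elim: l x => [//|y l IHl] x /= /andP[xy /IHl[pw sub]].
have yl : y \subset last y l.
  case: (l) sub => [//|z l'] sub; have [_ /proper_sub yz zl] := sub (y, z)
    (mem_head _ _).
  exact: subset_trans yz zl.
split; first by rewrite pw andbT; apply/allP => p /sub[].
move=> p; rewrite inE => /predU1P[->//|/sub[yp pp pl]]; split=> //.
exact: subset_trans (proper_sub xy) yp.
Qed.

Lemma chain_down x l : path (fun A B : {set E} => B \proper A) x l ->
  pairwise (fun p q => q.2 \subset p.1) (zip l (x :: l)) /\
  forall p, p \in zip l (x :: l) -> p.2 \subset x /\ p.1 \proper p.2.
Proof.
elim: l x => [//|y l IHl] x /= /andP[xy /IHl[pw sub]].
split; first by rewrite pw andbT; apply/allP => p /sub[].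
move=> p; rewrite inE => /predU1P[->//|/sub[yp pp]]; split=> //.
exact: subset_trans yp (proper_sub xy).
Qed.

Lemma chain_cover x l f : f \in last x l -> f \notin x ->
  exists2 p, p \in zip (x :: l) l & f \in part p.
Proof.
elim: l x => [x fx|y l IHl x /= fl fx]; first by rewrite fx.
have [fy|fy] := boolP (f \in y).
  by exists (x, y); rewrite ?mem_head // inE fx.
by have [p pl fp] := IHl y fl fy; exists p; rewrite // inE pl orbT.
Qed.

Lemma chain_cover' x l f : f \in x -> f \notin last x l ->
  exists2 p, p \in zip l (x :: l) & f \in part p.
Proof.
elim: l x => [x fx|y l IHl x /= fx fl]; first by rewrite fx.
have [fy|fy] := boolP (f \in y).
  by have [p pl fp] := IHl y fy fl; exists p; rewrite // inE pl orbT.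
by exists (y, x); rewrite ?mem_head // inE fy.
Qed.

Lemma pairwise_mem (A : eqType) (r : rel A) (l : seq A) (i j : A) :
  pairwise r l -> i \in l -> j \in l -> [\/ i = j, r i j | r j i].
Proof.
elim: l => //= k l IHl /andP[/allP kl /IHl IH]; rewrite !inE.
case/predU1P=> [->|il] /predU1P[->|jl]; first by constructor 1.
- by constructor 2; exact: kl.
- by constructor 3; exact: kl.
- exact: IH.
Qed.

End Chains.

(** * The active filtration of a spanning tree *)

Section TreeFiltration.
Context {V : finType} {d : Order.disp_t} {E : finOrderType d}.
Implicit Types (G : graph V E) (s : orientation E) (a b c e f g : E).
Implicit Types (S T A F : {set E}) (lev key : E -> int) (p q : {set E} * {set
  E}).
Local Open Scope ring_scope.

(** The lowest conflict between two levellings is impossible, since the level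
    of a non-active element is attained at a smaller one. *)
Lemma levelling_unique S cv fv T u lev lev' : opair S cv fv ->
  tableau cv fv S T u -> levelling S T u lev -> levelling S T u lev' ->
  {in S, lev =1 lev'}.
Proof.
move=> op tab lv lv' f; move: f; apply: (@rk_ind d E) => f IH fS.
have [af|naf] := boolP (actv u f); first by rewrite (lev_actv lv) // (lev_actv
  lv').
have [g [ug gf lg]] := lev_pred lv fS naf; have [h [uh hf lh]] := lev_pred lv'
  fS naf.
have Eg := IH g gf (tab_in op tab fS ug); have Eh := IH h hf (tab_in op tab fS
  uh).
have := lev_mono lv fS uh; have := lev_mono lv' fS ug.
by rewrite /tau; case: ifP => _; lia.
Qed.

Lemma Int_actv G T u : tableau (tension G) (flow G) (edges G) T u ->
  Int G T = [set b in T | actv u b].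
Proof.
move=> tab; apply/setP => a; rewrite !inE; case: (boolP (a \in T)) => //= aT.
by rewrite (fund_cocycleE tab aT) (is_min_supp tab) // (subsetP (tab_sub tab)).
Qed.

Lemma Ext_actv G T u : tableau (tension G) (flow G) (edges G) T u ->
  Ext G T = [set e in edges G :\: T | actv u e].
Proof.
move=> tab; apply/setP => a; rewrite 2!inE; case: (boolP (a \in edges G :\: T))
  => //= aT.
by rewrite (fund_cycleE tab aT) (is_min_supp tab) //; move: aT;
  rewrite inE => /andP[].
Qed.

Lemma tension_minor G A B x : tension G x -> (forall e, e \in A -> x e = 0) ->
  tension (minor G (A, B)) (fun e => if e \in B then x e else 0).
Proof.
move=> tx xA; apply: tension_contract; first exact: tension_restrict.
by move=> e /xA ->; rewrite if_same.
Qed.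

Lemma edges_minor G p : p.2 \subset edges G -> edges (minor G p) = part p.
Proof. by move=> /setIidPr pG; rewrite /= pG. Qed.

Lemma active_is_filtration G s T lev : gopt G s T lev ->
  is_filtration G (active_filtration G s).
Proof.
move=> o; have [_ EU] := up_list o; have [_ ED] := down_list o.
have pr a : a \in sort_set (dual_active G s) ++ sort_set (active G s) ->
    lo G lev a \proper hi G lev a.
  move=> /(step_actives o)[aG _]; apply/properP; split.
    by apply/subsetP => f; rewrite !inE => /andP[-> /ltW].
  by exists a; rewrite !inE aG ?lexx ?ltxx.
have srt A : {subset sort_set A <= sort_set (dual_active G s) ++ sort_set
  (active G s)} ->
    sorted min_lt [seq part FF | FF <- map (lohi G lev) (sort_set A)].
  move=> sub; rewrite -map_comp sorted_map.
  apply: (sub_in_sorted (P := mem (sort_set A)) _ _ (sort_set_lt A));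
    last exact/allP.
  move=> a b /sub/(step_actives o)[aG la] /sub/(step_actives o)[bG lb] ab /=.
  by rewrite (min_ltP (a := a) (b := b)) // -minor_edges; apply: (minor_min o).
apply/and5P; split; last (apply/andP; split).
- rewrite path_zip -/(up_steps _) (up_stepsE o) all_map; apply/allP => a al /=.
  by apply: pr; rewrite mem_cat al.
- have := congr1 (last set0) EU; rewrite last_rcons /= => ->; exact: eqxx.
- rewrite path_zip' -/(down_steps _) (down_stepsE o) all_map;
    apply/allP => a al /=.
  by apply: pr; rewrite mem_cat al orbT.
- have := congr1 (last set0) ED; rewrite last_rcons /= => ->; exact: eqxx.
- by rewrite (up_stepsE o); apply: srt => a aA; rewrite mem_cat aA.
- by rewrite (down_stepsE o); apply: srt => a aA; rewrite mem_cat aA orbT.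
Qed.

Lemma active_tree_filtration G s T lev : gopt G s T lev ->
  tree_filtration G T (active_filtration G s).
Proof.
move=> o; apply/and3P; split; first exact: active_is_filtration o.
- rewrite (up_stepsE o) all_map; apply/allP => a;
    rewrite mem_sort_set (dual_activeE o) inE.
  case/andP=> aG /eqP la /=; have o' := gopt_minor_const o a.
  have aN : a \in edges (minor G (lohi G lev a)) by rewrite minor_edges
    part_lohi inE aG eqxx.
  have [u [tab lv co]] := o'; rewrite /uniactive_internal (gopt_spanning o') /=.
  rewrite (IntE tab lv) (ExtE tab lv); apply/andP; split.
    apply/cards1P; exists a; apply/setP => f; rewrite inE [RHS]inE la.
    apply/andP/eqP => [[_ /eqP E0]|->]; last by rewrite aN.
    by apply: rk_inj; lia.
  by rewrite cards_eq0; apply/eqP/setP => f; rewrite inE [RHS]inE la andbC; lia.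
- rewrite (down_stepsE o) all_map; apply/allP => a;
    rewrite mem_sort_set (activeE o) inE.
  case/andP=> aG /eqP la /=; have o' := gopt_minor_const o a.
  have aN : a \in edges (minor G (lohi G lev a)) by rewrite minor_edges
    part_lohi inE aG eqxx.
  have [u [tab lv co]] := o'; rewrite /uniactive_external (gopt_spanning o') /=.
  rewrite (IntE tab lv) (ExtE tab lv); apply/andP; split.
    by rewrite cards_eq0; apply/eqP/setP => f; rewrite inE [RHS]inE la andbC;
      lia.
  apply/cards1P; exists a; apply/setP => f; rewrite inE [RHS]inE la.
  apply/andP/eqP => [[_ /eqP E0]|->]; last by rewrite aN.
  by apply: rk_inj; lia.
Qed.

Section Unique.
Variables (G : graph V E) (T : {set E}) (u : E -> E -> rat) (Fs : filtration E).
Hypothesis tab : tableau (tension G) (flow G) (edges G) T u.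
Hypothesis treeF : tree_filtration G T Fs.
Let op := graph_opair G.
Let filt : is_filtration G Fs. Proof. by case/and3P: treeF. Qed.

(** The steps of the filtration with the levels that they should have. *)
Definition step p (k : int) : Prop :=
  (p \in up_steps Fs /\ exists2 a, is_min (part p) a & k = (rk a).+1%:Z) \/
  (p \in down_steps Fs /\ exists2 a, is_min (part p) a & k = - (rk a).+1%:Z).

Lemma step_up_sub p : p \in up_steps Fs ->
  [/\ fcyc Fs \subset p.1, p.1 \proper p.2 & p.2 \subset edges G].
Proof.
case/and5P: filt => up /eqP lastE _ _ /andP[_ _] pU.
by have [_ /(_ p pU)[]] := chain_up up; rewrite lastE.
Qed.

Lemma fcyc_sub : fcyc Fs \subset edges G.
Proof.
case/and5P: filt => up /eqP lastE _ _ /andP[_ _]; move: up lastE; rewrite /=.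
case: (fup Fs) => [/= _ -> //|A l] up lastE.
have [_ /(_ (fcyc Fs, A) (mem_head _ _))[_ /proper_sub FA]] := chain_up up.
by rewrite lastE; exact: subset_trans.
Qed.

Lemma step_down_sub p : p \in down_steps Fs ->
  p.2 \subset fcyc Fs /\ p.1 \proper p.2.
Proof.
case/and5P: filt => _ _ down _ /andP[_ _] pU.
by have [_ /(_ p pU)[]] := chain_down down.
Qed.

Lemma step_sub p k : step p k -> p.1 \proper p.2 /\ p.2 \subset edges G.
Proof.
case=> [[/step_up_sub[_ pp pG] _]|[/step_down_sub[pF pp] _]]; split=> //.
exact: subset_trans pF fcyc_sub.
Qed.

Lemma proper_part p : p.1 \proper p.2 -> part p != set0.
Proof. by rewrite properE setD_eq0 => /andP[]. Qed.

Lemma up_order p q a b : p \in up_steps Fs -> q \in up_steps Fs ->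
    is_min (part p) a -> is_min (part q) b -> 
  [\/ p = q, (a < b)%O && (p.2 \subset q.1) | (b < a)%O && (q.2 \subset p.1)].
Proof.
case/and5P: filt => up _ _ _ /andP[srt _] pU qU pa qb.
have [pw _] := chain_up up; move: srt; rewrite sorted_pairwise;
  last exact: min_lt_trans.
rewrite pairwise_map => srt.
have /pairwise_mem/(_ pU qU) : pairwise
    [rel p q | min_lt (part p) (part q) && (p.2 \subset q.1)] (up_steps Fs).
  by rewrite pairwise_relI srt.
by rewrite /= (min_ltP pa qb) (min_ltP qb pa).
Qed.

Lemma down_order p q a b : p \in down_steps Fs -> q \in down_steps Fs ->
    is_min (part p) a -> is_min (part q) b -> 
  [\/ p = q, (a < b)%O && (q.2 \subset p.1) | (b < a)%O && (p.2 \subset q.1)].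
Proof.
case/and5P: filt => _ _ down _ /andP[_ srt] pU qU pa qb.
have [pw _] := chain_down down; move: srt; rewrite sorted_pairwise;
  last exact: min_lt_trans.
rewrite pairwise_map => srt.
have /pairwise_mem/(_ pU qU) : pairwise
    [rel p q | min_lt (part p) (part q) && (q.2 \subset p.1)] (down_steps Fs).
  by rewrite pairwise_relI srt.
by rewrite /= (min_ltP pa qb) (min_ltP qb pa).
Qed.

Lemma step_order p q k m : step p k -> step q m ->
  (k < m -> p.2 \subset q.1) /\ (k = m -> p = q).
Proof.
case=> [[pU [a pa ->]]|[pD [a pa ->]]]; case=> [[qU [b qb ->]]|[qD [b qb ->]]].
- have [E0|/andP[ab pq]|/andP[ba qp]] := up_order pU qU pa qb.
  + by subst q; rewrite (is_min_inj pa qb) ltxx.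
  + by split=> //; rewrite -rk_lt in ab; lia.
  + by rewrite -rk_lt in ba; split; lia.
- by split; lia.
- split; last by lia.
  have [pF _] := step_down_sub pD; have [Fq _ _] := step_up_sub qU.
  by move=> _; exact: subset_trans pF Fq.
- have [E0|/andP[ab pq]|/andP[ba qp]] := down_order pD qD pa qb.
  + by subst q; rewrite (is_min_inj pa qb) ltxx.
  + by rewrite -rk_lt in ab; split; lia.
  + by split=> //; rewrite -rk_lt in ba; lia.
Qed.

Lemma step_cover f : f \in edges G -> exists p k, step p k /\ f \in part p.
Proof.
move=> fG; case/and5P: filt => up /eqP lastE down /eqP last0 /andP[_ _].
have [fF|fF] := boolP (f \in fcyc Fs).
  have [|p pD fp] := chain_cover' fF (l := fdown Fs);
    first by rewrite last0 inE.
  have [a pa] := set_min (proper_part (step_down_sub pD).2).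
  by exists p, (- (rk a).+1%:Z); split=> //; right; split=> //; exists a.
have [|p pU fp] := chain_cover _ fF (l := fup Fs); first by rewrite lastE.
have [_ pp _] := step_up_sub pU; have [a pa] := set_min (proper_part pp).
by exists p, (rk a).+1%:Z; split=> //; left; split=> //; exists a.
Qed.

Variable key : E -> int.
Hypothesis keyP : forall f, f \in edges G -> exists2 p, step p (key f) & f \in
  part p.

Lemma key_le p k f : step p k -> f \in edges G -> (f \in p.2) = (key f <= k).
Proof.
move=> pk fG; have [q qf fq] := keyP fG; have [lt eq] := step_order pk qf.
have [lt' _] := step_order qf pk; have [qq _] := step_sub qf;
  have [pp _] := step_sub pk.
move: (fq); rewrite inE => /andP[fq1 fq2].
case: (ltgtP (key f) k) => [kf|kf|kf].
- by apply: (subsetP (proper_sub pp)); exact: (subsetP (lt' kf)).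
- by apply: contraNF fq1; exact: (subsetP (lt kf)).
- by rewrite eq.
Qed.

Lemma key_lt p k f : step p k -> f \in edges G -> (f \in p.1) = (key f < k).
Proof.
move=> pk fG; have [q qf fq] := keyP fG; have [lt eq] := step_order pk qf.
have [lt' _] := step_order qf pk; have [qq _] := step_sub qf;
  have [pp _] := step_sub pk.
move: (fq); rewrite inE => /andP[fq1 fq2].
case: (ltgtP (key f) k) => [kf|kf|kf].
- exact: (subsetP (lt' kf)).
- apply: contraNF fq1 => fp; apply: (subsetP (lt kf)).
  exact: (subsetP (proper_sub pp)).
- by rewrite eq //; apply: negbTE.
Qed.

Lemma step_tree p k : step p k -> spanning_tree (minor G p) (T :&: part p).
Proof.
case/and3P: treeF => _ /allP upP /allP downP.
by case=> [[/upP/and3P[]]|[/downP/and3P[]]].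
Qed.

(** A fundamental tension cannot meet a part below the one of its tree edge:
    on the lowest such part it would give a tension of the minor that vanishes
    on a spanning tree. *)
Lemma key_mono b e : b \in T -> u b e != 0 -> key b <= key e.
Proof.
move=> bT ube; have bG := subsetP (tab_sub tab) _ bT.
case: (arg_minP (P := [pred g | u b g != 0]) key ube) => g /= ubg gmin.
apply: le_trans (gmin e ube); rewrite leNgt; apply/negP => gb.
have gG := tab_in op tab bG ubg; have [p pg gp] := keyP gG.
have /spanning_tree_tab[uN tabN] := step_tree pg.
have [_ pG] := step_sub pg.
have tN : tension (minor G p) (fun h => if h \in p.2 then u b h else 0).
  case: p pg {gp tabN pG} => p1 p2 pg; apply: tension_minor;
    first exact: (tab_cv tab bT).
  move=> h hp; apply/eqP; apply: contraT => ubh.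
  by have := gmin h ubh; rewrite leNgt -(key_lt pg) ?(tab_in op tab bG ubh) ?hp.
have zT h : h \in T :&: part p -> (if h \in p.2 then u b h else 0) = 0.
  rewrite !inE => /and3P[hT hp1 hp2]; rewrite hp2.
  have hG := subsetP (tab_sub tab) _ hT.
  rewrite (tab_off tab bG hG) ?bT ?hT //; apply: contraTneq hp2 => <-.
  by rewrite (key_le pg) // -ltNge.
have := tab_zero (graph_opair _) tabN tN zT g; move: gp;
  rewrite inE => /andP[_ ->] E0.
by rewrite E0 eqxx in ubg.
Qed.

(** On its part, the fundamental vectors of the minor are the restrictions of
    those of the graph. *)
Lemma step_tableau p k uN : step p k ->
    tableau (tension (minor G p)) (flow (minor G p)) (edges (minor G p)) (T :&:
      part p) uN ->
  forall f g, f \in part p -> g \in part p -> uN f g = u f g.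
Proof.
move=> pk tabN; have [_ pG] := step_sub pk; have EN := edges_minor pG.
have inp f : f \in part p -> f \in p.2 by rewrite inE => /andP[].
have inG f : f \in part p -> f \in edges G by move/inp/(subsetP pG).
have bE b g : b \in T -> b \in part p -> g \in part p -> uN b g = u b g.
  move=> bT bp gp; have bG := inG b bp.
  have kb : k <= key b by rewrite leNgt -(key_lt pk bG); move: bp;
    rewrite inE => /andP[].
  have tN : tension (minor G p) (fun h => if h \in p.2 then u b h else 0).
    move: pk kb; case: (p) => p1 p2 pk kb; apply: tension_minor;
      first exact: (tab_cv tab bT).
    move=> h hp; apply/eqP; apply: contraT => ubh.
    have hG := tab_in op tab bG ubh; have := key_mono bT ubh.
    by move: hp; rewrite (key_lt pk hG); lia.
  have bTp : b \in T :&: part p by rewrite inE bT.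
  have := tab_fund (graph_opair _) tabN bTp tN _ g.
  rewrite (inp b bp) (inp g gp) (tab_diag tab) // mul1r => -> // h.
  rewrite inE => /andP[hT hp] hb; rewrite inp //.
  by rewrite (tab_off tab bG (inG h hp)) ?bT ?hT // eq_sym.
have inT f : f \in part p -> (f \in T :&: part p) = (f \in T).
  by move=> fp; rewrite in_setI fp andbT.
have inN f : f \in part p -> f \in edges (minor G p) by rewrite EN.
move=> f g fp gp; have [fT|fT] := boolP (f \in T); first exact: bE.
have [gT|gT] := boolP (g \in T).
  rewrite (tab_anti op tab (inG f fp) (inG g gp)) ?gT ?(negbTE fT) //.
  by rewrite (tab_anti (graph_opair _) tabN (inN f fp) (inN g gp)) ?inT ?gT
    ?(negbTE fT) // bE.
have [->|fg] := eqVneq f g; first by rewrite (tab_diag tab) ?(tab_diag tabN)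
  ?inN ?inG.
rewrite (tab_off tab (inG f fp) (inG g gp) fg) ?(negbTE fT) ?(negbTE gT) //.
by rewrite (tab_off tabN (inN f fp) (inN g gp) fg) // !inT // (negbTE fT)
  (negbTE gT).
Qed.

(** The smallest edge of a part is always active in its minor, and uniactivity
    leaves no other active edge. *)
Lemma step_active p k : step p k -> exists a, [/\ is_min (part p) a,
  k = tau T a * (rk a).+1%:Z
  & forall f, f \in part p -> f != a -> exists g, [/\ g \in part p, u f g != 0 &
    (g < f)%O]].
Proof.
move=> pk; have /spanning_tree_tab[uN tabN] := step_tree pk.
have [pp pG] := step_sub pk; have EN := edges_minor pG.
have uE := step_tableau pk tabN.
have [a pa] := set_min (proper_part pp); have aP := proj1 (andP pa).
have act_a : actv uN a.
  apply/actvP => g uag; apply: (implyP (forallP (proj2 (andP pa)) g)).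
  by rewrite -EN; apply: (tab_in (graph_opair _) tabN _ uag); rewrite EN.
have aE f : f \in part p ->
    (f \in Int (minor G p) (T :&: part p)) = (f \in T) && actv uN f /\
    (f \in Ext (minor G p) (T :&: part p)) = (f \notin T) && actv uN f.
  move=> fp; split; first by rewrite (Int_actv tabN) in_set in_setI fp andbT.
  by rewrite (Ext_actv tabN) EN in_set in_setD in_setI fp !andbT.
have nact f : f \in part p -> ~~ actv uN f ->
    exists g, [/\ g \in part p, u f g != 0 & (g < f)%O].
  move=> fp /actvPn[g ufg gf]; have gp : g \in part p.
    by rewrite -EN; apply: (tab_in (graph_opair _) tabN _ ufg); rewrite EN.
  by exists g; rewrite -uE.
case/and3P: treeF => _ /allP upP /allP downP.
exists a; case: pk => [[pU [a' pa' ->]]|[pD [a' pa' ->]]];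
  rewrite (is_min_inj pa' pa).
  case/and3P: (upP p pU) => _ /cards1P[c IntE] /eqP/cards0_eq ExtE.
  have [] := aE a aP; rewrite IntE ExtE act_a andbT in_set1 in_set0 andbT.
  move=> ac /esym/negbFE aT; rewrite aT in ac; split=> //;
    first by rewrite /tau aT mul1r.
  move=> f fp fa; apply: nact => //; apply: contraNN fa => af.
  have [] := aE f fp; rewrite IntE ExtE af andbT in_set1 in_set0 andbT.
  by move=> fc /esym/negbFE fT; rewrite fT in fc; rewrite (eqP fc) eq_sym.
case/and3P: (downP p pD) => _ /eqP/cards0_eq IntE /cards1P[c ExtE].
have [] := aE a aP; rewrite IntE ExtE act_a andbT in_set1 in_set0 andbT.
move=> /esym/negbT aT ac; rewrite aT in ac; split=> //.
  by rewrite /tau (negbTE aT) mulN1r.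
move=> f fp fa; apply: nact => //; apply: contraNN fa => af.
have [] := aE f fp; rewrite IntE ExtE af andbT in_set1 in_set0 andbT.
by move=> /esym/negbT fT fc; rewrite fT in fc; rewrite (eqP fc) eq_sym.
Qed.

Lemma step_key p k f : step p k -> f \in part p -> key f = k.
Proof.
move=> pk fp; have [_ pG] := step_sub pk.
have fG : f \in edges G by move: fp; rewrite inE => /andP[_ /(subsetP pG)].
move: fp; rewrite inE (key_lt pk fG) (key_le pk fG) -leNgt => /andP[k1 k2].
by apply/eqP; rewrite eq_le k2.
Qed.

Lemma key_rk f : f \in edges G -> `|key f| <= (rk f).+1%:Z.
Proof.
move=> fG; have [p pf fp] := keyP fG; have [a [/andP[_ /forallP amin] -> _]] :=
  step_active pf.
have := implyP (amin f) fp; rewrite -rk_le /tau; case: ifP => _; lia.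
Qed.

(** A filtration into uniactive minors is a levelling, so there is only one. *)
Lemma key_levelling : levelling (edges G) T u key.
Proof.
have mono f g : f \in edges G -> u f g != 0 -> tau T f * key f <= tau T f * key
  g.
  move=> fG ufg; have gG := tab_in op tab fG ufg; rewrite /tau;
    case: ifPn => fT.
    by rewrite !mul1r; exact: key_mono.
  have [->|gf] := eqVneq g f; first exact: lexx.
  have gT := tab_side op tab fG ufg gf; rewrite fT in gT.
  by rewrite !mulN1r lerN2; apply: key_mono => //;
    exact: (tab_sym op tab fG ufg).
split=> // [f fG /actvPn[h ufh hf]|f fG /actvP af].
  have [p pf fp] := keyP fG; have [a [pa ka nact]] := step_active pf.
  have [fa|/(nact f fp)[g [gp ufg gf]]] := eqVneq f a; last first.
    by exists g; split=> //; exact: (step_key pf gp).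
  have := mono f h fG ufh; have := key_rk (tab_in op tab fG ufh).
  rewrite ka -fa; move: hf; rewrite -rk_lt /tau; case: ifP => _; lia.
have [p pf fp] := keyP fG; have [a [pa ka nact]] := step_active pf.
have [fa|/(nact f fp)[g [gp /af fg gf]]] := eqVneq f a; first by rewrite ka -fa.
by rewrite leNgt gf in fg.
Qed.

Lemma step_lohi p k : step p k -> exists a, [/\ is_min (part p) a, a \in edges
  G,
  key a = k & p = (lo G key a, hi G key a)].
Proof.
move=> pk; have [a [pa _ _]] := step_active pk; have aP := proj1 (andP pa).
have ka := step_key pk aP; have [pp pG] := step_sub pk; exists a; split=> //.
  by move: aP; rewrite inE => /andP[_ /(subsetP pG)].
rewrite [LHS]surjective_pairing; congr pair; apply/setP => f; rewrite inE ka.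
  have [fG|fG] := boolP (f \in edges G); first by rewrite (key_lt pk).
  by apply: contraNF fG => /(subsetP (proper_sub pp))/(subsetP pG).
have [fG|fG] := boolP (f \in edges G); first by rewrite (key_le pk).
by apply: contraNF fG => /(subsetP pG).
Qed.

Lemma fcyc_key : fcyc Fs = [set f in edges G | key f < 0].
Proof.
apply/setP => f; rewrite inE; have [fG|fG] := boolP (f \in edges G); last first.
  by apply: contraNF fG => /(subsetP fcyc_sub).
have [p [[pU [a pa ->]]|[pD [a pa ->]]] fp] := keyP fG.
  have [Fp _ _] := step_up_sub pU; apply: contraTF fp => /(subsetP Fp) fp.
  by rewrite inE fp.
have [pF _] := step_down_sub pD; move: fp; rewrite inE => /andP[_ /(subsetP pF)
  ->].
by [].
Qed.

(** Ascending and descending steps are treated alike, up to the sign of their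
    levels. *)
Lemma key_steps (A : {set E}) (l : seq ({set E} * {set E})) (sgn : bool) :
    sorted min_lt [seq part p | p <- l] ->
    (forall p, p \in l -> exists2 a, is_min (part p) a & step p ((-1) ^+ sgn *
      (rk a).+1%:Z)) ->
    (forall a, a \in A = (a \in edges G) && (key a == (-1) ^+ sgn * (rk
      a).+1%:Z)) ->
    (forall p k, step p k -> 0 < (-1) ^+ sgn * k -> p \in l) ->
  l = map (lohi G key) (sort_set A).
Proof.
have signI (m n : nat) : (-1) ^+ sgn * m.+1%:Z = (-1) ^+ sgn * n.+1%:Z -> n = m.
  by case: sgn; rewrite ?expr1 ?expr0 ?mulN1r ?mul1r; lia.
move=> srt lstep AE lin.
have lE p : p \in l -> exists2 a, is_min (part p) a & (a \in A) && (p == lohi G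
  key a).
  move=> /lstep[a pa pk]; exists a => //.
  have [a' [pa' aG ka ->]] := step_lohi pk; rewrite -(is_min_inj pa pa') in aG
    ka *.
  by rewrite AE aG ka !eqxx.
have [a0 _|l0] := pickP (mem A); last first.
  have -> : sort_set A = [::].
    by case E0: (sort_set A) => [|b r] //; have := mem_sort_set A b;
      rewrite E0 mem_head -[b \in A]/(mem A b) l0.
  case: (l) lE => // p l' /(_ p (mem_head _ _))[a _ /andP[aA _]].
  by have := l0 a; rewrite /= aA.
pose m p := odflt a0 [pick a | is_min (part p) a].
have mE p a : is_min (part p) a -> m p = a.
  move=> pa; rewrite /m; case: pickP => [b pb|/(_ a)]; last by rewrite pa.
  exact: (is_min_inj pb pa).
have -> : sort_set A = map m l.
  apply/esym/sort_set_eq.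
    move: srt; rewrite !sorted_map; apply: (sub_in_sorted (P := mem l));
      last exact/allP.
    move=> p q /lE[a pa _] /lE[b qb _] /=.
    by rewrite (min_ltP pa qb) (mE p a pa) (mE q b qb).
  move=> a; apply/mapP/idP => [[p /lE[b pb /andP[bA _]] ->]|aA];
    first by rewrite (mE p b).
  move: (aA); rewrite AE => /andP[aG /eqP ka]; have [p pk ap] := keyP aG.
  have pl : p \in l by apply: lin pk _; rewrite ka mulrA -signr_addb addbb
    mul1r.
  exists p => //; have [b pb /andP[]] := lE p pl;
    rewrite AE => /andP[bG /eqP kb] /eqP Ep.
  rewrite (mE p b pb); apply/rk_inj/signI.
  by have := step_key pk (proj1 (andP pb)); rewrite kb ka.
rewrite -map_comp -[LHS]map_id; apply/eq_in_map => p /lE[a pa /andP[_ /eqP pE]]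
  /=.
by rewrite (mE p a pa).
Qed.

End Unique.
Lemma filtration_eq (Fs Fs' : filtration E) : fcyc Fs = fcyc Fs' ->
  up_steps Fs = up_steps Fs' -> down_steps Fs = down_steps Fs' -> Fs = Fs'.
Proof.
case: Fs Fs' => [F up down] [F' up' down'] /= <- eU eD; congr Filtration.
  have := congr1 unzip2 eU; by rewrite /up_steps !unzip2_zip //=.
have := congr1 unzip1 eD; by rewrite /down_steps !unzip1_zip //=.
Qed.

Lemma tree_filtration_unique G s T lev Fs : gopt G s T lev ->
  tree_filtration G T Fs -> Fs = active_filtration G s.
Proof.
move=> o tF; have [u [tab lv _]] := o.
have [key keyP] : exists key : E -> int, forall f, f \in edges G ->
    exists2 p, step Fs p (key f) & f \in part p.
  suff: forall f, exists k : int, f \in edges G -> exists2 p, step Fs p k & f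
    \in part p.
    by case/fin_all_exists => key keyP; exists key.
  move=> f; have [fG|] := boolP (f \in edges G); last by exists 0.
  have [p [k [pk fp]]] := step_cover tF fG.
  by exists k => _; exists p.
have lk : {in edges G, lev =1 key}.
  exact: (levelling_unique (graph_opair G) tab lv (key_levelling tab tF keyP)).
have lohiE a : a \in edges G -> lohi G key a = lohi G lev a.
  move=> aG; congr pair; apply/setP => f; rewrite !inE;
    by case: (boolP (f \in edges G)) => //= fG; rewrite !lk.
have /andP[/and5P[_ _ _ _ /andP[su sd]] _] := tF.
apply: filtration_eq.
- rewrite (active_fcyc o) (fcyc_key tF keyP); apply/setP => f; rewrite !inE.
  by case: (boolP (f \in edges G)) => //= fG; rewrite lk.
- rewrite (up_stepsE o) (key_steps (A := dual_active G s) (sgn := false) tab tF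
    keyP su).
  + apply/eq_in_map => a; rewrite mem_sort_set (dual_activeE o) inE => /andP[aG
      _].
    exact: lohiE.
  + move=> p pU; have [_ pp _] := step_up_sub tF pU.
    have [a pa] := set_min (proper_part pp); exists a => //.
    by left; split=> //; exists a; rewrite ?mul1r.
  + move=> a; rewrite (dual_activeE o) inE expr0 mul1r.
    by case: (boolP (a \in edges G)) => //= aG; rewrite lk.
  + by move=> p k [[//]|[_ [a _ ->]]]; rewrite expr0; lia.
- rewrite (down_stepsE o) (key_steps (A := active G s) (sgn := true) tab tF keyP
    sd).
  + apply/eq_in_map => a; rewrite mem_sort_set (activeE o) inE => /andP[aG _].
    exact: lohiE.
  + move=> p pD; have [_ pp] := step_down_sub tF pD.
    have [a pa] := set_min (proper_part pp); exists a => //.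
    by right; split=> //; exists a; rewrite ?mulN1r.
  + move=> a; rewrite (activeE o) inE expr1 mulN1r.
    by case: (boolP (a \in edges G)) => //= aG; rewrite lk.
  + by move=> p k [[_ [a _ ->]]|[//]]; rewrite expr1; lia.
Qed.

Lemma tree_filtrationP G s T lev Fs : gopt G s T lev ->
  tree_filtration G T Fs <-> Fs = active_filtration G s.
Proof.
by move=> o; split=> [|->]; [exact: tree_filtration_unique o | exact:
  active_tree_filtration o].
Qed.

End TreeFiltration.
(** * Activity classes *)

Section Classes.
Context {V : finType} {d : Order.disp_t} {E : finOrderType d}.
Implicit Types (G : graph V E) (s : orientation E) (a b c e f g : E).
Implicit Types (T A : {set E}) (Q : {set {set E}}) (lev : E -> int).
Local Open Scope ring_scope.

Section OneClass.
Variables (G : graph V E) (s : orientation E) (T : {set E}) (lev : E -> int).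
Hypothesis o : gopt G s T lev.

Let reps := sort_set (dual_active G s) ++ sort_set (active G s).

Lemma active_partitionE :
  active_partition G s = [set A in [seq part (lohi G lev a) | a <- reps]].
Proof. by apply/setP => A; rewrite !inE (steps_list o) -map_comp. Qed.

Lemma partition_level A f g : A \in active_partition G s ->
  f \in edges G -> g \in edges G -> lev f = lev g -> (f \in A) = (g \in A).
Proof.
rewrite active_partitionE inE => /mapP[a _ ->] fG gG fg.
by rewrite part_lohi !inE fG gG fg.
Qed.

Lemma partition_same A A' f : A \in active_partition G s ->
  A' \in active_partition G s -> f \in A -> f \in A' -> A = A'.
Proof.
rewrite active_partitionE !inE => /mapP[a _ ->] /mapP[a' _ ->].
rewrite !part_lohi !inE => /andP[_ /eqP <-] /andP[_ /eqP <-].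
by [].
Qed.

Lemma partition_nonempty A : A \in active_partition G s -> exists f, f \in A.
Proof.
rewrite active_partitionE inE => /mapP[a /(step_actives o)[aG _] ->].
by exists a; rewrite part_lohi inE aG eqxx.
Qed.

Lemma partition_cover f : f \in edges G ->
  exists2 A, A \in active_partition G s & f \in A.
Proof.
move=> fG; have [a ar fa] := parts_cover o fG; exists (part (lohi G lev a)) =>
  //.
by rewrite active_partitionE inE; apply/mapP; exists a.
Qed.

Lemma card_active_partition :
  #|active_partition G s| = (#|dual_active G s| + #|active G s|)%N.
Proof.
rewrite active_partitionE cardsE.
have u : uniq [seq part (lohi G lev a) | a <- reps].
  rewrite map_inj_in_uniq; first exact: (step_actives_uniq o).
  move=> a b /(step_actives o)[aG la] /(step_actives o)[bG lb] /setP/(_ a).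
  rewrite !part_lohi !inE aG eqxx /= => /esym/eqP lab; apply: rk_inj; lia.
by rewrite (card_uniqP u) size_map size_cat !size_sort -!cardE.
Qed.

Lemma card_activity_class :
  #|activity_class G s| = (2 ^ (#|dual_active G s| + #|active G s|))%N.
Proof.
rewrite card_in_imset ?card_powerset ?card_active_partition // => Q Q'.
rewrite !inE => /subsetP Qp /subsetP Q'p /ffunP rQ.
have cQ f : (f \in cover Q) = (f \in cover Q').
  by have := rQ f; rewrite !ffunE => /addIb.
have sub Q1 Q2 : {subset Q1 <= active_partition G s} ->
    {subset Q2 <= active_partition G s} ->
    (forall f, (f \in cover Q1) = (f \in cover Q2)) -> {subset Q1 <= Q2}.
  move=> Q1p Q2p c12 A AQ; have [f fA] := partition_nonempty (Q1p A AQ).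
  have /bigcupP[A' A'Q fA'] : f \in cover Q2.
    by rewrite -c12; apply/bigcupP; exists A.
  by rewrite (partition_same (Q1p A AQ) (Q2p A' A'Q) fA fA').
by apply/setP => A; apply/idP/idP; [exact: sub | apply: sub].
Qed.

(** The conditions compare elements of the same part, which are reversed
    together. *)
Lemma gopt_class s' : s' \in activity_class G s -> gopt G s' T lev.
Proof.
case/imsetP=> Q; rewrite inE => /subsetP Qp ->.
have [u [tab lv co]] := o; exists u; split=> // f m fG ufm lm mf mmin.
have mG := tab_in (graph_opair G) tab fG ufm.
have cE : (f \in cover Q) = (m \in cover Q).
  apply/bigcupP/bigcupP => -[A AQ fA]; exists A => //.
    by rewrite (partition_level (Qp A AQ) mG fG lm).
  by rewrite -(partition_level (Qp A AQ) mG fG lm).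
have := co f m fG ufm lm mf mmin; rewrite /sg !ffunE cE.
by case: (m \in cover Q); case: (s f); case: (s m) => /=; lra.
Qed.

Lemma tab_unique S cv fv u u' : opair S cv fv -> tableau cv fv S T u ->
  tableau cv fv S T u' -> forall f e, f \in T -> u' f e = u f e.
Proof.
move=> op tab tab' f e fT; have TS := subsetP (tab_sub tab).
rewrite (tab_fund op tab fT (tab_cv tab' fT)); last first.
  move=> g gT gf; rewrite (tab_off tab' (TS f fT) (TS g gT)) ?fT ?gT //.
  by rewrite eq_sym.
by rewrite (tab_diag tab') ?mul1r // TS.
Qed.

(** The set A where two orientations with the same tree differ contains f if
    and only if it contains the element that f is compared to; descending to
    the active elements, A is a union of parts. *)
Lemma class_complete s' lev' : edges G = [set: E] -> gopt G s' T lev' ->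
  s' \in activity_class G s.
Proof.
move=> GE [u' [tab' lv' co']]; have [u [tab lv co]] := o;
  have op := graph_opair G.
have GT f : f \in edges G by rewrite GE inE.
have uu f e : u' f e = u f e.
  have [fT|fT] := boolP (f \in T); first exact: (tab_unique op tab tab' e fT).
  have fN : f \in edges G :\: T by rewrite inE fT GT.
  have fund := tab_fund (opair_dual op) (tableau_dual tab) fN (tab_fv tab' fN).
  rewrite fund; first by rewrite (tab_diag tab') ?mul1r.
  move=> g; rewrite inE => /andP[gT _] gf.
  by rewrite (tab_off tab' (GT f) (GT g)) ?(negbTE fT) ?(negbTE gT) // eq_sym.
have act f : actv u' f = actv u f by apply: eq_forallb => g; rewrite uu.
have lv2 : levelling (edges G) T u lev'.
  split=> [f g fG ufg|f fG|f fG]; rewrite -?act.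
  - by apply: (lev_mono lv' fG); rewrite uu.
  - by move/(lev_pred lv' fG) => [h [uh hf lh]]; exists h; rewrite -uu.
  - exact: (lev_actv lv' fG).
have ll := levelling_unique op tab lv lv2.
pose A := [set f | s f != s' f].
have AA f m : u f m != 0 -> lev m = lev f -> (m < f)%O ->
    (forall h, u f h != 0 -> lev h = lev f -> (m <= h)%O) -> (f \in A) = (m \in
      A).
  move=> ufm lm mf mmin; have := co f m (GT f) ufm lm mf mmin.
  have : sg s' f * sg s' m * u' f m < 0.
    apply: co'; rewrite ?uu -?ll ?GT //.
    by move=> h uh; rewrite -!ll ?GT // => lh; apply: mmin => //; rewrite -uu.
  rewrite uu !inE /sg.
  by case: (s f); case: (s m); case: (s' f); case: (s' m) => //=; lra.
have Alev f : exists a, [/\ lev a = lev f, `|lev a| = (rk a).+1%:Z & (f \in A) =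
  (a \in A)].
  move: f; apply: (@rk_ind d E) => f IH.
  have [af|naf] := boolP (actv u f).
    by exists f; split=> //; have := actv_lev op tab lv (GT f);
      rewrite af => /esym/eqP.
  have [h [uh hf lh]] := lev_pred lv (GT f) naf.
  case: (arg_minnP (P := [pred g | (u f g != 0) && (lev g == lev f)]) rk (i0 :=
    h)).
    by rewrite /= uh lh eqxx.
  move=> m /= /andP[ufm /eqP lm] mmin.
  have mle g : u f g != 0 -> lev g = lev f -> (m <= g)%O.
    by move=> ug lg; rewrite -rk_le; apply: mmin; rewrite ug lg eqxx.
  have mf : (m < f)%O := le_lt_trans (mle h uh lh) hf.
  have [a [la aa mA]] := IH m mf; exists a; rewrite la lm -mA.
  by split=> //; [rewrite -lm -la | exact: AA].
have Aeq f g : lev f = lev g -> (f \in A) = (g \in A).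
  move=> fg; have [a [la aa ->]] := Alev f; have [b [lb bb ->]] := Alev g.
  by have -> : a = b by apply: rk_inj; lia.
apply/imsetP; exists [set P in active_partition G s | P \subset A].
  by rewrite inE; apply/subsetP => P; rewrite inE => /andP[].
suff -> : cover [set P in active_partition G s | P \subset A] = A.
  by apply/ffunP => f; rewrite ffunE inE; case: (s f); case: (s' f).
apply/setP => f; apply/bigcupP/idP => [[P]|fA].
  by rewrite inE => /andP[_ /subsetP PA] /PA.
have [P Pp fP] := partition_cover (GT f); exists P => //; rewrite inE Pp /=.
apply/subsetP => g gP; rewrite -(Aeq f g) //.
move: Pp fP gP; rewrite active_partitionE inE => /mapP[a _ ->].
by rewrite part_lohi !inE => /andP[_ /eqP ->] /andP[_ /eqP ->].
Qed.

Lemma acyclicE : acyclic G s = (Ext G T == set0).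
Proof.
have [u [tab lv _]] := o; rewrite (ExtE tab lv) -(activeE o).
apply/forallP/eqP => [nocyc|A0 C].
  apply/setP => a; rewrite !inE; apply/existsP => -[C /andP[dC _]].
  by have := nocyc C; rewrite dC.
apply/negP => dC; have [m mC] := dcycle_min dC.
have : m \in active G s by rewrite inE; apply/existsP; exists C; rewrite dC.
by rewrite A0 inE.
Qed.

Lemma strongly_connectedE : strongly_connected G s = (Int G T == set0).
Proof.
have [u [tab lv _]] := o; rewrite (IntE tab lv) -(dual_activeE o).
have all_neg : strongly_connected G s = [forall f in edges G, lev f < 0].
  apply: eq_forallb => f; case: (boolP (f \in edges G)) => //= fG.
  have := dcycle_union_all o => /setP/(_ f); rewrite [RHS]inE fG /= => <-.
  apply/existsP/bigcupP => [[C /andP[dC fC]]|[C dC fC]]; exists C => //.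
  by rewrite dC.
rewrite all_neg; apply/forallP/eqP => [neg|D0 f].
  apply/setP => a; rewrite (dual_activeE o) !inE.
  have := neg a; case: (a \in edges G) => //=; lia.
apply/implyP => fG; have := lev_nz o fG; rewrite neq_lt => /orP[//|f0].
by have [a [_ /(_ f0) + _]] := level_rep o fG; rewrite D0 inE.
Qed.

Lemma bipolar_uniactive p : is_min (edges G) p ->
  bipolar G s p = uniactive_internal G T.
Proof.
move=> pm; have [u [tab lv _]] := o.
rewrite (bipolarE o pm) /uniactive_internal (gopt_spanning o) /=.
rewrite (IntE tab lv) (ExtE tab lv).
exact: (single_level_card (graph_opair G) o pm).
Qed.

Lemma cyclic_bipolar_uniactive p : is_min (edges G) p ->
  cyclic_bipolar G s p = uniactive_external G T.
Proof.
move=> pm; have [u [tab lv _]] := o.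
rewrite (cyclic_bipolarE o pm) /uniactive_external (gopt_spanning o) /=.
rewrite (IntE tab lv) (ExtE tab lv).
have E0 := single_level_card (opair_dual (graph_opair G)) (opt_dual o) pm.
rewrite andbC (_ : [forall f in _, _] = [forall f in edges G, - lev f == (rk
  p).+1%:Z]).
  rewrite E0; congr (_ && _); congr (_ == _); apply: eq_card => a;
  by rewrite !inE ?eqr_oppLR ?eqr_opp.
by apply: eq_forallb => f; rewrite eqr_oppLR.
Qed.

(** With a single level the only parts that can be reversed are the empty set
    and the whole edge set. *)
Lemma single_class p : edges G = [set: E] -> p \in edges G ->
  {in edges G, forall f, lev f = lev p} ->
  activity_class G s = [set s; opposite s].
Proof.
move=> GE pG single; have GT f : f \in edges G by rewrite GE inE.
have [P Pp pP] := partition_cover pG.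
have PE A : A \in active_partition G s -> A = [set: E].
  move=> Ap; have [f fA] := partition_nonempty Ap; apply/setP => g; rewrite inE.
  by rewrite (partition_level Ap (GT g) (GT f)) // (single f) ?(single g).
apply/setP => s'; apply/imsetP/set2P => [[Q]|[->|->]].
- rewrite inE => /subsetP Qp ->.
  have [->|/set0Pn[A AQ]] := eqVneq Q set0.
    by left; apply/ffunP => f; rewrite ffunE /cover big_set0 inE.
  right; apply/ffunP => f; rewrite !ffunE inE.
  suff -> : f \in cover Q by [].
  by apply/bigcupP; exists A; rewrite // (PE A (Qp A AQ)) inE.
- exists set0; first by rewrite inE sub0set.
  by apply/ffunP => f; rewrite ffunE /cover big_set0 inE.
- exists [set P]; first by rewrite inE sub1set.
  by apply/ffunP => f; rewrite !ffunE /cover big_set1 (PE P Pp).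
Qed.

End OneClass.

(** Any signs can be given to the active edges. *)
Lemma gopt_surjective G T : spanning_tree G T -> exists s lev, gopt G s T lev.
Proof.
case/spanning_tree_tab=> u tab; have [lev lv] := levelling_exists (graph_opair
  G) tab.
have [s [co _]] := orient_exists (edges G) u lev (fun=> false).
have sE : finfun s =1 s by move=> f; rewrite ffunE.
exists (finfun s), lev, u; split=> // f m fG um lm mf mmin.
by rewrite /sg !sE; exact: co.
Qed.

Section Bijections.
Variables (G : graph V E) (alpha : orientation E -> {set E}).
Hypothesis GE : edges G = [set: E].
Hypothesis alphaP : forall s, exists lev, gopt G s (alpha s) lev.

Lemma alpha_onto T : spanning_tree G T -> exists s, alpha s = T.
Proof.
case/gopt_surjective=> s [lev o]; exists s; have [lev' o'] := alphaP s.
exact: (gopt_tree o' o).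
Qed.

Lemma mem_class s s' : (s' \in activity_class G s) = (alpha s' == alpha s).
Proof.
have [lev o] := alphaP s; have [lev' o'] := alphaP s'.
apply/idP/eqP => [/(gopt_class o)/(gopt_tree o')//|ss'].
by apply: (class_complete o (lev' := lev') GE); rewrite -ss'.
Qed.

(** A class is a fibre of alpha, so any property of orientations that can be
    read from the tree yields a bijection. *)
Lemma class_bijection (phi : pred (orientation E)) (psi : pred {set E})
    (cls : orientation E -> {set orientation E}) :
    (forall s, phi s = psi (alpha s)) ->
    (forall s, phi s -> cls s = activity_class G s) ->
    (forall T, psi T -> spanning_tree G T) ->
  let K := [set cls s | s : orientation E & phi s] in
  let TT := [set T | psi T] in
  induces_bijection alpha K TT /\ #|K| = #|TT|.
Proof.
move=> phiE clsE psiT K TT.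
pose f (k : {set orientation E}) := odflt set0 [pick T | [exists s in k, alpha s
  == T]].
have fE s : phi s -> f (cls s) = alpha s.
  move=> ps; rewrite /f clsE //; case: pickP => [T /existsP[s' /andP[ss' /eqP
    <-]]|/(_ (alpha s))].
    by move: ss'; rewrite mem_class => /eqP.
  by move/negbT/existsPn/(_ s); rewrite mem_class !eqxx.
have inj : {in K &, injective f}.
  move=> k k' /imsetP[s +  ->] /imsetP[s' + ->]; rewrite !inE => ps ps'.
  rewrite !fE // => ss'.
  by rewrite !clsE //; apply/setP => s''; rewrite !mem_class ss'.
have img : f @: K = TT.
  apply/setP => T; rewrite [RHS]inE; apply/imsetP/idP => [[k /imsetP[s]]|pT].
    by rewrite inE => ps -> ->; rewrite fE // -phiE.
  have [s sT] := alpha_onto (psiT T pT).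
  have ps : phi s by rewrite phiE sT.
  by exists (cls s); [apply/imsetP; exists s; rewrite ?inE | rewrite fE].
split; last by rewrite -img card_in_imset.
exists f; split=> // k /imsetP[s + ->] s'; rewrite inE => ps.
rewrite fE // clsE // mem_class.
by move/eqP.
Qed.

End Bijections.

Lemma tutte_eval G (x y : int) : (tutte G).[x, y] =
  \sum_(T | spanning_tree G T) x ^+ #|Int G T| * y ^+ #|Ext G T|.
Proof.
rewrite /tutte !horner_sum.
under eq_bigr => i _ do rewrite !horner_sum.
have -> : \sum_(T | spanning_tree G T) x ^+ #|Int G T| * y ^+ #|Ext G T| =
  \sum_(T | spanning_tree G T) \sum_(i < #|E|.+1) \sum_(j < #|E|.+1)
    ((#|Int G T| == i) && (#|Ext G T| == j))%:R * (y ^+ j * x ^+ i).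
  apply: eq_bigr => T _.
  have iT : (#|Int G T| < #|E|.+1)%N by rewrite ltnS max_card.
  have jT : (#|Ext G T| < #|E|.+1)%N by rewrite ltnS max_card.
  rewrite (bigD1 (Ordinal iT)) //= [X in _ + X]big1 ?addr0 => [|i ii];
    last first.
    apply: big1 => j _; case: eqP => [Ei|]; last by rewrite mul0r.
    by case/eqP: ii; apply: val_inj.
  rewrite (bigD1 (Ordinal jT)) //= big1 ?addr0 => [|j jj]; last first.
    rewrite eqxx /=; case: eqP => [Ej|]; last by rewrite mul0r.
    by case/eqP: jj; apply: val_inj.
  by rewrite !eqxx mul1r mulrC.
rewrite [RHS]exchange_big; apply: eq_bigr => i _ /=.
rewrite [RHS]exchange_big; apply: eq_bigr => j _ /=.
have natE (n : nat) : (n%:R : {poly {poly int}}).[x, y] = n%:R.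
  by rewrite !hornerMn !hornerE.
rewrite -mulr_suml !hornerM natE !hornerE /= ?mulrA; congr (_ * _ * _).
rewrite /tutte_coef -sum1_card natr_sum big_mkcond [RHS]big_mkcond /=.
by apply: eq_bigr => T _; rewrite inE; case: (spanning_tree G T) => //=;
  case: ifP.
Qed.

Lemma card_trees G (psi : nat -> nat -> bool) (x y : int) :
    (forall i j, x ^+ i * y ^+ j = (psi i j)%:R) ->
  #|[set T | spanning_tree G T && psi #|Int G T| #|Ext G T|]|%:R = (tutte G).[x,
    y].
Proof.
move=> xy; rewrite tutte_eval -sum1_card natr_sum big_mkcond [RHS]big_mkcond.
apply: eq_bigr => T _; rewrite inE; case: (spanning_tree G T) => //=.
by rewrite xy; case: (psi _ _).
Qed.

End Classes.

(** * The active bijection *)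

Section ActiveBijection.
Context {V : finType} {d : Order.disp_t} {E : finOrderType d}.

Lemma alpha_exists : exists alpha : tree_map (V := V) (E := E),
  forall G s, exists lev, gopt G s (alpha G s) lev.
Proof.
have [|f fP] := @functional_choice (graph V E * orientation E) {set E}
    (fun Gs T => exists lev, gopt Gs.1 Gs.2 T lev).
  by case=> G s; exact: gopt_exists.
by exists (fun G s => f (G, s)) => G s; exact: fP (G, s).
Qed.

Lemma alpha_ext (alpha beta : tree_map (V := V) (E := E)) :
  (forall G s, exists lev, gopt G s (alpha G s) lev) ->
  (forall G s, beta G s = alpha G s) ->
  forall G s, exists lev, gopt G s (beta G s) lev.
Proof. by move=> alphaP ba G s; rewrite ba. Qed.

End ActiveBijection.

Theorem theorem4p9 (V : finType) (d : Order.disp_t) (E : finOrderType d)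
    (G : graph V E) (hE : edges G = [set: E]) (hG : connected G) :
  exists alpha : tree_map (V := V) (E := E),
  [/\
    forall beta : tree_map (V := V) (E := E),
      [/\ alpha_inductive beta <-> (forall H s, beta H s = alpha H s),
          alpha_sequential beta <-> (forall H s, beta H s = alpha H s)
        & alpha_relaxed beta <-> (forall H s, beta H s = alpha H s)],
    forall s : orientation E,
      [/\ spanning_tree G (alpha G s),
          forall Fs : filtration E,
            tree_filtration G (alpha G s) Fs <-> Fs = active_filtration G s,
          Int G (alpha G s) = dual_active G s
        & Ext G (alpha G s) = active G s],
    forall (s : orientation E) (i j : nat),
      #|dual_active G s| = i -> #|active G s| = j ->
      #|activity_class G s| = (2 ^ (i + j))%N /\
      (forall s', s' \in activity_class G s ->
         [/\ #|dual_active G s'| = i, #|active G s'| = j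
           & alpha G s' = alpha G s])
  &
    [/\ forall T, spanning_tree G T -> exists s, alpha G s = T,
        let K := [set activity_class G s | s : orientation E] in
        let TT := [set T | spanning_tree G T] in
        [/\ induces_bijection (alpha G) K TT,
            (#|K|%:R = (tutte G).[1, 1])%R & (#|TT|%:R = (tutte G).[1, 1])%R],
        let K := [set activity_class G s | s : orientation E & acyclic G s] in
        let TT := [set T | internal_tree G T] in
        [/\ induces_bijection (alpha G) K TT,
            (#|K|%:R = (tutte G).[1, 0])%R & (#|TT|%:R = (tutte G).[1, 0])%R],
        let K :=
          [set activity_class G s | s : orientation E & strongly_connected G s]
        in
        let TT := [set T | external_tree G T] in
        [/\ induces_bijection (alpha G) K TT,
            (#|K|%:R = (tutte G).[0, 1])%R & (#|TT|%:R = (tutte G).[0, 1])%R]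
      & forall p : E, is_min (edges G) p ->
        (let K := [set [set s; opposite s] | s : orientation E & bipolar G s p]
         in
         let TT := [set T | uniactive_internal G T] in
         [/\ induces_bijection (alpha G) K TT,
             #|K| = tutte_coef G 1 0 & #|TT| = tutte_coef G 1 0])
        /\
        (let K :=
           [set [set s; opposite s] | s : orientation E & cyclic_bipolar G s p]
         in
         let TT := [set T | uniactive_external G T] in
         [/\ induces_bijection (alpha G) K TT,
             #|K| = tutte_coef G 0 1 & #|TT| = tutte_coef G 0 1])]].
Proof.
have [alpha alphaP] := @alpha_exists V d E; exists alpha.
have IntA s : Int G (alpha G s) = dual_active G s.
  by have [lev o] := alphaP G s; have [u [tab lv _]] := o;
    rewrite (IntE tab lv) (dual_activeE o).
have ExtA s : Ext G (alpha G s) = active G s.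
  by have [lev o] := alphaP G s; have [u [tab lv _]] := o;
    rewrite (ExtE tab lv) (activeE o).
split.
- move=> beta; split; split=> [|ba].
  + exact: inductive_unique.
  + exact: alpha_is_inductive (alpha_ext alphaP ba).
  + exact: sequential_unique.
  + exact: alpha_is_sequential (alpha_ext alphaP ba).
  + exact: relaxed_unique.
  + exact: alpha_is_relaxed (alpha_ext alphaP ba).
- move=> s; have [lev o] := alphaP G s; split=> //;
    first exact: gopt_spanning o.
  by move=> Fs; exact: tree_filtrationP o.
- move=> s i j <- <-; have [lev o] := alphaP G s.
  split=> [|s' s'c]; first exact: (card_activity_class o).
  have -> : alpha G s' = alpha G s := alphaE alphaP (gopt_class o s'c).
  have [lev' o'] := alphaP G s'.
  by rewrite -!IntA -!ExtA (alphaE alphaP (gopt_class o s'c)).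
have alphaG s : exists lev, gopt G s (alpha G s) lev := alphaP G s.
have bij := class_bijection hE alphaG.
have spT s : spanning_tree G (alpha G s) by have [lev /gopt_spanning] := alphaP
  G s.
split.
- exact: (alpha_onto alphaG).
- have [|||b c] := bij (fun=> true) (spanning_tree G) (activity_class G) => //.
    by move=> s; rewrite spT.
  have TT : (#|[set T | spanning_tree G T]|%:R = (tutte G).[1, 1])%R.
    rewrite -(@card_trees _ _ _ G (fun _ _ => true) 1 1) => [|i j];
      last by rewrite !expr1n mulr1.
    by congr (_%:R)%R; apply: eq_card => T; rewrite !inE andbT.
  have KE : [set activity_class G s | s : orientation E] =
      [set activity_class G s | s : orientation E & true].
    by apply/setP => k; apply/imsetP/imsetP => -[s _ ->]; exists s;
      rewrite ?inE.
  by rewrite KE; split; [exact: b | rewrite -TT; congr (_%:R)%R;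
    exact: c | exact: TT].
- have [|||b c] := bij (acyclic G) (internal_tree G) (activity_class G) => //.
    by move=> s; have [lev o] := alphaP G s; rewrite (acyclicE o) /internal_tree
      spT.
    by move=> T /andP[].
  have TT : (#|[set T | internal_tree G T]|%:R = (tutte G).[1, 0])%R.
    rewrite -(@card_trees _ _ _ G (fun _ j => j == 0) 1 0) => [|i j];
      last by rewrite expr1n mul1r expr0n.
    by congr (_%:R)%R; apply: eq_card => T; rewrite !inE cards_eq0.
  by split; [exact: b | rewrite -TT; congr (_%:R)%R; exact: c | exact: TT].
- have [|||b c] := bij (strongly_connected G) (external_tree G) (activity_class
    G) => //.
    by move=> s; have [lev o] := alphaP G s; rewrite (strongly_connectedE o)
      /external_tree spT.
    by move=> T /andP[].
  have TT : (#|[set T | external_tree G T]|%:R = (tutte G).[0, 1])%R.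
    rewrite -(@card_trees _ _ _ G (fun i _ => i == 0) 0 1) => [|i j];
      last by rewrite expr1n mulr1 expr0n.
    by congr (_%:R)%R; apply: eq_card => T; rewrite !inE cards_eq0.
  by split; [exact: b | rewrite -TT; congr (_%:R)%R; exact: c | exact: TT].
move=> p pm; have pG := proj1 (andP pm); split.
- have [|||b c] := bij (fun s => bipolar G s p) (uniactive_internal G) (fun s =>
    [set s; opposite s]).
  + by move=> s; have [lev o] := alphaP G s; exact: (bipolar_uniactive o pm).
  + move=> s; have [lev o] := alphaP G s; rewrite (bipolarE o pm) => /forallP
      levp.
    rewrite (single_class o hE pG) // => f fG.
    by rewrite (eqP (implyP (levp f) fG)) (eqP (implyP (levp p) pG)).
  + by move=> T /andP[].
  by split=> //; rewrite c.
- have [|||b c] := bij (fun s => cyclic_bipolar G s p) (uniactive_external G)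
    (fun s => [set s; opposite s]).
  + by move=> s; have [lev o] := alphaP G s; exact: (cyclic_bipolar_uniactive o
      pm).
  + move=> s; have [lev o] := alphaP G s; rewrite (cyclic_bipolarE o pm) =>
      /forallP levp.
    rewrite (single_class o hE pG) // => f fG.
    by rewrite (eqP (implyP (levp f) fG)) (eqP (implyP (levp p) pG)).
  + by move=> T /andP[].
  by split=> //; rewrite c.
Qed.
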